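(* Let $D\subseteq\mathbb{C}^2$ be a pseudoconvex domain with smooth boundary $M$, let $p\in M$ be a point of finite type $k$ with $k>2$, let $\mu$ be the weight of the complex nontangential direction at $p$, and let $P(z,\bar z,u)$ be the polynomial defining a generalized model $v=P(z,\bar z,u)$ to $M$ at $p$ (in fixed local holomorphic coordinates corresponding to the weight vector $(\frac1k,\mu)$). If $M$ is locally convexifiable at $p$, then there exists $h\in\mathbb{H}_{k,\mu}$ such that $$D^2_z(P+h)(z,u;\zeta)\ge 0\quad\text{for all }\big((z,u),\zeta\big)\in S_2\times S_1.$$
   Context: **Coordinates and type.** The type of $p\in M$ is the maximal order of contact of $M$ with complex curves passing through $p$. Here $k>2$ is the (finite) type of $p$; by pseudoconvexity $k$ is even. Local holomorphic coordinates $(z,w)$, $z=x+iy$, $w=u+iv$, are centered at $p$ and chosen so that the positive $v$-axis is the inner normal direction to $D$ at $p$; near $p$, $M$ is given by $v=F(z,\bar z,u)$. Such coordinates can be chosen so that $v=P_1(z,\bar z)+o(|z|^k,u)$, where $P_1$ is a real-valued homogeneous polynomial of degree $k$ of the form $P_1(z,\bar z)=a_0|z|^k+\sum_{j=2,\dots,k}|z|^{k-j}\,\mathrm{Re}(a_jz^j)$ with $a_j\in\mathbb{C}$ and $a_0>0$. **Weights.** A weight vector is a pair of rational numbers $\lambda=(\lambda_1,\lambda_2)$, with $\lambda_2>0$, such that $\lambda_1=\frac1n$ for some $n\in\mathbb{N}$ and there exist integers $k_1\ge 0$, $k_2>0$ with $k_1\lambda_1+k_2\lambda_2=1$. The monomial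 $c\,z^i\bar z^ju^l$ has weight $(i+j)\lambda_1+l\lambda_2$. A real-valued polynomial in $z,\bar z,u$ is $\lambda$-homogeneous of weight $\gamma$ if it is a sum of monomials of weight $\gamma$; the same weight assignment and notion of homogeneity are used for $\lambda=(\frac1k,0)$. A weight vector $(\frac1k,\lambda_2)$ is allowable if there are local holomorphic coordinates $(z,w)$, $z=x+iy$, $w=u+iv$, centered at $p$ and with the positive $v$-axis being the inner normal direction to $D$ at $p$, in which the defining equation has the form $v=P(z,\bar z,u)+o_{wt}(1)$, where $$P(z,\bar z,u)=\sum_{\frac mk+\lambda_2l=1}\ \sum_{j=0}^m a_{mjl}z^j\bar z^{m-j}u^l$$ is $\lambda$-homogeneous of weight one and $o_{wt}(1)$ denotes terms (in the Taylor expansion) of weight bigger than one with respect to $(\frac1k,\lambda_2)$. For any $\delta>0$ only finitely many $\lambda_2>\delta$ make $(\frac1k,\lambda_2)$ a weight vector. If the set of allowable values of $\lambda_2$ is finite, $\mu$ is the smallest of them; if this set is not bounded away from zero, $\mu=0$. The number $\mu$ is the weight of $w$ and $u$. **Generalized model.** If $\mu>0$, fix local holomorphic coordinates in which the defining equation is $v=P(z,\bar z,u)+o_{wt}(1)$, with $P(z,\bar z,u)=\sum_{\frac mk+\mu l=1}\ \sum_{j=0}^m a_{mjl}z^j\bar z^{m-j}u^l$ and $o_{wt}(1)$ denoting terms of weight bigger than one with respect to $(\frac1k,\mu)$; the hypersurface $v=P(z,\bar z,u)$ is a generalized model to $M$ at $p$. If $\mu=0$, a generalized model is $v=P_1(z,\bar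 z)$, i.e. $P=P_1$. **The space $\mathbb{H}_{k,\mu}$.** $\mathbb{H}_{k,\mu}$ is the set of all real-valued $(\frac1k,\mu)$-homogeneous polynomials in $z,u$ (i.e. in $z,\bar z,u$) of weight one that are harmonic in the $z$ variable (for $\mu>0$: those of the form $\mathrm{Re}\sum_{\frac mk+\mu l=1}\alpha_mz^mu^l$, $\alpha_m\in\mathbb{C}$). **Hessian in the $z$-direction.** For $(z,u)\in\mathbb{C}\times\mathbb{R}$, $\zeta\in\mathbb{C}$, $z=x_1+ix_2$, $\zeta=\xi_1+i\xi_2$, set $$D^2_zP(z,u;\zeta)=\sum_{i,j=1}^2\frac{\partial^2P}{\partial x_i\partial x_j}(z,u)\,\xi_i\xi_j.$$ Also $S_2=\{(z,u)\in\mathbb{C}\times\mathbb{R}:|z|^2+u^2=1\}$ and $S_1=\{\zeta\in\mathbb{C}:|\zeta|=1\}$. **Local convexifiability.** $M$ is locally convexifiable at $p$ if there exist local holomorphic coordinates in a full neighbourhood of $p$ such that $M$ is convex with respect to the underlying linear space. *)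

(* Defs.v *)
From HB Require Import structures.
From mathcomp Require Import all_boot all_order all_algebra.
From mathcomp Require Import complex.
From mathcomp Require Import all_classical all_reals all_analysis.

Set Implicit Arguments.
Unset Strict Implicit.
Unset Printing Implicit Defensive.

Import Order.TTheory GRing.Theory Num.Theory.
Import numFieldNormedType.Exports.

Local Open Scope classical_set_scope.
Local Open Scope ring_scope.
Local Open Scope complex_scope.

(* C as a normed space over itself, as the library does for abstract number
   fields; differentiable maps between powers of C are then the holomorphic
   ones. *)
#[non_forgetful_inheritance]
HB.instance Definition _ (R : realType) := NormedModule.copy R[i] R[i]^o.

Section Smooth.
Context {R : realType} {n : nat}.

Definition partials (s : seq 'I_n) (f : 'rV[R]_n -> R) : 'rV[R]_n -> R :=
  foldr (fun i g => 'D_(delta_mx 0 i) g) f s.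

(* C^oo on a neighbourhood of x: all iterated partial derivatives are
   Frechet differentiable there. *)
Definition smooth_near (f : 'rV[R]_n -> R) (x : 'rV[R]_n) : Prop :=
  \forall y \near x, forall s : seq 'I_n, differentiable (partials s f) y.

(* R^(2n) is identified with C^n by (x_1..x_n, y_1..y_n) |-> (x_j + i y_j). *)
Definition toC (x : 'rV[R]_(n + n)) : 'rV[R[i]]_n :=
  \row_j (x 0 (lshift n j) +i* x 0 (rshift n j)).

Definition ofC (z : 'rV[R[i]]_n) : 'rV[R]_(n + n) :=
  row_mx (\row_j complex.Re (z 0 j)) (\row_j complex.Im (z 0 j)).

End Smooth.

Section Domains.
Context {R : realType}.
Notation C2 := 'rV[R[i]]_2.

Definition bd (D : set C2) : set C2 := closure D `\` D°.

Definition partialsC (s : seq 'I_(2 + 2)) (r : C2 -> R) (q : C2) : R :=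
  partials s (r \o toC) (ofC q).

Definition defining_function (D : set C2) (q : C2) (r : C2 -> R) : Prop :=
  [/\ smooth_near (r \o toC) (ofC q),
      exists i, partialsC [:: i] r q != 0
    & \forall x \near q, D x <-> r x < 0].

Definition smooth_boundary (D : set C2) : Prop :=
  forall q, bd D q -> exists r, defining_function D q r.

(* dr / dz_j at q *)
Definition dz (r : C2 -> R) (q : C2) (j : 'I_2) : R[i] :=
  2^-1 * (partialsC [:: lshift 2 j] r q -i* partialsC [:: rshift 2 j] r q).

(* d^2 r / dz_j d(conj z_l) at q, i.e. 1/4 (d_xj - i d_yj) (d_xl + i d_yl) r *)
Definition dzdzbar (r : C2 -> R) (q : C2) (j l : 'I_2) : R[i] :=
  4^-1 * ((partialsC [:: lshift 2 j; lshift 2 l] r q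
            + partialsC [:: rshift 2 j; rshift 2 l] r q)
          +i* (partialsC [:: lshift 2 j; rshift 2 l] r q
            - partialsC [:: rshift 2 j; lshift 2 l] r q)).

(* Levi pseudoconvexity, the usual definition for smoothly bounded domains. *)
Definition pseudoconvex (D : set C2) : Prop :=
  forall q r, bd D q -> defining_function D q r ->
  forall t : C2, \sum_j dz r q j * t 0 j = 0 ->
    0 <= \sum_j \sum_l dzdzbar r q j l * t 0 j * (t 0 l)^*.

(* g(t) - p vanishes to order exactly m at t = 0; for some m this says that the
   germ of g is not constant. Curves with m > 1 may be singular. *)
Definition curve_germ (p : C2) (g : R[i] -> C2) (m : nat) : Prop :=
  [/\ \forall t \near (0 : R[i]), differentiable g t,
      g 0 = p,
      ((fun t => g t - p) =O_ (0 : R[i]) (fun t => t ^+ m))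
    & ~ ((fun t => g t - p) =O_ (0 : R[i]) (fun t => t ^+ m.+1))].

Definition vanishes_to_order (N : nat) (f : R[i] -> R) : Prop :=
  (fun t => (f t)%:C) =O_ (0 : R[i]) (fun t => t ^+ N).

(* The order of contact of the boundary with a curve g is ord (r o g) / ord g,
   which does not depend on the parametrization; k is its maximum. *)
Definition finite_type (D : set C2) (p : C2) (k : nat) : Prop :=
  exists2 r, defining_function D p r &
    (exists g m, curve_germ p g m /\ vanishes_to_order (k * m) (r \o g)) /\
    (forall g m N, curve_germ p g m -> vanishes_to_order N (r \o g) ->
       (N <= k * m)%N).

Definition biholomorphic (U V : set C2) (f g : C2 -> C2) : Prop :=
  [/\ open U, open V,
      forall x, U x -> [/\ V (f x), g (f x) = x & differentiable f x]
    & forall y, V y -> [/\ U (g y), f (g y) = y & differentiable g y]].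

(* "M is convex" in the coordinates f: the side D of M is convex there. *)
Definition locally_convexifiable (D : set C2) (p : C2) : Prop :=
  exists U V f g, [/\ U p, biholomorphic U V f g &
    @convex_set R 'rV[R]_(2 + 2) (toC @^-1` (f @` (D `&` U)))].

(* Real coordinates (x, y, u) on C x R. *)
Definition ix : 'I_3 := @Ordinal 3 0 isT.
Definition iy : 'I_3 := @Ordinal 3 1 isT.
Definition iu : 'I_3 := @Ordinal 3 2 isT.

Definition real3 (P : R[i] -> R -> R) : 'rV[R]_3 -> R :=
  fun X => P (X 0 ix +i* X 0 iy) (X 0 iu).

Definition pt3 (z : R[i]) (u : R) : 'rV[R]_3 :=
  \row_i (if i == ix then complex.Re z
          else if i == iy then complex.Im z else u).

(* Holomorphic coordinates (z, w) = f (with inverse g) centered at p, in which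
   D is { v > F(x, y, u) } near 0. As F vanishes to second order at 0, the
   positive v-axis is the inner normal to D at p. *)
Definition normal_coordinates (D : set C2) (p : C2) (f g : C2 -> C2)
    (F : 'rV[R]_3 -> R) : Prop :=
  [/\ exists U V, U p /\ biholomorphic U V f g,
      f p = 0,
      smooth_near F 0,
      F 0 = 0 /\ (forall i, partials [:: i] F 0 = 0)
    & \forall q \near (0 : C2),
        D (g q) <-> F (pt3 (q 0 0) (complex.Re (q 0 1))) < complex.Im (q 0 1)].

Definition weight (k : nat) (lam : rat) (m l : nat) : rat :=
  m%:R / k%:R + l%:R * lam.

(* (1/k, lam) is a weight vector *)
Definition is_weight_vector (k : nat) (lam : rat) : Prop :=
  0 < lam /\ exists k1 k2 : nat, (0 < k2)%N /\ weight k lam k1 k2 = 1.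

(* A monomial c z^i (conj z)^j u^l is coded by (c, (i, j, l)). *)
Definition monomial (e : R[i] * (nat * nat * nat)) (z : R[i]) (u : R) : R[i] :=
  let: (c, (i, j, l)) := e in c * z ^+ i * z^* ^+ j * u%:C ^+ l.

Definition weight_homogeneous (k : nat) (lam gam : rat) (P : R[i] -> R -> R)
    : Prop :=
  exists s : seq (R[i] * (nat * nat * nat)),
    (forall c i j l, (c, (i, j, l)) \in s -> weight k lam (i + j) l = gam) /\
    (forall z u, (P z u)%:C = \sum_(e <- s) monomial e z u).

(* All terms of the Taylor expansion of f at 0 have weight > 1. *)
Definition o_wt1 (k : nat) (lam : rat) (f : 'rV[R]_3 -> R) : Prop :=
  forall s : seq 'I_3,
    weight k lam (count (predC1 iu) s) (count_mem iu s) <= 1 ->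
    partials s f 0 = 0.

Definition weighted_model (D : set C2) (p : C2) (k : nat) (lam : rat)
    (P : R[i] -> R -> R) : Prop :=
  weight_homogeneous k lam 1 P /\
  exists f g F, normal_coordinates D p f g F /\
    o_wt1 k lam (fun X => F X - real3 P X).

Definition allowable (D : set C2) (p : C2) (k : nat) : set rat :=
  [set lam | is_weight_vector k lam /\ exists P, weighted_model D p k lam P].

Definition weight_of_w (D : set C2) (p : C2) (k : nat) (mu : rat) : Prop :=
  [/\ finite_set (allowable D p k), allowable D p k mu
     & forall lam, allowable D p k lam -> mu <= lam] \/
  (mu = 0 /\ forall d, 0 < d -> exists2 lam, allowable D p k lam & lam < d).

(* P = P_1(z), in coordinates where v = P_1 + o(|z|^k, u). Homogeneity for the
   weights (1/k, 0) makes P_1 a polynomial of degree k, which rules out a_j <> 0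
   for odd k - j. *)
Definition unweighted_model (D : set C2) (p : C2) (k : nat)
    (P : R[i] -> R -> R) : Prop :=
  [/\ weight_homogeneous k 0 1 P,
      exists (a0 : R) (a : nat -> R[i]), 0 < a0 /\ forall z u,
        P z u = a0 * Normc.normc z ^+ k +
          \sum_(2 <= j < k.+1)
             Normc.normc z ^+ (k - j) * complex.Re (a j * z ^+ j)
    & exists f g F, normal_coordinates D p f g F /\
        (fun X => F X - real3 P X) =o_ (0 : 'rV[R]_3)
        real3 (fun z u => Normc.normc z ^+ k + `|u|)].

Definition generalized_model (D : set C2) (p : C2) (k : nat) (mu : rat)
    (P : R[i] -> R -> R) : Prop :=
  (0 < mu /\ weighted_model D p k mu P) \/
  (mu = 0 /\ unweighted_model D p k P).

Definition Hspace (k : nat) (mu : rat) : set (R[i] -> R -> R) :=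
  [set h | weight_homogeneous k mu 1 h /\ forall z u,
     partials [:: ix; ix] (real3 h) (pt3 z u)
       + partials [:: iy; iy] (real3 h) (pt3 z u) = 0].

Definition Dz2 (P : R[i] -> R -> R) (z : R[i]) (u : R) (zeta : R[i]) : R :=
  let e := [:: (ix, complex.Re zeta); (iy, complex.Im zeta)] in
  \sum_(a <- e) \sum_(b <- e)
     partials [:: a.1; b.1] (real3 P) (pt3 z u) * a.2 * b.2.

End Domains.

(* Main.v *)
Require Import Defs.
From HB Require Import structures.
From mathcomp Require Import all_boot all_order all_algebra.
From mathcomp Require Import complex zify ring lra.
From mathcomp Require Import all_classical all_reals all_analysis.

Set Implicit Arguments.
Unset Strict Implicit.
Unset Printing Implicit Defensive.

Import Order.TTheory GRing.Theory Num.Theory.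
Import numFieldNormedType.Exports.

Local Open Scope classical_set_scope.
Local Open Scope ring_scope.
Local Open Scope complex_scope.

(** Let [phi] lead from the normal coordinates [(z, w)] of the model to the
   coordinates in which the boundary is convex. At a boundary point [q] near
   the origin and for a complex tangent direction [(zeta, al)], with
   [al = i dF(zeta)], the real line through [phi q] in the direction
   [dphi (zeta, al)] corresponds to a curve in the coordinates [(z, w)] with
   acceleration [kappa = zeta ^ 2 K + zeta al L + al ^ 2 H], where [K], [L] and
   [H] depend holomorphically on [q] ([acceleration]). Convexity makes the
   second derivative of [F - Im w] along this curve nonnegative
   ([second_order]):
   [0 <= D2F(zeta) + F_x Re kappa_0 + F_y Im kappa_0 + F_u Re kappa_1 - Im kappa_1].

   This is evaluated above the points [(t ^ a z, t ^ b u)], for integers [a]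
   and [b] proportional to [1 / k] and [mu], with [N] the integer corresponding
   to the weight one, and [M = N - 2 a]. There the Hessian of [F] is
   [t ^ M D2P(zeta) + O(t ^ (M + 1))] by homogeneity. Apart from
   [F_u Re (zeta ^ 2 K_1)], which the small factor [F_u] renders harmless, all
   other terms with a derivative of [F] are [O(t ^ (M + 1))], which leaves
   [Im (zeta ^ 2 K_1) <= t ^ M D2P(zeta)] up to small errors. The left hand side
   changes sign when [zeta] is multiplied by [i], so that [K_1 = O(t ^ M)]
   ([four_directions]). Hence the Taylor expansion of the holomorphic function
   [K_1] starts with the weight [M]; as [w] and [u] differ by [O(t ^ N)] only,
   its part of weight [M] is a polynomial [q] with
   [Im (q(z, u) zeta ^ 2) <= D2P(zeta)] ([convex_limit]). The harmonic function
   [h = Re (i Q)], where [Q] is the second primitive of [q] in [z], has the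
   Hessian [- Im (q zeta ^ 2)] and the weight one, and it is the correction
   ([harmonic_primitive]).

   For [mu = 0] the weights are [a = 1] and [b = N = k]. In this case [P] does
   not depend on [u], and [F - P = o(|z| ^ k + |u|)] makes the derivatives of
   [F - P] of weight at most [N] vanish at the origin ([unweighted_remainder]).

   Everything on holomorphic functions rests on Cauchy's formula for squares,
   in which the integrals are replaced by dyadic Riemann sums: these are
   additive under bisection, as Goursat's argument requires ([goursat],
   [cauchy_sum]). Cauchy's estimates then show that derivatives, also in two
   variables, are holomorphic ([holomorphic_derive]), which yields Taylor
   expansions with respect to weights ([weighted_taylor]). *)

Import Normc.
Local Notation Re := complex.Re.
Local Notation Im := complex.Im.

(** * Moduli of complex numbers as real numbers *)

Section Modulus.
Context {R : realType}.
Local Notation C := R[i].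
Implicit Types (z w : C) (x : R).

Lemma normc_ge0 z : 0 <= normc z.
Proof. by case: z => a b; rewrite sqrtr_ge0. Qed.

Lemma normc_abs z : `|z| = (normc z)%:C.
Proof. by case: z. Qed.

Lemma normc_eq0 z : (normc z == 0) = (z == 0).
Proof.
by apply/eqP/eqP => [/eq0_normc//|->]; rewrite normc0.
Qed.

Lemma normc_gt0 z : (0 < normc z) = (z != 0).
Proof. by rewrite lt_def normc_eq0 normc_ge0 andbT. Qed.

Lemma normcR x : normc x%:C = `|x|.
Proof. by rewrite /= expr0n addr0 sqrtr_sqr. Qed.

Lemma normci : normc 'i = 1 :> R.
Proof. by rewrite /= expr0n add0r expr1n sqrtr1. Qed.

Lemma normc_sub z w : normc (z - w) = normc (w - z).
Proof. by rewrite -normcN opprB. Qed.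

Lemma normc_le_dist z w : normc z <= normc w + normc (z - w).
Proof. by rewrite -{1}[z](subrK w) addrC le_normcD. Qed.

Lemma normcX z n : normc (z ^+ n) = normc z ^+ n.
Proof.
by elim: n => [|n IH]; rewrite ?expr0 ?normc1// !exprS normcM IH.
Qed.

Lemma normc_sum (I : Type) (r : seq I) (P : pred I) (F : I -> C) :
  normc (\sum_(i <- r | P i) F i) <= \sum_(i <- r | P i) normc (F i).
Proof.
elim/big_rec2 : _ => [|i y z _ h]; first by rewrite normc0.
by rewrite (le_trans (le_normcD _ _))// lerD2l.
Qed.

Lemma Re_le_normc z : `|Re z| <= normc z.
Proof.
case: z => a b /=; rewrite -sqrtr_sqr ler_wsqrtr// lerDl; exact: sqr_ge0.
Qed.

Lemma Im_le_normc z : `|Im z| <= normc z.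
Proof.
case: z => a b /=; rewrite -sqrtr_sqr ler_wsqrtr// lerDr; exact: sqr_ge0.
Qed.

Lemma normc_le_ReIm z : normc z <= `|Re z| + `|Im z|.
Proof.
rewrite {1}[z]complexE (le_trans (le_normcD _ _))//.
by rewrite normcM normci mul1r !normcR.
Qed.

Lemma cReD z w : Re (z + w) = Re z + Re w.
Proof. by case: z; case: w. Qed.
Lemma cImD z w : Im (z + w) = Im z + Im w.
Proof. by case: z; case: w. Qed.
Lemma cReN z : Re (- z) = - Re z.
Proof. by case: z. Qed.
Lemma cImN z : Im (- z) = - Im z.
Proof. by case: z. Qed.
Lemma cReM z w :
  Re (z * w) = Re z * Re w - Im z * Im w.
Proof. by case: z; case: w. Qed.
Lemma cImM z w :
  Im (z * w) = Re z * Im w + Im z * Re w.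
Proof. by case: z; case: w. Qed.

Definition ReImE := (cReD, cImD, cReN, cImN, cReM, cImM).

End Modulus.

(** * Complex differentiability in one variable *)

Section OneVariable.
Context {R : realType}.
Local Notation C := R[i].
Implicit Types (f g : C -> C) (z d : C).

(** Complex differentiability in terms of the real-valued modulus, so that all
   estimates below take place in the ordered field [R]. *)
Definition cderiv f z d := forall e : R, 0 < e -> exists2 r : R, 0 < r &
  forall h, normc h < r -> normc (f (z + h) - f z - d * h) <= e * normc h.

Lemma nbhs_normcP (z : C) (A : set C) :
  nbhs z A <-> exists2 r : R, 0 < r & forall h, normc h < r -> A (z + h).
Proof.
rewrite nbhs_ballP; split=> [[e e0 eA]|[r r0 rA]].
  have er : e = (Re e)%:C by rewrite RRe_real// gtr0_real.
  exists (Re e) => [|h hr]; first by rewrite -ltcR -er.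
  apply: eA; rewrite -ball_normE/= opprD addrA subrr add0r normrN.
  by rewrite normc_abs er ltcR.
exists r%:C => [|w]; first by rewrite /= ltcR.
rewrite -ball_normE/= distrC normc_abs ltcR => /rA.
by rewrite addrC subrK.
Qed.

Lemma cderivP f z : derivable f z 1 <-> exists d, cderiv f z d.
Proof.
split=> [/cvg_ex[d /= /cvgrPdist_le fd]|[d fd]].
- exists d => e e0; have e0' : 0 < e%:C by rewrite ltcR.
  have /nbhs_normcP[r r0 hr] := fd _ e0'; exists r => // h hlt.
  have [->|h0] := eqVneq h 0; first by rewrite addr0 subrr mulr0 subr0 normc0 mulr0.
  have := hr h hlt; rewrite !add0r => /(_ h0).
  rewrite normc_abs lecR => le.
  have -> : f (z + h) - f z - d * h = - h * (d - h^-1 *: (f (h *: 1 + z) - f z)).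
    rewrite /GRing.scale/= mulr1 [h + z]addrC; field; exact: h0.
  by rewrite normcM normcN mulrC ler_wpM2r// normc_ge0.
- apply/cvg_ex; exists d; apply/cvgrPdist_le => e e0.
  have er : e = (Re e)%:C by rewrite RRe_real// gtr0_real.
  have /fd[r r0 hr] : 0 < Re e by rewrite -ltcR -er.
  apply/nbhs_normcP; exists r => // h.
  rewrite add0r => /hr hh h0.
  rewrite normc_abs er lecR.
  have h0' : 0 < normc h by rewrite normc_gt0.
  rewrite -(ler_pM2r h0') -normcM.
  have <- : - (f (z + h) - f z - d * h) = (d - h^-1 *: (f (h *: 1 + z) - f z)) * h.
    rewrite /GRing.scale/= mulr1 [h + z]addrC; field; exact: h0.
  by rewrite normcN.
Qed.

End OneVariable.

Section Squares.
Context {R : realType}.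
Local Notation C := R[i].
Implicit Types (f g : C -> C) (z c v : C) (s h : R).

Lemma nested_intervals (a s : nat -> R) :
  (forall n, 0 <= s n) -> (forall n, a n <= a n.+1) ->
  (forall n, a n.+1 + s n.+1 <= a n + s n) ->
  exists x, forall n, a n <= x <= a n + s n.
Proof.
move=> s0 au ad.
have aM i j : a i <= a (i + j)%N.
  by elim: j => [|j IH]; rewrite ?addn0// addnS (le_trans IH).
have aD i j : a (i + j)%N + s (i + j)%N <= a i + s i.
  by elim: j => [|j IH]; rewrite ?addn0// addnS (le_trans (ad _)).
have aB i j : a i <= a j + s j.
  by rewrite (le_trans (aM i j))// addnC (le_trans _ (aD j i))// lerDl.
have ub n : ubound (range a) (a n + s n) by move=> _ [i _ <-].
exists (sup (range a)) => n; apply/andP; split.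
  by apply: ub_le_sup; [exists (a 0%N + s 0%N); exact: ub | exists n].
by apply: ge_sup; [exists (a 0%N); exists 0%N | exact: ub].
Qed.

Definition sq c s z :=
  (Re c <= Re z <= Re c + s) /\
  (Im c <= Im z <= Im c + s).

Lemma sq_corners c s : 0 <= s -> sq c s c.
Proof. by move=> s0; split; rewrite lexx lerDl. Qed.

Lemma sq_close c s z w : sq c s z -> sq c s w -> normc (w - z) <= s *+ 2.
Proof.
move=> [/andP[a1 a2] /andP[a3 a4]] [/andP[b1 b2] /andP[b3 b4]].
apply: le_trans (normc_le_ReIm _) _; rewrite !ReImE.
by rewrite mulr2n lerD// ler_norml; apply/andP; split; lra.
Qed.

(** Bisection: if a property of squares fails for one square and passes from
   the four quarters of a square to the square, it fails for squares shrinking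
   to a point. *)
Lemma square_ind (P : C -> R -> Prop) c s : 0 < s ->
  (forall c' h, 0 < h -> P c' h -> P (c' + h%:C) h -> P (c' + h%:C * 'i) h ->
     P (c' + h%:C + h%:C * 'i) h -> P c' (h + h)) ->
  (forall z, sq c s z -> exists2 r : R, 0 < r &
     forall c' s', 0 < s' -> s' < r -> sq c' s' z -> P c' s') ->
  P c s.
Proof.
move=> s0 Pq Ploc; apply: contrapT => nP.
have ex (x : C * R) : exists y : C * R, 0 < x.2 -> ~ P x.1 x.2 ->
    [/\ y.2 = x.2 / 2, ~ P y.1 y.2,
     Re x.1 <= Re y.1 <= Re x.1 + x.2 / 2 &
     Im x.1 <= Im y.1 <= Im x.1 + x.2 / 2].
  case: x => c' s' /=; have [s0'|_] := ltP 0 s'; last by exists (c', s').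
  set h := s' / 2; have h0 : 0 < h by rewrite divr_gt0.
  have hh : s' = h + h by rewrite -splitr.
  have le2 x : x <= x <= x + h by lra.
  have le3 x : x <= x + h <= x + h by lra.
  have [P1|] := pselect (P c' h); last first.
    by exists (c', h); split => //=; lra.
  have [P2|] := pselect (P (c' + h%:C) h); last first.
    by exists (c' + h%:C, h); split => //=; rewrite !ReImE/=; lra.
  have [P3|] := pselect (P (c' + h%:C * 'i) h); last first.
    by exists (c' + h%:C * 'i, h); split => //=; rewrite !ReImE/=; lra.
  have [P4|] := pselect (P (c' + h%:C + h%:C * 'i) h); last first.
    by exists (c' + h%:C + h%:C * 'i, h); split => //=; rewrite !ReImE/=; lra.
  by exists (c', h) => _; rewrite hh => -[]; exact: Pq.
have [q Hq] := choice ex.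
pose x n := iter n q (c, s).
have inv n : 0 < (x n).2 /\ ~ P (x n).1 (x n).2.
  elim: n => [//|n [IH1 IH2]]; have [e nP' _ _] := Hq _ IH1 IH2.
  by split; [rewrite /x iterS -/(x n) e divr_gt0 | rewrite /x iterS].
have step n : [/\ (x n.+1).2 = (x n).2 / 2,
   Re (x n).1 <= Re (x n.+1).1 <= Re (x n).1 + (x n).2 / 2
   & Im (x n).1 <= Im (x n.+1).1 <= Im (x n).1 + (x n).2 / 2].
  by have [i1 i2] := inv n; have [] := Hq _ i1 i2.
have size n : (x n).2 = s / 2 ^+ n.
  elim: n => [|n IH]; first by rewrite expr0 divr1.
  by have [-> _ _] := step n; rewrite IH exprSr invfM mulrA.
have [xr Hr] : exists r, forall n, Re (x n).1 <= r <= Re (x n).1 + (x n).2.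
  apply: nested_intervals => n; first by rewrite ltW//; case: (inv n).
    by have [_ /andP[]] := step n.
  by have [-> /andP[a b] _] := step n; lra.
have [xi Hi] : exists r, forall n, Im (x n).1 <= r <= Im (x n).1 + (x n).2.
  apply: nested_intervals => n; first by rewrite ltW//; case: (inv n).
    by have [_ _ /andP[]] := step n.
  by have [-> _ /andP[a b]] := step n; lra.
have [|r r0 Hr'] := Ploc (xr +i* xi).
  by split; [exact: (Hr 0%N) | exact: (Hi 0%N)].
have [n Hn] : exists n, (x n).2 < r.
  exists (Num.bound (s / r)); rewrite size ltr_pdivrMr ?exprn_gt0//.
  rewrite mulrC -ltr_pdivrMr//.
  apply: lt_trans (archi_boundP _) _; first by rewrite divr_ge0 ?ltW.
  by rewrite -natrX ltr_nat ltn_expl.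
by case: (inv n) => n0 []; apply: Hr' => //; split.
Qed.

End Squares.

(** * Dyadic Riemann sums and Goursat's lemma *)

Section Goursat.
Context {R : realType}.
Local Notation C := R[i].
Implicit Types (f g : C -> C) (z c v : C) (s h : R).

(** The left Riemann sum, over [2 ^ m] steps, of the integral of [f] along the
   segment from [c] to [c + v]. Dyadic sums are exactly additive under
   bisection, which is what Goursat's argument requires of integrals. *)
Definition edge m f c v : C :=
  v / 2 ^+ m * \sum_(j < 2 ^ m) f (c + v * (j%:R / 2 ^+ m)).

Definition contour m f c s : C :=
  edge m f c s%:C + edge m f (c + s%:C) (s%:C * 'i)
  - edge m f (c + s%:C * 'i) s%:C - edge m f c (s%:C * 'i).

Lemma dyadicE (j m : nat) : (j%:R / 2 ^+ m : C) = (j%:R / 2 ^+ m)%:C.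
Proof. by rewrite rmorphM fmorphV rmorphXn/= !rmorph_nat. Qed.

Lemma edge_split m f c v :
  edge m.+1 f c (v + v) = edge m f c v + edge m f (c + v) v.
Proof.
have n0 : (2 ^+ m : C) != 0 by rewrite expf_neq0// pnatr_eq0.
have n2 : (2 : C) != 0 by rewrite pnatr_eq0.
rewrite /edge expnS mul2n -addnn big_split_ord/= mulrDr; congr (_ + _).
  congr (_ * _); first by rewrite exprS; field; rewrite n0.
  by apply: eq_bigr => j _; congr f; rewrite exprS; field; rewrite n0.
congr (_ * _); first by rewrite exprS; field; rewrite n0.
apply: eq_bigr => j _; congr f; by rewrite natrD natrX exprS; field; rewrite n0.
Qed.

Lemma contour_split m f c h :
  contour m.+1 f c (h + h) =
    contour m f c h + contour m f (c + h%:C) h + contour m f (c + h%:C * 'i) h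
    + contour m f (c + h%:C + h%:C * 'i) h.
Proof.
rewrite /contour rmorphD/= mulrDl !edge_split !addrA.
have -> : c + h%:C + h%:C * 'i + h%:C = c + h%:C + h%:C + h%:C * 'i by ring.
have -> : c + h%:C * 'i + h%:C = c + h%:C + h%:C * 'i by ring.
have -> : c + h%:C * 'i + h%:C * 'i + h%:C = c + h%:C + h%:C * 'i + h%:C * 'i by ring.
ring.
Qed.

Lemma edge_lin m f g (a b : C) c v :
  edge m (fun z => a * f z + b * g z) c v = a * edge m f c v + b * edge m g c v.
Proof.
by rewrite /edge big_split/= -!mulr_sumr mulrDr; congr (_ + _); rewrite mulrCA.
Qed.

Lemma contour_lin m f g (a b : C) c s :
  contour m (fun z => a * f z + b * g z) c s =
  a * contour m f c s + b * contour m g c s.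
Proof. by rewrite /contour !edge_lin; ring. Qed.

Lemma eq_edge m f g c v : (forall t : R, 0 <= t <= 1 -> f (c + v * t%:C) = g (c + v * t%:C)) ->
  edge m f c v = edge m g c v.
Proof.
move=> fg; rewrite /edge; congr (_ * _); apply: eq_bigr => j _.
rewrite dyadicE; apply: fg; rewrite divr_ge0 ?exprn_ge0//= ler_pdivrMr ?exprn_gt0// mul1r.
by rewrite -natrX ler_nat ltnW.
Qed.

Lemma edge_bound m f c v (B : R) :
  (forall t : R, 0 <= t <= 1 -> normc (f (c + v * t%:C)) <= B) ->
  normc (edge m f c v) <= normc v * B.
Proof.
move=> fB; rewrite /edge !normcM normcV normcX -mulrA ler_wpM2l ?normc_ge0//.
have -> : normc (2 : C) = 2.
  by rewrite -(rmorph_nat (real_complex R)) normcR ger0_norm.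
rewrite mulrC ler_pdivrMr ?exprn_gt0//.
apply: le_trans (normc_sum _ _ _) _.
have : \sum_(j < 2 ^ m) normc (f (c + v * (j%:R / 2 ^+ m))) <= \sum_(j < 2 ^ m) B.
  apply: ler_sum => j _.
  rewrite dyadicE.
  apply: fB; rewrite divr_ge0 ?exprn_ge0//= ler_pdivrMr ?exprn_gt0// mul1r.
  by rewrite -natrX ler_nat ltnW.
by rewrite sumr_const card_ord -[B *+ _]mulr_natr natrX.
Qed.

Definition on_boundary c s z :=
  sq c s z /\ (Re z = Re c \/ Re z = Re c + s \/
               Im z = Im c \/ Im z = Im c + s).

Lemma boundary_edges c s t : 0 <= s -> 0 <= t <= 1 ->
  [/\ on_boundary c s (c + s%:C * t%:C),
      on_boundary c s (c + s%:C + s%:C * 'i * t%:C),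
      on_boundary c s (c + s%:C * 'i + s%:C * t%:C) &
      on_boundary c s (c + s%:C * 'i * t%:C)].
Proof.
move=> s0 /andP[t0 t1].
have st0 : 0 <= s * t by rewrite mulr_ge0.
have st1 : s * t <= s by rewrite ler_piMr.
by split; rewrite /on_boundary /sq !ReImE/=; split; lra.
Qed.

Lemma eq_contour m f g c s : 0 <= s ->
  (forall z, on_boundary c s z -> f z = g z) ->
  contour m f c s = contour m g c s.
Proof.
move=> s0 fg; rewrite /contour.
have far t (t01 : 0 <= t <= 1) := boundary_edges c s0 t01.
by congr (_ + _ - _ - _); apply: eq_edge => t /far[? ? ? ?]; exact: fg.
Qed.

Lemma contour_bound m f c s (B : R) : 0 <= s ->
  (forall z, on_boundary c s z -> normc (f z) <= B) ->
  normc (contour m f c s) <= 4 * s * B.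
Proof.
move=> s0 fB.
have ns : normc (s%:C : C) = s by rewrite normcR ger0_norm.
have nsi : normc (s%:C * 'i : C) = s by rewrite normcM normci mulr1.
have eB c' v : normc v = s -> (forall t : R, 0 <= t <= 1 -> on_boundary c s (c' + v * t%:C)) ->
    normc (edge m f c' v) <= s * B.
  by move=> nv cv; rewrite -[X in X * _]nv; apply: edge_bound => t /cv; exact: fB.
have far t (t01 : 0 <= t <= 1) := boundary_edges c s0 t01.
have b1 : normc (edge m f c s%:C) <= s * B by apply: eB => // t /far[].
have b2 : normc (edge m f (c + s%:C) (s%:C * 'i)) <= s * B by apply: eB => // t /far[].
have b3 : normc (edge m f (c + s%:C * 'i) s%:C) <= s * B by apply: eB => // t /far[].
have b4 : normc (edge m f c (s%:C * 'i)) <= s * B by apply: eB => // t /far[].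
rewrite /contour.
apply: le_trans (le_normcD _ _) _; rewrite normcN.
have := le_normcD (edge m f c s%:C + edge m f (c + s%:C) (s%:C * 'i)) (- edge m f (c + s%:C * 'i) s%:C).
have := le_normcD (edge m f c s%:C) (edge m f (c + s%:C) (s%:C * 'i)).
rewrite normcN; lra.
Qed.

(** Left Riemann sums are not exact on [z], but the errors on opposite edges
   cancel. *)
Lemma contour_affine m (a b : C) c s : contour m (fun z => a + b * z) c s = 0.
Proof.
have n0 : (2 ^+ m : C) != 0 by rewrite expf_neq0// pnatr_eq0.
rewrite (_ : (fun z => a + b * z) = fun z => a * (fun=> 1) z + b * id z); last first.
  by apply/funext => z; rewrite mulr1.
have edge1 c' v : edge m (fun=> 1) c' v = v.
  by rewrite /edge sumr_const card_ord -mulr_natr mul1r natrX divfK.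
have edgeid c' v : edge m id c' v = v * c' + edge m id 0 v.
  rewrite /edge big_split/= sumr_const card_ord -[c' *+ _]mulr_natr natrX mulrDr.
  congr (_ + _); first by field; exact: n0.
  by congr (_ * _); apply: eq_bigr => j _; rewrite add0r.
rewrite contour_lin /contour !edge1 [edge _ id c _]edgeid [edge _ id (c + _) _]edgeid.
rewrite [edge _ id (c + _ * _) _]edgeid [edge _ id c (_ * _)]edgeid.
ring.
Qed.

Lemma contour_quarters f c h (e1 e2 e3 e4 : R) :
  (exists M, forall m, (M <= m)%N -> normc (contour m f c h) <= e1) ->
  (exists M, forall m, (M <= m)%N -> normc (contour m f (c + h%:C) h) <= e2) ->
  (exists M, forall m, (M <= m)%N -> normc (contour m f (c + h%:C * 'i) h) <= e3) ->
  (exists M, forall m, (M <= m)%N ->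
     normc (contour m f (c + h%:C + h%:C * 'i) h) <= e4) ->
  exists M, forall m, (M <= m)%N ->
    normc (contour m f c (h + h)) <= e1 + e2 + e3 + e4.
Proof.
move=> [M1 H1] [M2 H2] [M3 H3] [M4 H4].
exists (maxn (maxn M1 M2) (maxn M3 M4)).+1 => -[//|m].
rewrite ltnS !geq_max => /andP[/andP[m1 m2] /andP[m3 m4]].
rewrite contour_split.
apply: le_trans (le_normcD _ _) _; rewrite lerD//; last exact: H4.
apply: le_trans (le_normcD _ _) _; rewrite lerD//; last exact: H3.
apply: le_trans (le_normcD _ _) _; rewrite lerD//; [exact: H1|exact: H2].
Qed.

(** Goursat: by bisection it is enough to bound the sums over small squares
   around a point where [f] is close to an affine function. *)
Lemma goursat f c s : 0 < s -> (forall z, sq c s z -> derivable f z 1) ->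
  forall e : R, 0 < e -> exists M, forall m, (M <= m)%N ->
    normc (contour m f c s) <= e.
Proof.
move=> s0 fd e e0.
suff [M HM] : exists M, forall m, (M <= m)%N ->
    normc (contour m f c s) <= e / s ^+ 2 * s ^+ 2.
  by exists M => m /HM; rewrite divfK// expf_neq0 ?gt_eqF.
have : 0 < e / s ^+ 2 by rewrite divr_gt0 ?exprn_gt0.
move: (e / _) => {}e {}e0.
apply: (square_ind (P := fun c s => exists M, forall m, (M <= m)%N ->
    normc (contour m f c s) <= e * s ^+ 2)) => //.
  move=> c' h h0 H1 H2 H3 H4.
  have [M HM] := contour_quarters H1 H2 H3 H4.
  by exists M => m /HM le; apply: le_trans le _; rewrite le_eqVlt; apply/orP; left; apply/eqP; ring.
move=> z /fd/cderivP[d fz].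
have [r r0 Hr] := fz (e / 8) ltac:(lra).
exists (r / 4); first lra.
move=> c' s' s0' sr zin; exists 0%N => m _.
have -> : contour m f c' s' =
    contour m (fun w => f w - f z - d * (w - z)) c' s'.
  rewrite (_ : (fun w => _) =
     (fun w => 1 * f w + (-1) * (fun w => (f z - d * z) + d * w) w)); last first.
    by apply/funext => w /=; ring.
  by rewrite contour_lin contour_affine mulr0 addr0 mul1r.
have -> : e * s' ^+ 2 = 4 * s' * (e / 8 * (s' *+ 2)) by field.
apply: contour_bound; first exact: ltW.
move=> w [win _]; have wz := sq_close zin win.
have := Hr (w - z); rewrite [z + _]addrC subrK => Hw.
apply: le_trans (Hw _) _; first by apply: le_lt_trans wz _; lra.
by rewrite ler_wpM2l// ltW// divr_gt0.
Qed.

(** The fraction of a neighbourhood of [a] lying above an interval of length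
   [h] starting at [x], an additive function of the interval: it is 1, 1/2 or 0
   when [a] is interior, an end point or exterior. *)
Definition share (a x h : R) : R :=
  2^-1 * ((x <= a)%R%:R - (x + h <= a)%R%:R + ((x < a)%R%:R - (x + h < a)%R%:R)).

Lemma share_split a x h : share a x (h + h) = share a x h + share a (x + h) h.
Proof. by rewrite /share [x + (h + h)]addrA; ring. Qed.

Lemma share_ge0 a x h : 0 <= h -> 0 <= share a x h.
Proof.
move=> h0; rewrite /share.
by case: (leP x a); case: (leP (x + h) a); case: (ltP x a); case: (ltP (x + h) a) => /=; lra.
Qed.

Lemma share_ge_half a x h : 0 < h -> x <= a <= x + h -> 2^-1 <= share a x h.
Proof.
move=> h0 /andP[xa ax]; rewrite /share xa [x + h < a]ltNge ax/=.
by case: (leP (x + h) a); case: (ltP x a) => /=; lra.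
Qed.

(** An isolated singularity at which [f] stays bounded does not matter: after
   [n] bisections it only affects squares of total perimeter [O(2^-n)]. The
   [share]s account for squares having [a] on their boundary. *)
Lemma goursat_punctured f c s (a : C) (B : R) : 0 < s -> 0 <= B ->
  (forall z, sq c s z -> z != a -> derivable f z 1) ->
  (forall z, sq c s z -> normc (f z) <= B) ->
  forall e : R, 0 < e -> exists M, forall m, (M <= m)%N ->
    normc (contour m f c s) <= e.
Proof.
move=> s0 B0 fd fB e e0.
pose wt c s := share (Re a) (Re c) s * share (Im a) (Im c) s.
have wt_split c' h : wt c' (h + h) = wt c' h + wt (c' + h%:C) h +
    wt (c' + h%:C * 'i) h + wt (c' + h%:C + h%:C * 'i) h.
  rewrite /wt !share_split !ReImE/= !(mulr0, mulr1, mul0r, addr0, add0r, subr0, subrr); ring.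
have wt0 c' h : 0 <= h -> 0 <= wt c' h by move=> h0; rewrite mulr_ge0// share_ge0.
have key n : forall c s (e : R), 0 < s -> 0 < e ->
    (forall z, sq c s z -> z != a -> derivable f z 1) ->
    (forall z, sq c s z -> normc (f z) <= B) ->
    exists M, forall m, (M <= m)%N ->
      normc (contour m f c s) <= 16 * B * (s / 2 ^+ n) * wt c s + e.
  clear fd fB s0 e0 c s e; elim: n => [|n IH] c s e s0 e0 fd fB.
    rewrite expr0 divr1.
    have [ain|aout] := pselect (sq c s a); last first.
      have [|M HM] := @goursat f c s s0 _ e e0.
        by move=> z zin; apply: fd => //; apply: contra_notN aout => /eqP <-.
      exists M => m /HM le; apply: le_trans le _.
      by rewrite lerDr mulr_ge0 ?(wt0 _ _ (ltW s0))// !mulr_ge0// ltW.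
    exists 0%N => m _.
    have w4 : 4^-1 <= wt c s.
      have -> : 4^-1 = 2^-1 * 2^-1 :> R by field.
      by apply: ler_pM; rewrite ?invr_ge0//; apply: share_ge_half => //; case: ain.
    apply: (@le_trans _ _ (4 * s * B)).
      by apply: contour_bound => [|z [/fB]]//; exact: ltW.
    have : 16 * B * s * 4^-1 <= 16 * B * s * wt c s.
      by rewrite ler_wpM2l// !mulr_ge0// ltW.
    lra.
  have [h h0 hh] : exists2 h, 0 < h & s = h + h.
    by exists (s / 2); [rewrite divr_gt0 | exact: splitr].
  rewrite hh in fd fB *.
  have sub1 z : sq c h z -> sq c (h + h) z.
    by move=> -[/andP[? ?] /andP[? ?]]; split; lra.
  have sub2 z : sq (c + h%:C) h z -> sq c (h + h) z.
    by move=> -[]; rewrite !ReImE/= => /andP[? ?] /andP[? ?]; split; lra.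
  have sub3 z : sq (c + h%:C * 'i) h z -> sq c (h + h) z.
    by move=> -[]; rewrite !ReImE/= => /andP[? ?] /andP[? ?]; split; lra.
  have sub4 z : sq (c + h%:C + h%:C * 'i) h z -> sq c (h + h) z.
    by move=> -[]; rewrite !ReImE/= => /andP[? ?] /andP[? ?]; split; lra.
  have e4 : 0 < e / 4 by rewrite divr_gt0.
  have := contour_quarters
    (IH _ _ _ h0 e4 (fun z hz => fd z (sub1 z hz)) (fun z hz => fB z (sub1 z hz)))
    (IH _ _ _ h0 e4 (fun z hz => fd z (sub2 z hz)) (fun z hz => fB z (sub2 z hz)))
    (IH _ _ _ h0 e4 (fun z hz => fd z (sub3 z hz)) (fun z hz => fB z (sub3 z hz)))
    (IH _ _ _ h0 e4 (fun z hz => fd z (sub4 z hz)) (fun z hz => fB z (sub4 z hz))).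
  move=> [M HM]; exists M => m /HM le; apply: le_trans le _.
  rewrite wt_split le_eqVlt; apply/orP; left; apply/eqP; rewrite exprS; field.
  by rewrite expf_neq0// pnatr_eq0.
pose A := 16 * B * s * wt c s.
have A0 : 0 <= A by rewrite mulr_ge0 ?(wt0 _ _ (ltW s0))// !mulr_ge0// ltW.
have e2 : 0 < e / 2 by rewrite divr_gt0.
have [M HM] := key (Num.bound (A / (e / 2))) c s _ s0 e2 fd fB.
exists M => m /HM le; apply: le_trans le _.
set n := Num.bound _.
have : A / 2 ^+ n <= e / 2.
  rewrite ler_pdivrMr ?exprn_gt0// mulrC -ler_pdivrMr//.
  apply: ltW; apply: lt_trans (archi_boundP _) _; first by rewrite divr_ge0// ltW.
  by rewrite -/n -natrX ltr_nat ltn_expl.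
have -> : 16 * B * (s / 2 ^+ n) * wt c s = A / 2 ^+ n by rewrite /A; ring.
lra.
Qed.

End Goursat.

(** * Cauchy's formula by Riemann sums *)

Section Limits.
Context {R : realType}.
Local Notation C := R[i].

Lemma cauchy_real (u : nat -> R) :
  (forall e : R, 0 < e -> exists M, forall m n, (M <= m)%N -> (M <= n)%N ->
     `|u m - u n| <= e) ->
  exists l, forall e : R, 0 < e -> exists M, forall m, (M <= m)%N ->
     `|u m - l| <= e.
Proof.
move=> uC; have : cauchy (u @ \oo).
  apply: cauchy_exP => e e0.
  have [M HM] := uC (e / 2) ltac:(by rewrite divr_gt0).
  exists (u M); exists M => // m /= Mm; rewrite -ball_normE/=.
  by apply: le_lt_trans (HM M m (leqnn _) Mm) _; rewrite ltr_pdivrMr// ltr_pMr// ltr1n.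
move/cauchy_cvg => /cvg_ex[l /cvgrPdist_le ul]; exists l => e /ul[M _ HM].
by exists M => m /HM; rewrite distrC.
Qed.

Definition tends (u : nat -> C) (l : C) := forall e : R, 0 < e ->
  exists M, forall m, (M <= m)%N -> normc (u m - l) <= e.

Lemma cauchy_complex (u : nat -> C) :
  (forall e : R, 0 < e -> exists M, forall m n, (M <= m)%N -> (M <= n)%N ->
     normc (u m - u n) <= e) -> exists l, tends u l.
Proof.
move=> uC.
have [|x Hx] := @cauchy_real (fun m => Re (u m)).
  move=> e /uC[M HM]; exists M => m n Mm Mn.
  by rewrite -cReN -cReD (le_trans (Re_le_normc _))// HM.
have [|y Hy] := @cauchy_real (fun m => Im (u m)).
  move=> e /uC[M HM]; exists M => m n Mm Mn.
  by rewrite -cImN -cImD (le_trans (Im_le_normc _))// HM.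
exists (x +i* y) => e e0; have e2 : 0 < e / 2 by rewrite divr_gt0.
have [M1 H1] := Hx _ e2; have [M2 H2] := Hy _ e2.
exists (maxn M1 M2) => m; rewrite geq_max => /andP[m1 m2].
apply: le_trans (normc_le_ReIm _) _; rewrite !ReImE/= [e]splitr.
by rewrite lerD ?H1 ?H2.
Qed.

Lemma tends_bound (u : nat -> C) l (B : R) :
  tends u l -> (forall m, normc (u m) <= B) -> normc l <= B.
Proof.
move=> ul uB; apply/ler_addgt0Pr => e /ul[M /(_ M (leqnn M)) HM].
by rewrite (le_trans (normc_le_dist l (u M)))// lerD// normc_sub.
Qed.

Lemma tendsD (u v : nat -> C) l l' (a b : C) : tends u l -> tends v l' ->
  tends (fun m => a * u m + b * v m) (a * l + b * l').
Proof.
move=> ul vl e e0.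
pose A := normc a + normc b + 1.
have A0 : 0 < A by rewrite ltr_wpDl// addr_ge0 ?normc_ge0.
have eA : 0 < e / A by rewrite divr_gt0.
have [M1 H1] := ul _ eA; have [M2 H2] := vl _ eA.
exists (maxn M1 M2) => m; rewrite geq_max => /andP[m1 m2].
have -> : a * u m + b * v m - (a * l + b * l') = a * (u m - l) + b * (v m - l') by ring.
apply: le_trans (le_normcD _ _) _; rewrite !normcM.
have h1 : normc a * normc (u m - l) <= normc a * (e / A).
  by rewrite ler_wpM2l ?normc_ge0// H1.
have h2 : normc b * normc (v m - l') <= normc b * (e / A).
  by rewrite ler_wpM2l ?normc_ge0// H2.
apply: le_trans (lerD h1 h2) _; rewrite -mulrDl mulrA ler_pdivrMr// mulrC ler_wpM2l//; first exact: ltW.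
by rewrite /A lerDl.
Qed.

(** A uniform first order expansion at the origin passes to pointwise limits;
   in particular the derivatives converge. *)
Lemma quadratic_limit (G : nat -> C -> C) (f : C -> C) (D : nat -> C) (r K B : R) :
  0 < r -> 0 <= K ->
  (forall m h, normc h <= r ->
     normc (G m h - G m 0 - h * D m) <= K * normc h ^+ 2) ->
  (forall h, normc h <= r -> tends (G ^~ h) (f h)) ->
  (forall m, normc (D m) <= B) ->
  exists2 d, normc d <= B & forall h, normc h <= r ->
     normc (f h - f 0 - h * d) <= K * normc h ^+ 2.
Proof.
move=> r0 K0 GD Gf DB.
have n0 : normc (0 : C) <= r by rewrite normc0 ltW.
have [|d Dd] := @cauchy_complex D.
  move=> e e0.
  have [t t0 [tr tK]] : exists2 t : R, 0 < t & t <= r /\ K * t <= e / 4.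
    exists (Num.min r (e / 4 / (K + 1))).
      by rewrite lt_min r0 !divr_gt0// ltr_wpDl.
    split; first by rewrite ge_min lexx.
    have K1 : 0 < K + 1 by rewrite ltr_wpDl.
    apply: (@le_trans _ _ ((K + 1) * (e / 4 / (K + 1)))); last first.
      by rewrite mulrC divfK// gt_eqF.
    apply: ler_pM => //; [by rewrite le_min ltW//= !divr_ge0// ltW | by rewrite lerDl |].
    by rewrite ge_min lexx orbT.
  have nt : normc (t%:C : C) = t by rewrite normcR gtr0_norm.
  have et : 0 < t * e / 8 by rewrite divr_gt0// mulr_gt0.
  have tr' : normc (t%:C : C) <= r by rewrite nt.
  have [M1 H1] := Gf _ tr' _ et; have [M2 H2] := Gf _ n0 _ et.
  have bnd m : (maxn M1 M2 <= m)%N ->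
      normc (f t%:C - f 0 - t%:C * D m) <= t * (e / 2).
    rewrite geq_max => /andP[/H1 a1 /H2 a2].
    have -> : f t%:C - f 0 - t%:C * D m =
      - (G m t%:C - f t%:C) + (G m 0 - f 0) + (G m t%:C - G m 0 - t%:C * D m) by ring.
    apply: le_trans (le_normcD _ _) _.
    apply: le_trans (lerD (le_normcD _ _) (GD _ _ tr')) _.
    rewrite normcN nt.
    have : K * t ^+ 2 <= t * (e / 4) by rewrite expr2 mulrA [leRHS]mulrC ler_pM2r.
    lra.
  exists (maxn M1 M2) => m n /bnd bm /bnd bn.
  rewrite -(ler_pM2l t0) -[X in X * _]nt -normcM.
  have -> : t%:C * (D m - D n) = (f t%:C - f 0 - t%:C * D n) - (f t%:C - f 0 - t%:C * D m) by ring.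
  apply: le_trans (le_normcD _ _) _; rewrite normcN; lra.
exists d; first exact: tends_bound Dd DB.
move=> h hr.
have T := tendsD 1 (- h) (tendsD 1 (-1) (Gf _ hr) (Gf _ n0)) Dd.
have -> : f h - f 0 - h * d = 1 * (1 * f h + (-1) * f 0) + (- h) * d by ring.
apply: tends_bound T _ => m.
have -> : 1 * (1 * G m h + (-1) * G m 0) + (- h) * D m = G m h - G m 0 - h * D m by ring.
exact: GD.
Qed.

End Limits.

Section CauchyFormula.
Context {R : realType}.
Local Notation C := R[i].
Implicit Types (f g : C -> C) (z c v a b : C) (s h : R).

(** The function [(z - b) ^- 2] is compared with the increments of its primitive
   [- (z - b)^-1]. *)
Lemma edge_telescope m c v b (d : R) : 0 < d ->
  (forall t : R, 0 <= t <= 1 -> d <= normc (c + v * t%:C - b)) ->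
  normc (edge m (fun z => (z - b) ^- 2) c v - ((c - b)^-1 - (c + v - b)^-1))
    <= normc v ^+ 2 / d ^+ 3 / 2 ^+ m.
Proof.
move=> d0 far.
have n0 : (2 ^+ m : C) != 0 by rewrite expf_neq0// pnatr_eq0.
have n0' : 0 < (2 ^+ m : R) by rewrite exprn_gt0.
pose z (j : nat) : C := c + v * (j%:R / 2 ^+ m) - b.
have zfar j : (j <= 2 ^ m)%N -> d <= normc (z j).
  move=> jm; rewrite /z.
  rewrite dyadicE.
  apply: far; rewrite divr_ge0 ?(ltW n0')//= ler_pdivrMr// mul1r.
  by rewrite -natrX ler_nat.
have z0 j : (j <= 2 ^ m)%N -> z j != 0.
  by move=> /zfar dz; rewrite -normc_gt0 (lt_le_trans d0).
have -> : (c - b)^-1 - (c + v - b)^-1 = \sum_(j < 2 ^ m) ((z j)^-1 - (z j.+1)^-1).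
  rewrite -(big_mkord xpredT (fun j => (z j)^-1 - (z j.+1)^-1)).
  under eq_bigr do rewrite -opprB.
  rewrite sumrN telescope_sumr// opprB /z mul0r mulr0 addr0 natrX divff// mulr1//.
rewrite /edge mulr_sumr -sumrB.
apply: le_trans (normc_sum _ _ _) _.
have nv : normc (v / 2 ^+ m) = normc v / 2 ^+ m.
  have -> : (2 ^+ m : C) = (2 ^+ m)%:C by rewrite rmorphXn/= rmorph_nat.
  by rewrite normcM normcV normcR ger0_norm ?ltW.
have : \sum_(j < 2 ^ m) normc (v / 2 ^+ m * (c + v * (j%:R / 2 ^+ m) - b) ^- 2 -
       ((z j)^-1 - (z j.+1)^-1)) <= \sum_(j < 2 ^ m) (normc v / 2 ^+ m) ^+ 2 / d ^+ 3.
  apply: ler_sum => j _; rewrite -/(z j).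
  have zj := z0 _ (ltnW (ltn_ord j)); have zj1 := z0 _ (ltn_ord j).
  have e1 : z j.+1 = z j + v / 2 ^+ m by rewrite /z -natr1; field; exact: n0.
  have -> : v / 2 ^+ m * z j ^- 2 - ((z j)^-1 - (z j.+1)^-1) =
     (v / 2 ^+ m) ^+ 2 / (z j ^+ 2 * z j.+1).
    rewrite {}e1 in zj1 *; move: (v / _) zj1 => w zj1; field; rewrite zj1 zj//.
  rewrite normcM normcX nv normcV normcM normcX.
  rewrite ler_wpM2l ?sqr_ge0// lef_pV2 ?posrE ?exprn_gt0 ?mulr_gt0 ?exprn_gt0 ?normc_gt0//.
  rewrite exprSr; apply: ler_pM; rewrite ?exprn_ge0 ?(ltW d0)//.
    by apply: lerXn2r; rewrite ?nnegrE ?normc_ge0 ?(ltW d0)// zfar// ltnW.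
  exact: zfar.
move/le_trans; apply.
rewrite sumr_const card_ord -[_ *+ (2 ^ m)]mulr_natr natrX le_eqVlt; apply/orP; left; apply/eqP.
by field; rewrite !gt_eqF.
Qed.

Variable rho : R.
Hypothesis rho0 : 0 < rho.

Let c0 : C := - rho%:C - rho%:C * 'i.

Lemma boundary_far z a : on_boundary c0 (rho + rho) z -> normc a <= rho / 2 ->
  rho / 2 <= normc (z - a).
Proof.
move=> [_ zb] ar.
have bRe (w : C) : - normc w <= Re w <= normc w by rewrite -ler_norml Re_le_normc.
have bIm (w : C) : - normc w <= Im w <= normc w by rewrite -ler_norml Im_le_normc.
have /andP[i1 i2] := bRe a; have /andP[i3 i4] := bIm a.
have /andP[] := bRe (z - a); have /andP[] := bIm (z - a).
rewrite !ReImE; rewrite /c0 !ReImE/= in zb.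
by case: zb => [|[|[|]]] zb; lra.
Qed.

(** On each oriented edge of direction [v], the imaginary part of [v / z] is at
   least 1. A lower bound is enough for Cauchy's formula, which divides by this
   sum instead of [2 pi i]. *)
Lemma winding_lower m : 4 <= Im (contour m (fun z : C => z^-1) c0 (rho + rho)).
Proof.
have Im_edge (b : bool) c v : (forall t : R, 0 <= t <= 1 ->
     1 <= Im ((-1) ^+ b * (v * (c + v * t%:C)^-1))) ->
     1 <= Im ((-1) ^+ b * edge m (fun z : C => z^-1) c v).
  move=> H; rewrite /edge mulrA mulr_sumr.
  have n0 : 0 < (2 ^+ m : R) by rewrite exprn_gt0.
  have e2 : (2 ^+ m : C) = (2 ^+ m)%:C by rewrite rmorphXn/= rmorph_nat.
  have ImS (F : 'I_(2 ^ m) -> C) : Im (\sum_j F j) = \sum_j Im (F j).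
    exact: (@big_morph _ _ (@Im R) 0 +%R 0 +%R (@cImD R) erefl).
  rewrite ImS.
  have <- : \sum_(j < 2 ^ m) ((2 ^+ m)^-1 : R) = 1.
    by rewrite sumr_const card_ord -[_ *+ (2 ^ m)]mulr_natr natrX mulVf// gt_eqF.
  apply: ler_sum => j _.
  rewrite dyadicE.
  rewrite -mulrA [v / _ * _]mulrAC mulrA e2 -fmorphV/= [X in Im X]mulrC cImM/= mul0r addr0.
  rewrite ler_peMr ?invr_ge0 ?(ltW n0)//.
  apply: H; rewrite divr_ge0 ?(ltW n0)//= ler_pdivrMr// mul1r.
  by rewrite -natrX ler_nat ltnW.
have key (x : R) : `|x| <= rho -> 1 <= (rho + rho) * rho / (x ^+ 2 + rho ^+ 2).
  move=> xr; rewrite ler_pdivlMr ?ltr_wpDl ?sqr_ge0 ?exprn_gt0// mul1r.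
  have : x ^+ 2 <= rho ^+ 2 by rewrite -real_normK ?num_real// lerXn2r ?nnegrE ?(ltW rho0).
  by rewrite !expr2; lra.
have xr (t : R) : 0 <= t <= 1 -> `|- rho + (rho + rho) * t| <= rho.
  move=> /andP[t0 t1]; rewrite ler_norml.
  have : 0 <= (rho + rho) * t by rewrite mulr_ge0// addr_ge0 ?ltW.
  have : (rho + rho) * t <= rho + rho by rewrite ler_piMr// addr_ge0 ?ltW.
  by move=> ? ?; apply/andP; split; lra.
have := Im_edge false c0 (rho + rho)%:C.
have := Im_edge false (c0 + (rho + rho)%:C) ((rho + rho)%:C * 'i).
have := Im_edge true (c0 + (rho + rho)%:C * 'i) (rho + rho)%:C.
have := Im_edge true c0 ((rho + rho)%:C * 'i).
rewrite /contour !cImD !cImN expr0 expr1 !mul1r !mulN1r !cImN.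
move=> h4 h3 h2 h1.
have {}h1 : 1 <= Im (edge m (fun z : C => z^-1) c0 (rho + rho)%:C).
  apply: h1 => t t01; rewrite mul1r; apply: le_trans (key _ (xr t t01)) _.
  rewrite le_eqVlt; apply/orP; left; apply/eqP.
  rewrite /c0 /= !(mul0r, mulr0, mulr1, subr0, addr0, add0r, oppr0, sub0r, opprK) sqrrN. ring.
have {}h2 : 1 <= Im (edge m (fun z : C => z^-1) (c0 + (rho + rho)%:C) ((rho + rho)%:C * 'i)).
  apply: h2 => t t01; rewrite mul1r; apply: le_trans (key _ (xr t t01)) _.
  rewrite le_eqVlt; apply/orP; left; apply/eqP.
  rewrite /c0 /= !(mul0r, mulr0, mulr1, subr0, addr0, add0r, oppr0, sub0r, opprK).
  rewrite (_ : - rho + (rho + rho) = rho); last by ring.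
  rewrite [rho ^+ 2 + _]addrC; ring.
have {}h3 : 1 <= - Im (edge m (fun z : C => z^-1) (c0 + (rho + rho)%:C * 'i) (rho + rho)%:C).
  apply: h3 => t t01; rewrite mulN1r cImN; apply: le_trans (key _ (xr t t01)) _.
  rewrite le_eqVlt; apply/orP; left; apply/eqP.
  rewrite /c0 /= !(mul0r, mulr0, mulr1, subr0, addr0, add0r, oppr0, sub0r, opprK).
  rewrite (_ : - rho + (rho + rho) = rho); last by ring.
  ring.
have {}h4 : 1 <= - Im (edge m (fun z : C => z^-1) c0 ((rho + rho)%:C * 'i)).
  apply: h4 => t t01; rewrite mulN1r cImN; apply: le_trans (key _ (xr t t01)) _.
  rewrite le_eqVlt; apply/orP; left; apply/eqP.
  rewrite /c0 /= !(mul0r, mulr0, mulr1, subr0, addr0, add0r, oppr0, sub0r, opprK) sqrrN.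
  rewrite [rho ^+ 2 + _]addrC; ring.
lra.
Qed.

Lemma inv_cube_le (d x y : R) : 0 < d -> d <= x -> d <= y ->
  (x ^+ 2 * y)^-1 <= (d ^+ 3)^-1.
Proof.
move=> d0 dx dy; have x0 := lt_le_trans d0 dx; have y0 := lt_le_trans d0 dy.
rewrite lef_pV2 ?posrE ?mulr_gt0 ?exprn_gt0// exprSr.
apply: ler_pM => //; rewrite ?exprn_ge0 ?(ltW d0)//.
by apply: lerXn2r; rewrite ?nnegrE ?(ltW d0) ?(ltW x0).
Qed.

Lemma contour_pole2 m b : normc b <= rho / 2 ->
  normc (contour m (fun z => (z - b) ^- 2) c0 (rho + rho)) <= 128 / rho / 2 ^+ m.
Proof.
move=> br.
have s0 : 0 <= rho + rho by rewrite addr_ge0 ?ltW.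
have d0 : 0 < rho / 2 by rewrite divr_gt0.
have far t (t01 : 0 <= t <= 1) := boundary_edges c0 s0 t01.
pose er c v := edge m (fun z => (z - b) ^- 2) c v - ((c - b)^-1 - (c + v - b)^-1).
have erB c v : normc v = rho + rho ->
    (forall t : R, 0 <= t <= 1 -> on_boundary c0 (rho + rho) (c + v * t%:C)) ->
    normc (er c v) <= 32 / rho / 2 ^+ m.
  move=> nv cv; have -> : 32 / rho = normc v ^+ 2 / (rho / 2) ^+ 3.
    by rewrite nv; field; rewrite gt_eqF.
  by apply: edge_telescope => // t /cv ?; exact: boundary_far.
have ns : normc ((rho + rho)%:C : C) = rho + rho by rewrite normcR ger0_norm.
have nsi : normc ((rho + rho)%:C * 'i : C) = rho + rho by rewrite normcM normci mulr1.
have -> : contour m (fun z => (z - b) ^- 2) c0 (rho + rho) =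
  er c0 (rho + rho)%:C + er (c0 + (rho + rho)%:C) ((rho + rho)%:C * 'i)
  - er (c0 + (rho + rho)%:C * 'i) (rho + rho)%:C - er c0 ((rho + rho)%:C * 'i).
  by rewrite /contour /er [c0 + _ * 'i + (rho + rho)%:C]addrAC; ring.
have four (w1 w2 w3 w4 : C) (x : R) : normc w1 <= x -> normc w2 <= x ->
    normc w3 <= x -> normc w4 <= x -> normc (w1 + w2 - w3 - w4) <= 4 * x.
  have := le_normcD (w1 + w2 - w3) (- w4); have := le_normcD (w1 + w2) (- w3).
  by have := le_normcD w1 w2; rewrite !normcN; lra.
have -> : 128 / rho / 2 ^+ m = 4 * (32 / rho / 2 ^+ m) by ring.
by apply: four; apply: erB => // t /far[].
Qed.

(** Subdividing the interval makes the sum of the quadratic errors arbitrarily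
   small. *)
Lemma telescope_quadratic (phi : R -> C) (A K : R) : 0 <= K ->
  (forall t h, 0 <= t -> 0 <= h -> t + h <= 1 ->
     normc (phi (t + h) - phi t) <= A * h + K * h ^+ 2) ->
  normc (phi 1 - phi 0) <= A.
Proof.
move=> K0 H; apply/ler_addgt0Pr => e e0.
pose N := Num.bound (K / e).
have KN : K / e < N%:R by apply: archi_boundP; rewrite divr_ge0// ltW.
have N0 : 0 < (N%:R : R) by rewrite (le_lt_trans _ KN)// divr_ge0// ltW.
have -> : phi 1 - phi 0 = \sum_(j < N) (phi (j.+1%:R / N%:R) - phi (j%:R / N%:R)).
  rewrite -(big_mkord xpredT (fun j => phi (j.+1%:R / N%:R) - phi (j%:R / N%:R))).
  by rewrite (telescope_sumr (fun j => phi (j%:R / N%:R)))// mul0r divff// gt_eqF.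
apply: le_trans (normc_sum _ _ _) _.
have : \sum_(j < N) normc (phi (j.+1%:R / N%:R) - phi (j%:R / N%:R)) <=
    \sum_(j < N) (A / N%:R + K / N%:R ^+ 2).
  apply: ler_sum => j _.
  have -> : j.+1%:R / N%:R = j%:R / N%:R + N%:R^-1 :> R.
    by rewrite -natr1 mulrDl mul1r.
  apply: le_trans (H _ _ _ _ _) _; rewrite ?divr_ge0 ?invr_ge0//.
    by rewrite -[X in _ + X]mul1r -mulrDl natr1 ler_pdivrMr// mul1r ler_nat.
  by rewrite exprVn.
move/le_trans; apply.
rewrite sumr_const card_ord -[_ *+ N]mulr_natr mulrDl divfK ?gt_eqF// lerD2l.
have -> : K / N%:R ^+ 2 * N%:R = K / N%:R by field; rewrite gt_eqF.
by rewrite ler_pdivrMr// mulrC -ler_pdivrMr// ltW.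
Qed.

(** The sums for the winding number around [a] do not depend on [a] in the
   limit, as [1 / (z - a) ^ 2] has a primitive. *)
Lemma winding_constant a : normc a <= rho / 2 ->
  tends (fun m => contour m (fun z => (z - a)^-1) c0 (rho + rho)
                  - contour m (fun z => z^-1) c0 (rho + rho)) 0.
Proof.
move=> ar e e0.
have s0 : 0 <= rho + rho by rewrite addr_ge0 ?ltW.
have d0 : 0 < rho / 2 by rewrite divr_gt0.
pose A := normc a * (128 / rho).
have A0 : 0 <= A by rewrite mulr_ge0 ?normc_ge0// divr_ge0// ltW.
exists (Num.bound (A / e)) => m Mm; rewrite subr0.
pose phi t := contour m (fun z => (z - t%:C * a)^-1) c0 (rho + rho).
have -> : contour m (fun z => (z - a)^-1) c0 (rho + rho)
   - contour m (fun z => z^-1) c0 (rho + rho) = phi 1 - phi 0.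
  rewrite /phi; congr (contour _ _ _ _ - contour _ _ _ _); apply/funext => z.
    by rewrite mul1r.
  by rewrite mul0r subr0.
apply: (@le_trans _ _ (A / 2 ^+ m)); last first.
  rewrite ler_pdivrMr ?exprn_gt0// mulrC -ler_pdivrMr//.
  apply: ltW; apply: lt_le_trans (archi_boundP _) _; first by rewrite divr_ge0// ltW.
  by rewrite -natrX ler_nat (leq_trans Mm)// ltnW// ltn_expl.
apply: (@telescope_quadratic phi _ (4 * (rho + rho) * (normc a ^+ 2 / (rho / 2) ^+ 3))).
  by rewrite mulr_ge0 ?(mulr_ge0 _ s0)// divr_ge0 ?exprn_ge0 ?normc_ge0 ?(ltW d0).
move=> t h t0 h0 th.
have tar (x : R) : 0 <= x <= 1 -> normc (x%:C * a) <= rho / 2.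
  move=> /andP[x0 x1]; rewrite normcM normcR ger0_norm//.
  by rewrite (le_trans _ ar)// ler_piMl ?normc_ge0.
have t1 : normc (t%:C * a) <= rho / 2 by apply: tar; lra.
have t2 : normc ((t + h)%:C * a) <= rho / 2 by apply: tar; lra.
rewrite /phi.
have -> : contour m (fun z => (z - (t + h)%:C * a)^-1) c0 (rho + rho) -
   contour m (fun z => (z - t%:C * a)^-1) c0 (rho + rho) =
   contour m (fun z => h%:C * a * (z - t%:C * a) ^- 2 + 1 * ((h%:C * a) ^+ 2 /
      ((z - t%:C * a) ^+ 2 * (z - (t + h)%:C * a)))) c0 (rho + rho).
  have -> : contour m (fun z => (z - (t + h)%:C * a)^-1) c0 (rho + rho) -
     contour m (fun z => (z - t%:C * a)^-1) c0 (rho + rho) =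
     contour m (fun z => 1 * (z - (t + h)%:C * a)^-1 + (-1) * (z - t%:C * a)^-1) c0 (rho + rho).
    by rewrite contour_lin; ring.
  apply: eq_contour => // z zb.
  have z1 : z - t%:C * a != 0 by rewrite -normc_gt0 (lt_le_trans d0)// boundary_far.
  have z2 : z - (t + h)%:C * a != 0 by rewrite -normc_gt0 (lt_le_trans d0)// boundary_far.
  have z3 : z - (t%:C + h%:C) * a != 0 by rewrite -rmorphD.
  by rewrite rmorphD/=; field; rewrite z1 z3.
rewrite contour_lin mul1r; apply: le_trans (le_normcD _ _) _; apply: lerD.
  rewrite !normcM normcR ger0_norm// /A.
  have -> : normc a * (128 / rho) / 2 ^+ m * h = h * normc a * (128 / rho / 2 ^+ m) by ring.
  by rewrite ler_wpM2l ?mulr_ge0 ?normc_ge0// contour_pole2.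
rewrite -[leRHS]mulrA.
apply: contour_bound => // z zb.
have far1 := boundary_far zb t1; have far2 := boundary_far zb t2.
rewrite normcM normcX normcM normcR (ger0_norm h0) exprMn.
rewrite [h ^+ 2 * _]mulrC mulrAC ler_wpM2r ?sqr_ge0// ler_wpM2l ?sqr_ge0//.
by rewrite normcV normcM normcX; exact: inv_cube_le.
Qed.

Variable B : R.
Hypothesis B0 : 0 <= B.

(** Cauchy's formula: Goursat's lemma applies to the difference quotient
   [(f z - f a) / (z - a)], which is bounded near [a]. *)
Lemma cauchy_sum f a :
  (forall z, sq c0 (rho + rho) z -> derivable f z 1) ->
  (forall z, sq c0 (rho + rho) z -> normc (f z) <= B) ->
  normc a <= rho / 2 ->
  tends (fun m => contour m (fun z => f z / (z - a)) c0 (rho + rho) /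
                  contour m (fun z => z^-1) c0 (rho + rho)) (f a).
Proof.
move=> fd fB ar.
have s0 : 0 < rho + rho by rewrite addr_gt0.
have d0 : 0 < rho / 2 by rewrite divr_gt0.
have ain : sq c0 (rho + rho) a.
  have : `|Re a| <= rho / 2 := le_trans (Re_le_normc a) ar.
  have : `|Im a| <= rho / 2 := le_trans (Im_le_normc a) ar.
  by rewrite !ler_norml /sq /c0 !ReImE/= => /andP[? ?] /andP[? ?]; split; apply/andP; split; lra.
pose g z := (f z - f a) / (z - a).
have gd z : sq c0 (rho + rho) z -> z != a -> derivable g z 1.
  move=> zin za; rewrite /g.
  have d1 : derivable (fun z => f z - f a) z 1.
    by apply: derivableB; [exact: fd | exact: derivable_cst].
  have d2 : derivable (fun z : C => (z - a)^-1) z 1.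
    apply: derivableV; first by rewrite subr_eq0.
    by apply: derivableB; [exact: derivable_id | exact: derivable_cst].
  exact: (derivableM d1 d2).
have [B' B'0 gB] : exists2 B' : R, 0 <= B' & forall z, sq c0 (rho + rho) z -> normc (g z) <= B'.
  have /fd/cderivP[d fa] := ain.
  have [r r0 Hr] := fa 1 ltr01.
  exists (normc d + 1 + 2 * B / r).
    by rewrite !addr_ge0 ?normc_ge0// divr_ge0 ?(ltW r0)// mulr_ge0.
  move=> z zin; rewrite /g.
  have [->|za] := eqVneq z a.
    by rewrite !subrr mul0r normc0 !addr_ge0 ?normc_ge0// divr_ge0 ?(ltW r0)// mulr_ge0.
  have za0 : 0 < normc (z - a) by rewrite normc_gt0 subr_eq0.
  rewrite normcM normcV ler_pdivrMr//.
  have [/Hr|rz] := ltP (normc (z - a)) r.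
    rewrite [a + _]addrC subrK mul1r => H.
    have -> : f z - f a = (f z - f a - d * (z - a)) + d * (z - a) by ring.
    apply: le_trans (le_normcD _ _) _; rewrite normcM.
    have : 0 <= 2 * B / r * normc (z - a) by rewrite !mulr_ge0 ?invr_ge0 ?(ltW r0) ?normc_ge0.
    by rewrite !mulrDl; lra.
  have h1 : normc (f z - f a) <= 2 * B.
    apply: le_trans (le_normcD _ _) _; rewrite normcN.
    by have := fB _ zin; have := fB _ ain; lra.
  apply: le_trans h1 _.
  have h2 : 2 * B <= 2 * B / r * normc (z - a).
    by rewrite -[leLHS](@divfK _ r) ?gt_eqF// ler_wpM2l// divr_ge0 ?(ltW r0)// mulr_ge0.
  have h3 : 0 <= (normc d + 1) * normc (z - a) by rewrite mulr_ge0 ?addr_ge0 ?normc_ge0.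
  by rewrite mulrDl; lra.
have G := goursat_punctured s0 B'0 gd gB.
have W := winding_constant ar.
set J := fun m => contour m (fun z => z^-1) c0 (rho + rho).
have J4 m : 4 <= normc (J m).
  by rewrite (le_trans (winding_lower m))// (le_trans (ler_norm _))// Im_le_normc.
have J0 m : J m != 0 by rewrite -normc_gt0 (lt_le_trans _ (J4 m)).
move=> e e0.
have [M1 H1] := G e e0.
pose e' := e / (normc (f a) + 1).
have fa0 : 0 < normc (f a) + 1 by rewrite ltr_wpDl ?normc_ge0.
have e'0 : 0 < e' by rewrite divr_gt0.
have [M2 H2] := W e' e'0.
exists (maxn M1 M2) => m; rewrite geq_max => /andP[/H1 h1 /H2].
rewrite subr0 -/(J m) => h2; rewrite -/(J m).
have -> : contour m (fun z => f z / (z - a)) c0 (rho + rho) / J m - f a =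
  (contour m g c0 (rho + rho) +
   f a * (contour m (fun z => (z - a)^-1) c0 (rho + rho) - J m)) / J m.
  have -> : contour m g c0 (rho + rho) =
     contour m (fun z => 1 * (f z / (z - a)) + (- f a) * (z - a)^-1) c0 (rho + rho).
    by congr contour; apply/funext => z; rewrite /g; ring.
  rewrite contour_lin; field; exact: J0.
rewrite normcM normcV ler_pdivrMr ?normc_gt0//.
apply: le_trans (le_normcD _ _) _; rewrite normcM.
have h3 : normc (f a) * normc (contour m (fun z => (z - a)^-1) c0 (rho + rho) - J m) <= e.
  apply: (@le_trans _ _ ((normc (f a) + 1) * e')); last by rewrite /e' mulrC divfK ?gt_eqF.
  by apply: ler_pM; rewrite ?normc_ge0// lerDl.
have : e * 4 <= e * normc (J m) by rewrite ler_pM2l.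
lra.
Qed.

(** For fixed [m] the sum in Cauchy's formula is a rational function of the
   point [a], and its expansion at 0 has constants independent of [m]. *)
Lemma cauchy_quadratic_center f :
  (forall z, sq c0 (rho + rho) z -> derivable f z 1) ->
  (forall z, sq c0 (rho + rho) z -> normc (f z) <= B) ->
  exists2 d, normc d <= 8 * B / rho & forall h : C, normc h <= rho / 2 ->
    normc (f h - f 0 - h * d) <= 16 * B / rho ^+ 2 * normc h ^+ 2.
Proof.
move=> fd fB.
have s0 : 0 < rho + rho by rewrite addr_gt0.
have d0 : 0 < rho / 2 by rewrite divr_gt0.
have K0 : 0 <= 16 * B / rho ^+ 2 by rewrite divr_ge0 ?exprn_ge0 ?(ltW rho0)// mulr_ge0.
set J := fun m => contour m (fun z => z^-1) c0 (rho + rho).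
have J4 m : 4 <= normc (J m).
  by rewrite (le_trans (winding_lower m))// (le_trans (ler_norm _))// Im_le_normc.
have J0 m : J m != 0 by rewrite -normc_gt0 (lt_le_trans _ (J4 m)).
have n0 : normc (0 : C) <= rho / 2 by rewrite normc0 ltW.
have cb m (g : C -> C) (b : R) : (forall z, on_boundary c0 (rho + rho) z -> normc (g z) <= b) ->
    normc (contour m g c0 (rho + rho) / J m) <= 2 * rho * b.
  move=> gb; rewrite normcM normcV ler_pdivrMr ?normc_gt0//.
  have h1 := contour_bound m (ltW s0) gb.
  apply: le_trans h1 _.
  have b0 : 0 <= 2 * rho * b.
    have : normc (g c0) <= b.
      apply: gb; split; first exact: sq_corners (ltW s0).
      by left.
    move=> /(le_trans (normc_ge0 _)) b0; rewrite mulr_ge0// mulr_ge0// ltW//.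
  have : 2 * rho * b * 4 <= 2 * rho * b * normc (J m) by rewrite ler_wpM2l.
  lra.
apply: (@quadratic_limit R
    (fun m a => contour m (fun z => f z / (z - a)) c0 (rho + rho) / J m) f
    (fun m => contour m (fun z => f z / z ^+ 2) c0 (rho + rho) / J m)) => //.
- move=> m h hr.
  have -> : contour m (fun z => f z / (z - h)) c0 (rho + rho) / J m -
    contour m (fun z => f z / (z - 0)) c0 (rho + rho) / J m -
    h * (contour m (fun z => f z / z ^+ 2) c0 (rho + rho) / J m) =
    contour m (fun z => f z * h ^+ 2 / (z ^+ 2 * (z - h))) c0 (rho + rho) / J m.
    have -> : contour m (fun z => f z * h ^+ 2 / (z ^+ 2 * (z - h))) c0 (rho + rho) =
      contour m (fun z => 1 * (fun z => 1 * (f z / (z - h)) + (-1) * (f z / (z - 0))) z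
           + (- h) * (f z / z ^+ 2)) c0 (rho + rho).
      apply: eq_contour => [|z zb]; first exact: ltW.
      have := boundary_far zb hr; have := boundary_far zb n0.
      rewrite subr0 => z1 z2.
      have z10 : z != 0 by rewrite -normc_gt0 (lt_le_trans d0).
      have z20 : z - h != 0 by rewrite -normc_gt0 (lt_le_trans d0).
      by field; rewrite z10 z20.
    by rewrite !contour_lin; field; exact: J0.
  apply: le_trans (cb m _ (B * normc h ^+ 2 / (rho / 2) ^+ 3) _) _.
    move=> z zb; have := boundary_far zb hr; have := boundary_far zb n0.
    rewrite subr0 => z1 z2.
    have -> : normc (f z * h ^+ 2 / (z ^+ 2 * (z - h))) =
        normc (f z) * normc h ^+ 2 * (normc z ^+ 2 * normc (z - h))^-1.
      by rewrite normcM [normc (f z * _)]normcM normcV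
        [normc (_ * (z - h))]normcM !normcX.
    apply: ler_pM; rewrite ?mulr_ge0 ?normc_ge0 ?exprn_ge0 ?normc_ge0//.
    - by rewrite invr_ge0 mulr_ge0 ?exprn_ge0 ?normc_ge0.
    - by rewrite ler_wpM2r ?exprn_ge0 ?normc_ge0// fB//; case: zb.
    - exact: inv_cube_le.
  rewrite le_eqVlt; apply/orP; left; apply/eqP.
  by field; rewrite gt_eqF.
- by move=> h hr; exact: cauchy_sum.
- move=> m; apply: le_trans (cb m _ (B / (rho / 2) ^+ 2) _) _.
    move=> z zb; have := boundary_far zb n0; rewrite subr0 => z1.
    have -> : normc (f z / z ^+ 2) = normc (f z) / normc z ^+ 2.
      by rewrite normcM normcV normcX.
    apply: ler_pM; rewrite ?normc_ge0//.
    - by rewrite invr_ge0 exprn_ge0 ?normc_ge0.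
    - by rewrite fB//; case: zb.
    - rewrite lef_pV2 ?posrE ?exprn_gt0 ?(lt_le_trans d0)//.
      by rewrite lerXn2r// nnegrE ?(ltW d0)// normc_ge0.
  rewrite le_eqVlt; apply/orP; left; apply/eqP.
  by field; rewrite gt_eqF.
Qed.

End CauchyFormula.

(** * Regularity of holomorphic functions of one variable *)

Section Regularity.
Context {R : realType}.
Local Notation C := R[i].
Implicit Types (f g : C -> C) (z o d h : C) (r B K : R).

Lemma cderiv_derivable f z d : cderiv f z d -> derivable f z 1.
Proof. by move=> fd; apply/cderivP; exists d. Qed.

Lemma cderiv_lin f g z d d' (a b : C) : cderiv f z d -> cderiv g z d' ->
  cderiv (fun x => a * f x + b * g x) z (a * d + b * d').
Proof.
move=> fd gd e e0.
pose A := normc a + normc b + 1.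
have A0 : 0 < A by rewrite ltr_wpDl// addr_ge0 ?normc_ge0.
have eA : 0 < e / A by rewrite divr_gt0.
have [r1 r10 H1] := fd _ eA; have [r2 r20 H2] := gd _ eA.
exists (Num.min r1 r2) => [|h]; first by rewrite lt_min r10.
rewrite lt_min => /andP[/H1 h1 /H2 h2].
have -> : a * f (z + h) + b * g (z + h) - (a * f z + b * g z) - (a * d + b * d') * h
  = a * (f (z + h) - f z - d * h) + b * (g (z + h) - g z - d' * h) by ring.
apply: le_trans (le_normcD _ _) _; rewrite !normcM.
have := ler_wpM2l (normc_ge0 a) h1; have := ler_wpM2l (normc_ge0 b) h2.
have -> : e * normc h = A * (e / A * normc h) by field; rewrite gt_eqF.
have : 0 <= e / A * normc h by rewrite mulr_ge0 ?normc_ge0// ltW.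
by rewrite /A; move: (e / _ * _) => x; rewrite !mulrDl mul1r; lra.
Qed.

Lemma cderiv_unique f z d d' : cderiv f z d -> cderiv f z d' -> d = d'.
Proof.
move=> fd fd'; apply/eqP; rewrite -subr_eq0 -normc_eq0 eq_le normc_ge0 andbT.
apply/ler_addgt0Pr => e e0; rewrite add0r.
have [r r0 H] := cderiv_lin 1 (-1) fd' fd e0.
have r2 : 0 < r / 2 by rewrite divr_gt0.
have nt : normc ((r / 2)%:C : C) = r / 2 by rewrite normcR gtr0_norm.
have := H (r / 2)%:C; rewrite nt => /(_ ltac:(lra)).
have -> : 1 * f (z + (r / 2)%:C) + -1 * f (z + (r / 2)%:C) - (1 * f z + -1 * f z) -
  (1 * d' + -1 * d) * (r / 2)%:C = (d - d') * (r / 2)%:C by ring.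
by rewrite normcM nt ler_pM2r.
Qed.

Lemma quadratic_cderiv f o d r K : 0 < r -> 0 <= K ->
  (forall h, normc h <= r -> normc (f (o + h) - f o - h * d) <= K * normc h ^+ 2) ->
  cderiv f o d.
Proof.
move=> r0 K0 H e e0.
have K1 : 0 < K + 1 by rewrite ltr_wpDl.
exists (Num.min r (e / (K + 1))) => [|h]; first by rewrite lt_min r0 divr_gt0.
rewrite lt_min => /andP[hr hK]; rewrite [d * h]mulrC.
apply: le_trans (H _ (ltW hr)) _; rewrite expr2 mulrA ler_wpM2r ?normc_ge0//.
rewrite ltr_pdivlMr// in hK; rewrite mulrC; apply: le_trans (ltW hK).
by rewrite ler_wpM2l ?normc_ge0// lerDl.
Qed.

Lemma cderiv_shift f o z d : cderiv (fun x => f (o + x)) z d <-> cderiv f (o + z) d.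
Proof.
by split=> H e /H[r r0 Hr]; exists r => // h /Hr; rewrite addrA.
Qed.

Lemma near_disc z o (r r' : R) h : normc (z - o) <= r -> normc h <= r' ->
  normc (z + h - o) <= r + r'.
Proof.
move=> zr hr; have -> : z + h - o = (z - o) + h by ring.
by apply: le_trans (le_normcD _ _) _; exact: lerD.
Qed.

(** [cauchy_quadratic_center] is applied to the square of side [r] about [o],
   which lies in the disc; the slope it provides has to be [f1 o]. *)
Lemma cauchy_quadratic f (f1 : C -> C) o r B : 0 < r -> 0 <= B ->
  (forall z, normc (z - o) <= r -> cderiv f z (f1 z)) ->
  (forall z, normc (z - o) <= r -> normc (f z) <= B) ->
  normc (f1 o) <= 16 * B / r /\ forall h, normc h <= r / 4 ->
    normc (f (o + h) - f o - h * f1 o) <= 64 * B / r ^+ 2 * normc h ^+ 2.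
Proof.
move=> r0 B0 fd fB.
have rho0 : 0 < r / 2 by rewrite divr_gt0.
have insq z : sq (- (r / 2)%:C - (r / 2)%:C * 'i) (r / 2 + r / 2) z ->
    normc (o + z - o) <= r.
  move=> [/andP[+ +] /andP[+ +]]; rewrite !ReImE/= => a1 a2 a3 a4.
  rewrite addrAC subrr add0r; apply: le_trans (normc_le_ReIm _) _.
  by rewrite [r]splitr lerD// ler_norml; apply/andP; split; lra.
have [||d dB Hd] := @cauchy_quadratic_center R _ rho0 B B0 (fun z => f (o + z)).
- by move=> z /insq/fd fz; apply: (@cderiv_derivable _ _ (f1 (o + z))); apply/cderiv_shift.
- by move=> z /insq/fB.
have e1 : 8 * B / (r / 2) = 16 * B / r by field; rewrite gt_eqF.
have e2 : 16 * B / (r / 2) ^+ 2 = 64 * B / r ^+ 2 by field; rewrite gt_eqF.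
rewrite {}e1 in dB; rewrite {}e2 in Hd.
have -> : f1 o = d.
  apply: (@cderiv_unique f o); first by apply: fd; rewrite subrr normc0 ltW.
  apply: (@quadratic_cderiv _ _ _ (r / 4) (64 * B / r ^+ 2)).
  - by rewrite divr_gt0.
  - by rewrite divr_ge0 ?exprn_ge0 ?mulr_ge0// ltW.
  - move=> h hr; rewrite -{2}(addr0 o); apply: Hd; lra.
by split=> // h hr; rewrite -{2}(addr0 o); apply: Hd; lra.
Qed.

(** Cauchy's estimates bound the quadratic remainders of the [F n] uniformly in
   [n], so that [quadratic_limit] applies. *)
Lemma bounded_limit_cderiv (F : nat -> C -> C) (F1 : nat -> C -> C) f o r B :
  0 < r -> 0 <= B ->
  (forall n z, normc (z - o) <= r -> cderiv (F n) z (F1 n z)) ->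
  (forall n z, normc (z - o) <= r -> normc (F n z) <= B) ->
  (forall z, normc (z - o) <= r -> tends (F ^~ z) (f z)) ->
  exists d, cderiv f o d.
Proof.
move=> r0 B0 Fd FB Ff.
have r4 : 0 < r / 4 by rewrite divr_gt0.
have K0 : 0 <= 64 * B / r ^+ 2 by rewrite divr_ge0 ?exprn_ge0 ?mulr_ge0// ltW.
have Q n := cauchy_quadratic r0 B0 (Fd n) (FB n).
have [|||d _ Hd] := @quadratic_limit R (fun n h => F n (o + h)) (fun h => f (o + h))
    (fun n => F1 n o) (r / 4) (64 * B / r ^+ 2) (16 * B / r) r4 K0.
- by move=> n h hr; rewrite addr0; exact: (Q n).2.
- move=> h hr; apply: Ff; rewrite addrAC subrr add0r; lra.
- by move=> n; exact: (Q n).1.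
exists d; apply: (@quadratic_cderiv _ _ _ (r / 4) (64 * B / r ^+ 2)) => // h hr.
by have := Hd _ hr; rewrite addr0.
Qed.

(** The difference quotients along one real sequence of increments suffice to
   exhibit derivatives as bounded limits, for [bounded_limit_cderiv]. *)
Lemma difference_quotients f d o r B K : 0 < r -> 0 <= K ->
  normc d <= B ->
  (forall h, normc h <= r -> normc (f (o + h) - f o - h * d) <= K * normc h ^+ 2) ->
  let q n := (r / n.+1%:R)%:C^-1 * (f (o + (r / n.+1%:R)%:C) - f o) in
  (forall n, normc (q n) <= B + K * r) /\ tends q d.
Proof.
move=> r0 K0 dB H q.
have t0 n : 0 < r / n.+1%:R by rewrite divr_gt0.
have nt n : normc ((r / n.+1%:R)%:C : C) = r / n.+1%:R by rewrite normcR gtr0_norm.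
have tr n : r / n.+1%:R <= r by rewrite ler_pdivrMr// ler_pMr// ler1n.
have qd n : normc (q n - d) <= K * (r / n.+1%:R).
  have tC0 : (r / n.+1%:R)%:C != 0 :> C by rewrite -normc_gt0 nt.
  have -> : q n - d =
      (f (o + (r / n.+1%:R)%:C) - f o - (r / n.+1%:R)%:C * d) / (r / n.+1%:R)%:C.
    by rewrite /q; move: (_%:C) tC0 => x x0; field.
  rewrite normcM normcV nt ler_pdivrMr// -mulrA -expr2.
  by rewrite -{3}nt; apply: H; rewrite nt.
split=> [n|e e0].
  have -> : q n = d + (q n - d) by ring.
  apply: le_trans (le_normcD _ _) _; apply: lerD => //.
  by apply: le_trans (qd n) _; rewrite ler_wpM2l.
exists (Num.bound (K * r / e)) => n Mn; apply: le_trans (qd n) _.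
rewrite mulrA ler_pdivrMr// [leRHS]mulrC -ler_pdivrMr//.
apply: ltW; apply: lt_le_trans (archi_boundP _) _; first by rewrite divr_ge0 ?mulr_ge0// ltW.
by rewrite ler_nat leqW.
Qed.

Lemma derivative_cderiv f (f1 : C -> C) o r B : 0 < r -> 0 <= B ->
  (forall z, normc (z - o) <= r -> cderiv f z (f1 z)) ->
  (forall z, normc (z - o) <= r -> normc (f z) <= B) ->
  exists d, cderiv f1 o d.
Proof.
move=> r0 B0 fd fB.
pose s := r / 2; have s0 : 0 < s by rewrite divr_gt0.
pose t := s / 4; have t0 : 0 < t by rewrite divr_gt0.
have K0 : 0 <= 64 * B / s ^+ 2 by rewrite divr_ge0 ?exprn_ge0 ?mulr_ge0// ltW.
have sub z h : normc (z - o) <= s -> normc h <= s -> normc (z + h - o) <= r.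
  by move=> zs hs; rewrite [r]splitr; exact: near_disc.
have Q z (zs : normc (z - o) <= s) : normc (f1 z) <= 16 * B / s /\
    forall h, normc h <= t -> normc (f (z + h) - f z - h * f1 z) <= 64 * B / s ^+ 2 * normc h ^+ 2.
  apply: cauchy_quadratic => // w ws; have := sub z (w - z) zs ws; rewrite [z + _]addrC subrK.
    exact: fd.
  exact: fB.
have D z (zs : normc (z - o) <= s) := difference_quotients t0 K0 (Q z zs).1 (Q z zs).2.
have nt n : normc ((t / n.+1%:R)%:C : C) <= s.
  rewrite normcR gtr0_norm ?divr_gt0// ler_pdivrMr//.
  apply: (@le_trans _ _ s); first by rewrite /t; lra.
  by rewrite ler_peMr ?ler1n// ltW.
apply: (@bounded_limit_cderiv
   (fun n z => (t / n.+1%:R)%:C^-1 * (f (z + (t / n.+1%:R)%:C) - f z))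
   (fun n z => (t / n.+1%:R)%:C^-1 * (f1 (z + (t / n.+1%:R)%:C)) + (- (t / n.+1%:R)%:C^-1) * f1 z)
   f1 o s (16 * B / s + 64 * B / s ^+ 2 * t)) => //.
- by rewrite addr_ge0 ?(mulr_ge0 K0 (ltW t0))// divr_ge0 ?mulr_ge0// ltW.
- move=> n z zs.
  rewrite (_ : (fun z => _) = (fun z => (t / n.+1%:R)%:C^-1 * (fun x => f (x + (t / n.+1%:R)%:C)) z + (- (t / n.+1%:R)%:C^-1) * f z)); last first.
    by apply/funext => x /=; ring.
  apply: cderiv_lin.
    rewrite (_ : (fun x => _) = (fun x => f ((t / n.+1%:R)%:C + x))); last first.
      by apply/funext => x; rewrite addrC.
    apply/cderiv_shift; rewrite addrC; exact/fd/sub.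
  by apply: fd; have := sub z 0 zs; rewrite addr0 normc0; apply; rewrite ltW.
- by move=> n z /D[].
- by move=> z /D[].
Qed.

End Regularity.

(** * Partial derivatives of holomorphic functions of two variables *)

Section TwoVariables.
Context {R : realType}.
Local Notation C := R[i].
Implicit Types (g : C -> C -> C) (z w h l a b : C).

Definition fderiv g z w a b := forall e : R, 0 < e -> exists2 r : R, 0 < r &
  forall h l, normc h < r -> normc l < r ->
    normc (g (z + h) (w + l) - g z w - (a * h + b * l)) <= e * (normc h + normc l).

Lemma fderiv_swap g z w a b :
  fderiv g z w a b <-> fderiv (fun w z => g z w) w z b a.
Proof.
by split=> H e /H[r r0 Hr]; exists r => // h l hr lr;
  rewrite [_ * h + _]addrC [normc h + _]addrC; exact: Hr.
Qed.

Lemma fderiv_cderiv g z w a b : fderiv g z w a b -> cderiv (g ^~ w) z a.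
Proof.
move=> H e /H[r r0 Hr]; exists r => // h hr.
by have := Hr h 0; rewrite normc0 !addr0 mulr0 addr0; apply.
Qed.

(** The derivatives of the quotients [(g z (w + l) - g z w) / l] in [z]
   converge as [l] tends to 0, uniformly enough to give a first order
   expansion of the partial derivative in both variables. *)
Lemma partial_fderiv g (G1 G2 : C -> C -> C) z0 w0 (r : R) : 0 < r ->
  (forall z w, normc (z - z0) < r -> normc (w - w0) < r ->
     fderiv g z w (G1 z w) (G2 z w)) ->
  exists a b, fderiv G1 z0 w0 a b.
Proof.
move=> r0 gd.
have [p [B [p0 B0 pr gB]]] : exists p B : R, [/\ 0 < p, 0 <= B, p < r &
    forall z w, normc (z - z0) <= p -> normc (w - w0) <= p -> normc (g z w) <= B].
  have /(_ 1 ltr01)[r1 r10 H1] := gd z0 w0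
    ltac:(by rewrite subrr normc0) ltac:(by rewrite subrr normc0).
  pose p := Num.min r r1 / 2.
  have m0 : 0 < Num.min r r1 by rewrite lt_min r0.
  have p0 : 0 < p by rewrite divr_gt0.
  have : p < Num.min r r1 by rewrite ltr_pdivrMr// ltr_pMr// ltr1n.
  rewrite lt_min => /andP[pr pr1].
  pose a := normc (G1 z0 w0); pose b := normc (G2 z0 w0).
  have a0 : 0 <= a := normc_ge0 _; have b0 : 0 <= b := normc_ge0 _.
  exists p, (normc (g z0 w0) + (a * p + b * p) + (p + p)).
  split=> //; first by do !apply: addr_ge0; rewrite ?normc_ge0 ?(ltW p0) ?(mulr_ge0 _ (ltW p0)).
  move=> z w zp wp.
  have := H1 (z - z0) (w - w0) (le_lt_trans zp pr1) (le_lt_trans wp pr1).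
  rewrite [z0 + _]addrC subrK [w0 + _]addrC subrK mul1r => H.
  have -> : g z w = g z0 w0 + (G1 z0 w0 * (z - z0) + G2 z0 w0 * (w - w0)) +
     (g z w - g z0 w0 - (G1 z0 w0 * (z - z0) + G2 z0 w0 * (w - w0))) by ring.
  apply: le_trans (le_normcD _ _) _; apply: lerD; last first.
    by apply: le_trans H _; exact: lerD.
  apply: le_trans (le_normcD _ _) _; apply: lerD => //.
  apply: le_trans (le_normcD _ _) _; rewrite !normcM.
  by apply: lerD; rewrite ler_wpM2l ?normc_ge0.
have {}gd z w : normc (z - z0) <= p -> normc (w - w0) <= p -> fderiv g z w (G1 z w) (G2 z w).
  by move=> zp wp; apply: gd; exact: le_lt_trans pr.
have cz z w : normc (z - z0) <= p -> normc (w - w0) <= p -> cderiv (g ^~ w) z (G1 z w).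
  by move=> zp wp; exact: fderiv_cderiv (gd z w zp wp).
have cw z w : normc (z - z0) <= p -> normc (w - w0) <= p -> cderiv (g z) w (G2 z w).
  by move=> zp wp; have /fderiv_swap/fderiv_cderiv := gd z w zp wp.
have nw0 : normc (w0 - w0) <= p by rewrite subrr normc0 ltW.
have nz0 x : 0 <= x -> normc (z0 - z0) <= x by rewrite subrr normc0.
pose s := p / 2; have s0 : 0 < s by rewrite divr_gt0.
have sp : s <= p by rewrite /s; lra.
pose t := p / 4; have t0 : 0 < t by rewrite divr_gt0.
pose K := 64 * B / p ^+ 2.
have K0 : 0 <= K by rewrite divr_ge0 ?exprn_ge0 ?mulr_ge0// ltW.
pose B1 := 16 * B / p; have B10 : 0 <= B1 by rewrite divr_ge0 ?mulr_ge0// ltW.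
pose k z := G2 z w0.
have Qw z (zp : normc (z - z0) <= p) : normc (k z) <= B1 /\
    forall l, normc l <= t -> normc (g z (w0 + l) - g z w0 - l * k z) <= K * normc l ^+ 2.
  by apply: (@cauchy_quadratic _ (g z) (G2 z) w0 p B) => // w wp; [exact: cw | exact: gB].
have sub z z' : normc (z - z0) <= s -> normc (z' - z) <= s -> normc (z' - z0) <= p.
  move=> zs zs'; have := near_disc zs zs'.
  by rewrite [z + _]addrC subrK -splitr.
have ntt n : normc ((t / n.+1%:R)%:C : C) <= t.
  by rewrite normcR gtr0_norm ?divr_gt0// ler_pdivrMr// ler_peMr ?ler1n// ltW.
have tp l : normc l <= t -> normc (w0 + l - w0) <= p.
  by rewrite addrAC subrr add0r /t => lt; apply: le_trans lt _; lra.
(* k is a bounded limit of difference quotients of g in w, hence holomorphic *)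
have [k1 Hk1] : exists k1 : C -> C, forall z, normc (z - z0) <= s -> cderiv k z (k1 z).
  have ex z : exists d, normc (z - z0) <= s -> cderiv k z d.
    have [zs|] := pselect (normc (z - z0) <= s); last by exists 0.
    have D z' (zs' : normc (z' - z) <= s) :=
      difference_quotients t0 K0 (Qw z' (sub z z' zs zs')).1 (Qw z' (sub z z' zs zs')).2.
    have [||||d Hd] := @bounded_limit_cderiv R
      (fun n z => (t / n.+1%:R)%:C^-1 * (g z (w0 + (t / n.+1%:R)%:C) - g z w0))
      (fun n z => (t / n.+1%:R)%:C^-1 * G1 z (w0 + (t / n.+1%:R)%:C) + (- (t / n.+1%:R)%:C^-1) * G1 z w0)
      k z s (B1 + K * t) s0.
    - by rewrite addr_ge0 ?(mulr_ge0 K0 (ltW t0)).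
    - move=> n z' zs'; have z'p := sub z z' zs zs'.
      rewrite (_ : (fun z => _) = (fun z => (t / n.+1%:R)%:C^-1 * (g ^~ (w0 + (t / n.+1%:R)%:C)) z
          + (- (t / n.+1%:R)%:C^-1) * (g ^~ w0) z)); last by apply/funext => x /=; ring.
      by apply: cderiv_lin; [exact/cz/tp/ntt | exact: cz].
    - by move=> n z' /D[].
    - by move=> z' /D[].
    by exists d.
  have [k1 Hk1] := choice ex; by exists k1.
(* Cauchy's estimate in z for the quadratic remainder of the expansion in w *)
have rem z l : normc (z - z0) <= s / 2 -> normc l <= t ->
    normc (G1 z (w0 + l) - G1 z w0 - l * k1 z) <= 16 * (K * normc l ^+ 2) / (s / 2).
  move=> zs lt.
  have sub2 z' : normc (z' - z) <= s / 2 -> normc (z' - z0) <= s.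
    move=> zs'; have := near_disc zs zs'.
    by rewrite [z + _]addrC subrK -splitr.
  have [||||H _] := @cauchy_quadratic R
    (fun z => 1 * (fun z => 1 * g z (w0 + l) + (-1) * g z w0) z + (- l) * k z)
    (fun z => 1 * (1 * G1 z (w0 + l) + (-1) * G1 z w0) + (- l) * k1 z)
    z (s / 2) (K * normc l ^+ 2).
  - by rewrite divr_gt0.
  - by rewrite mulr_ge0 ?exprn_ge0 ?normc_ge0.
  - move=> z' /sub2 z's; have z'p := le_trans z's sp.
    apply: cderiv_lin; last exact: Hk1.
    by apply: (cderiv_lin _ _ (cz _ _ _ _)); [|exact: tp|exact: cz].
  - move=> z' /sub2 z's; have z'p := le_trans z's sp.
    have -> : 1 * (fun z => 1 * g z (w0 + l) + (-1) * g z w0) z' + (- l) * k z' =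
      g z' (w0 + l) - g z' w0 - l * k z' by ring.
    exact: (Qw z' z'p).2.
  apply: le_trans H; rewrite le_eqVlt; apply/orP; left; apply/eqP; congr normc; ring.
have [a Ha] : exists a, cderiv (G1 ^~ w0) z0 a.
  apply: (@derivative_cderiv R (g ^~ w0) (G1 ^~ w0) z0 p B) => // z zp; first exact: cz.
  exact: gB.
have [b' Hb'] : exists b', cderiv k1 z0 b'.
  apply: (@derivative_cderiv R k k1 z0 s B1) => // z zs.
  by apply: (Qw z _).1; exact: le_trans sp.
exists a, (k1 z0) => e e0.
have [r1 r10 H1] := Ha _ e0; have [r2 r20 H2] := Hb' _ ltr01.
pose L := 16 * K / (s / 2).
have s20 : 0 < s / 2 by rewrite divr_gt0.
have L0 : 0 <= L := divr_ge0 (mulr_ge0 (ler0n _ 16) K0) (ltW s20).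
pose M := L + normc b' + 1.
have M0 : 0 < M by rewrite ltr_wpDl// addr_ge0 ?normc_ge0.
pose q := Num.min (Num.min r1 r2) (Num.min (Num.min t (s / 2)) (e / M)).
exists q; first by rewrite /q !lt_min r10 r20 t0 !divr_gt0.
move=> h l; rewrite /q !lt_min => /andP[/andP[h1 h2] /andP[/andP[h3 h4] h5]].
move=> /andP[/andP[l1 l2] /andP[/andP[l3 l4] l5]].
have {}H1 := H1 h h1; have {}H2 := H2 h h2; rewrite mul1r in H2.
have zh : normc (z0 + h - z0) <= s / 2 by rewrite addrAC subrr add0r ltW.
have H3 := rem (z0 + h) l zh (ltW l3).
have -> : G1 (z0 + h) (w0 + l) - G1 z0 w0 - (a * h + k1 z0 * l) =
  (G1 (z0 + h) w0 - G1 z0 w0 - a * h) +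
  (G1 (z0 + h) (w0 + l) - G1 (z0 + h) w0 - l * k1 (z0 + h)) +
  l * ((k1 (z0 + h) - k1 z0 - b' * h) + b' * h) by ring.
have H4 : normc (k1 (z0 + h) - k1 z0 - b' * h + b' * h) <= (normc b' + 1) * (e / M).
  apply: le_trans (le_normcD _ _) _; rewrite normcM addrC.
  apply: (@le_trans _ _ ((normc b' + 1) * normc h)); first by rewrite mulrDl mul1r lerD2l.
  by rewrite ler_wpM2l ?addr_ge0 ?normc_ge0// ltW.
have H5 : 16 * (K * normc l ^+ 2) / (s / 2) <= normc l * (L * (e / M)).
  have -> : 16 * (K * normc l ^+ 2) / (s / 2) = normc l * (L * normc l) by rewrite /L; ring.
  by rewrite ler_wpM2l ?normc_ge0// ler_wpM2l// ltW.
apply: le_trans (le_normcD _ _) _.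
apply: le_trans (lerD (le_normcD _ _) (lexx _)) _.
rewrite normcM.
have H6 := ler_wpM2l (normc_ge0 l) H4.
have -> : e * (normc h + normc l) = e * normc h +
    (normc l * (L * (e / M)) + normc l * ((normc b' + 1) * (e / M))).
  rewrite mulrDr; congr (_ + _); rewrite -mulrDr -mulrDl addrA -/M.
  by field; rewrite gt_eqF.
lra.
Qed.

End TwoVariables.

Section FrechetBridge.
Context {R : realType}.
Local Notation C := R[i].
Local Notation C2 := 'rV[C]_2.
Implicit Types (f : C2 -> C) (q v : C2) (z w h l a b : C).

Definition vec2 z w : C2 := \row_(j < 2) (if j == 0 then z else w).

Lemma vec2_0 z w : vec2 z w 0 0 = z. Proof. by rewrite mxE eqxx. Qed.
Lemma vec2_1 z w : vec2 z w 0 1 = w. Proof. by rewrite mxE. Qed.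

Lemma vec2_eta q : vec2 (q 0 0) (q 0 1) = q.
Proof.
apply/rowP => j; rewrite mxE; case: j => [[|[|//]]] i /=.
  by congr (q 0 _); apply: val_inj.
by congr (q 0 _); apply: val_inj.
Qed.

Lemma vec2D z w h l : vec2 z w + vec2 h l = vec2 (z + h) (w + l).
Proof. by apply/rowP => j; rewrite !mxE; case: eqP. Qed.

Lemma vec2Z a z w : a *: vec2 z w = vec2 (a * z) (a * w).
Proof. by apply/rowP => j; rewrite !mxE; case: eqP. Qed.

Lemma nbhs_vec2P q (A : set C2) :
  nbhs q A <-> exists2 r : R, 0 < r & forall h l, normc h < r -> normc l < r ->
    A (q + vec2 h l).
Proof.
rewrite nbhs_ballP; split=> [[e e0 eA]|[r r0 rA]].
  have er : e = (Re e)%:C by rewrite RRe_real// gtr0_real.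
  exists (Re e) => [|h l hr lr]; first by rewrite -ltcR -er.
  apply: eA; split=> // i j; rewrite -ball_normE/= !mxE (ord1 i).
  rewrite opprD addrA subrr add0r normrN normc_abs er ltcR.
  by case: ifP.
exists r%:C => [|w]; first by rewrite /= ltcR.
move=> [_ H]; have -> : w = q + vec2 (w 0 0 - q 0 0) (w 0 1 - q 0 1).
  rewrite -[X in X + _]vec2_eta vec2D ![q _ _ + _]addrC !subrK; exact/esym/vec2_eta.
apply: rA; rewrite -ltcR -normc_abs distrC.
  by have := H 0 0; rewrite -ball_normE.
by have := H 0 1; rewrite -ball_normE.
Qed.

Lemma coord_norm_le q j : `|q 0 j| <= `|q|.
Proof.
rewrite [leRHS]/Num.Def.normr/= mx_normE.
have -> : `|q 0 j| = (`|q 0 j|%:nng)%:num by [].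
rewrite num_le; exact: (le_bigmax _ (fun i : 'I_1 * 'I_2 => `|q i.1 i.2|%:nng) (0, j)).
Qed.

Lemma vec2_norm_le : exists2 c : R, 0 < c & forall h l,
  `|vec2 h l| <= (c * (normc h + normc l))%:C.
Proof.
pose c := normc `|vec2 1 0| + normc `|vec2 0 1| + 1.
exists c => [|h l]; first by rewrite ltr_wpDl// addr_ge0 ?normc_ge0.
have -> : vec2 h l = h *: vec2 1 0 + l *: vec2 0 1.
  by rewrite !vec2Z vec2D !mulr0 !mulr1 addr0 add0r.
apply: le_trans (ler_normD _ _) _; rewrite !normrZ !normc_abs.
rewrite -(ger0_norm (normr_ge0 (vec2 1 0))) -(ger0_norm (normr_ge0 (vec2 0 1))) !normc_abs.
rewrite -!rmorphM -rmorphD lecR /c.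
have a0 := normc_ge0 `|vec2 1 0|; have b0 := normc_ge0 `|vec2 0 1|.
have h0 := normc_ge0 h; have l0 := normc_ge0 l.
have := mulr_ge0 h0 b0; have := mulr_ge0 l0 a0.
by rewrite !mulrDl !mulrDr !mul1r ![normc `|_| * _]mulrC; lra.
Qed.

(** With the converse [fderiv_differentiable], this transfers differentiability
   over [C] to estimates in [R]. *)
Lemma differentiable_fderiv f q : differentiable f q ->
  fderiv (fun z w => f (vec2 z w)) (q 0 0) (q 0 1)
    ('D_(vec2 1 0) f q) ('D_(vec2 0 1) f q).
Proof.
move=> df e e0; rewrite !deriveE//.
  have [c c0 Hc] := vec2_norm_le.
  have /eqaddoP := diff_locally df.
  have ec0 : 0 < (e / c)%:C by rewrite ltcR divr_gt0.
  move=> /(_ _ ec0)/nbhs_vec2P[r r0 Hr]; exists r => // h l hr lr.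
  have := Hr h l hr lr; rewrite add0r /= => H.
  rewrite -lecR -normc_abs.
  have -> : f (vec2 (q 0 0 + h) (q 0 1 + l)) - f (vec2 (q 0 0) (q 0 1)) -
     ('d f q (vec2 1 0) * h + 'd f q (vec2 0 1) * l) =
     (f \o shift q - (cst (f q) + 'd f q)) (vec2 h l).
    have -> : (f \o shift q - (cst (f q) + 'd f q)) (vec2 h l) =
       f (vec2 h l + q) - (f q + 'd f q (vec2 h l)) by [].
    rewrite -vec2D vec2_eta [q + _]addrC.
    have -> : 'd f q (vec2 h l) = h * 'd f q (vec2 1 0) + l * 'd f q (vec2 0 1).
      rewrite -[X in 'd f q X](_ : h *: vec2 1 0 + l *: vec2 0 1 = _); last first.
        by rewrite !vec2Z vec2D !mulr0 !mulr1 addr0 add0r.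
      by rewrite linearD !linearZ.
    ring.
  apply: le_trans H _.
  apply: (@le_trans _ _ ((e / c)%:C * (c * (normc h + normc l))%:C)).
    by rewrite ler_wpM2l// ltW.
  by rewrite -rmorphM lecR mulrA divfK// gt_eqF.
Qed.

Lemma fderiv_differentiable f q a b :
  fderiv (fun z w => f (vec2 z w)) (q 0 0) (q 0 1) a b -> differentiable f q.
Proof.
move=> fd.
- pose L v : C := a * v 0 0 + b * v 0 1.
  have dL v : differentiable L v.
    apply: differentiableD.
      apply: differentiableM; first exact: differentiable_cst.
      exact: differentiable_coord.
    apply: differentiableM; first exact: differentiable_cst.
    exact: differentiable_coord.
  pose g v := f v - L v.
  have dg : differentiable g q.
    have d0 : ('d (cst (0 : C)) q : C2 -> C) = 0 := diff_cst _ _.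
    have h0 : g \o shift q = cst (g q) + 'd (cst (0 : C)) q +o_ (0 : C2) id.
      rewrite d0.
      apply/eqaddoP => e e0.
      have er : e = (Re e)%:C by rewrite RRe_real// gtr0_real.
      have e20 : 0 < Re e / 2 by rewrite divr_gt0// -ltcR -er.
      have [r r0 Hr] := fd _ e20.
      apply/nbhs_vec2P; exists r => // h l hr lr; rewrite add0r.
      have := Hr h l hr lr.
      have -> : (g \o shift q - (cst (g q) + 0)) (vec2 h l) =
        g (vec2 h l + q) - (g q + 0) by [].
      rewrite -vec2D vec2_eta [q + _]addrC addr0 /g /L.
      have -> : f (vec2 h l + q) - (a * (vec2 h l + q) 0 0 + b * (vec2 h l + q) 0 1) -
         (f q - (a * q 0 0 + b * q 0 1)) = f (vec2 h l + q) - f q - (a * h + b * l).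
        by rewrite ![(_ + q) _ _]mxE vec2_0 vec2_1; ring.
      rewrite -lecR -normc_abs => /le_trans; apply.
      rewrite [X in _ <= X * _]er.
      apply: (@le_trans _ _ ((Re e / 2)%:C * (2 * `|vec2 h l|))).
        rewrite rmorphM ler_wpM2l//; first by rewrite ltW// ltcR.
        rewrite rmorphD/= -!normc_abs mulr2n mulrDl !mul1r; apply: lerD.
          by rewrite -[X in `|X|](vec2_0 h l); exact: coord_norm_le.
        by rewrite -[X in `|X|](vec2_1 h l); exact: coord_norm_le.
      by rewrite mulrA rmorphM fmorphV/= rmorph_nat divfK// pnatr_eq0.
    have c0 : continuous ('d (cst (0 : C)) q) by rewrite d0 => x; exact: cst_continuous.
    apply/diff_locallyP; rewrite (diff_unique c0 h0); split=> //.
  have -> : f = g + L by apply/funext => v; rewrite /g; exact/esym/subrK.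
  exact: differentiableD.
Qed.

Lemma diff_vec2 f q v : 'd f q v = 'd f q (vec2 1 0) * v 0 0 + 'd f q (vec2 0 1) * v 0 1.
Proof.
rewrite -[in LHS](vec2_eta v).
rewrite -[X in 'd f q X = _](_ : v 0 0 *: vec2 1 0 + v 0 1 *: vec2 0 1 = _); last first.
  by rewrite !vec2Z vec2D !mulr0 !mulr1 addr0 add0r.
by rewrite linearD !linearZ /=; congr (_ + _); exact: mulrC.
Qed.

Lemma derive_vec2 f q v : differentiable f q ->
  'D_v f q = 'D_(vec2 1 0) f q * v 0 0 + 'D_(vec2 0 1) f q * v 0 1.
Proof. by move=> df; rewrite !deriveE// diff_vec2. Qed.

Lemma fderiv_lin (g g' k : C -> C -> C) z w a b a' b' (s t : C) :
  fderiv g z w a b -> fderiv g' z w a' b' ->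
  (exists2 r : R, 0 < r & forall h l, normc h < r -> normc l < r ->
     k (z + h) (w + l) = s * g (z + h) (w + l) + t * g' (z + h) (w + l)) ->
  fderiv k z w (s * a + t * a') (s * b + t * b').
Proof.
move=> gd gd' [r r0 kE] e e0.
pose A := normc s + normc t + 1.
have A0 : 0 < A by rewrite ltr_wpDl// addr_ge0 ?normc_ge0.
have eA : 0 < e / A by rewrite divr_gt0.
have [r1 r10 H1] := gd _ eA; have [r2 r20 H2] := gd' _ eA.
exists (Num.min r (Num.min r1 r2)) => [|h l]; first by rewrite !lt_min r0 r10.
rewrite !lt_min => /andP[h0 /andP[h1 h2]] /andP[l0 /andP[l1 l2]].
have k0 : k z w = s * g z w + t * g' z w.
  by have := kE 0 0; rewrite normc0 !addr0; apply.
rewrite kE// k0.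
have -> : s * g (z + h) (w + l) + t * g' (z + h) (w + l) - (s * g z w + t * g' z w) -
    ((s * a + t * a') * h + (s * b + t * b') * l) =
   s * (g (z + h) (w + l) - g z w - (a * h + b * l)) +
   t * (g' (z + h) (w + l) - g' z w - (a' * h + b' * l)) by ring.
apply: le_trans (le_normcD _ _) _; rewrite !normcM.
have := ler_wpM2l (normc_ge0 s) (H1 h l h1 l1).
have := ler_wpM2l (normc_ge0 t) (H2 h l h2 l2).
have -> : e * (normc h + normc l) = A * (e / A * (normc h + normc l)) by field; rewrite gt_eqF.
have : 0 <= e / A * (normc h + normc l) by rewrite mulr_ge0 ?addr_ge0 ?normc_ge0// ltW.
by rewrite /A; move: (e / _ * _) => x; rewrite !mulrDl mul1r; lra.
Qed.

(** A directional derivative is a fixed linear combination of the two partial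
   derivatives, to which [partial_fderiv] applies. *)
Theorem holomorphic_derive f (O : set C2) v : open O ->
  (forall q, O q -> differentiable f q) -> forall q, O q -> differentiable ('D_v f) q.
Proof.
move=> Oo Of q Oq.
have /nbhs_vec2P[r r0 Hr] := open_nbhs_nbhs (conj Oo Oq).
have inO z w : normc (z - q 0 0) < r -> normc (w - q 0 1) < r -> O (vec2 z w).
  move=> zr wr; have := Hr _ _ zr wr; rewrite -[X in X + _]vec2_eta vec2D.
  by rewrite ![q _ _ + _]addrC !subrK.
pose G1 z w := 'D_(vec2 1 0) f (vec2 z w); pose G2 z w := 'D_(vec2 0 1) f (vec2 z w).
have fd z w : normc (z - q 0 0) < r -> normc (w - q 0 1) < r ->
    fderiv (fun z w => f (vec2 z w)) z w (G1 z w) (G2 z w).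
  move=> zr wr; have := differentiable_fderiv (Of _ (inO _ _ zr wr)).
  by rewrite vec2_0 vec2_1.
have [a [b H1]] := partial_fderiv r0 fd.
have [b' [a' /fderiv_swap H2]] : exists b a, fderiv (fun w z => G2 z w) (q 0 1) (q 0 0) b a.
  apply: (@partial_fderiv _ (fun w z => f (vec2 z w)) (fun w z => G2 z w) (fun w z => G1 z w) _ _ _ r0).
  by move=> w z wr zr; apply/fderiv_swap; exact: fd.
apply: (@fderiv_differentiable _ _ (v 0 0 * a + v 0 1 * a') (v 0 0 * b + v 0 1 * b')).
apply: (fderiv_lin H1 H2); exists r => // h l hr lr.
rewrite derive_vec2; first by rewrite /G1 /G2 ![v _ _ * _]mulrC.
by apply: Of; apply: inO; rewrite addrAC subrr add0r.
Qed.

End FrechetBridge.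

(** * Mean value inequality and weighted Taylor expansion *)

Section MeanValue.
Context {R : realType}.
Local Notation C := R[i].

Lemma is_derive_eps (f : R -> R) (x d : R) :
  (forall e : R, 0 < e -> exists2 r : R, 0 < r & forall h, `|h| < r ->
     `|f (x + h) - f x - d * h| <= e * `|h|) -> is_derive x 1 f d.
Proof.
move=> H; have lim : h^-1 *: (f (h *: 1 + x) - f x) @[h --> 0^'] --> d.
  apply/cvgrPdist_le => e e0; have [r r0 Hr] := H e e0.
  exists r => //= h; rewrite /ball_ /= sub0r normrN => hr h0.
  have := Hr h hr; rewrite -ler_pdivrMr ?normr_gt0// -normfV -normrM.
  rewrite -normrN; congr (`|_| <= _).
  by rewrite /GRing.scale/= mulr1 [h + x]addrC; field.
apply: DeriveDef; first by apply/cvg_ex; exists d.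
exact: cvg_lim lim.
Qed.

Lemma mean_value01 (f df : R -> R) :
  (forall t : R, 0 <= t <= 1 -> is_derive t 1 f (df t)) ->
  exists2 c, 0 <= c <= 1 & f 1 - f 0 = df c.
Proof.
move=> fd; have [x x01|x|c c01 ->] := @MVT R f df 0 1 ltr01.
- by apply: fd; move: x01; rewrite in_itv/= => /andP[? ?]; rewrite !ltW.
- apply: derivable_within_continuous => t; rewrite in_itv/= => t01.
  by have [] := fd _ t01.
- exists c; last by rewrite subr0 mulr1.
  by move: c01; rewrite in_itv/= => /andP[? ?]; rewrite !ltW.
Qed.

Lemma cderiv_ray (G : C -> C) (u z d : C) (t : R) : cderiv G (t%:C * z) d ->
  is_derive t 1 (fun s : R => Re (u * G (s%:C * z))) (Re (u * (d * z))).
Proof.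
move=> Gd; apply: is_derive_eps => e e0.
pose N := normc u * normc z + 1.
have N0 : 0 < N by rewrite ltr_wpDl// mulr_ge0 ?normc_ge0.
have eN : 0 < e / N by rewrite divr_gt0.
have [r r0 Hr] := Gd _ eN.
have z1 : 0 < normc z + 1 by rewrite ltr_wpDl// normc_ge0.
exists (r / (normc z + 1)) => [|h hr]; first by rewrite divr_gt0.
have nh : normc (h%:C * z) = `|h| * normc z by rewrite normcM normcR.
have {}Hr : normc (G (t%:C * z + h%:C * z) - G (t%:C * z) - d * (h%:C * z)) <= e / N * (`|h| * normc z).
  rewrite -nh; apply: Hr; rewrite nh.
  rewrite ltr_pdivlMr// in hr; apply: le_lt_trans hr.
  by rewrite ler_wpM2l// lerDl.
have -> : Re (u * G ((t + h)%:C * z)) - Re (u * G (t%:C * z))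
    - Re (u * (d * z)) * h =
    Re (u * (G (t%:C * z + h%:C * z) - G (t%:C * z) - d * (h%:C * z))).
  have -> : Re (u * (d * z)) * h = Re (u * (d * (h%:C * z))).
    have -> : u * (d * (h%:C * z)) = u * (d * z) * h%:C by ring.
    by rewrite [in RHS]cReM/= mulr0 subr0.
  by rewrite -cReN -cReD -cReN -cReD rmorphD/= mulrDl; congr Re; ring.
apply: le_trans (Re_le_normc _) _; rewrite normcM.
apply: le_trans (ler_wpM2l (normc_ge0 u) Hr) _.
have -> : normc u * (e / N * (`|h| * normc z)) = e * `|h| * (normc u * normc z / N) by ring.
rewrite ler_piMr ?mulr_ge0 ?(ltW e0)// ler_pdivrMr// mul1r.
by rewrite /N lerDl.
Qed.

Lemma cderiv_mean_value (G G1 : C -> C) (z : C) (e : R) :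
  (forall t : R, 0 <= t <= 1 -> cderiv G (t%:C * z) (G1 (t%:C * z))) ->
  (forall t : R, 0 <= t <= 1 -> normc (G1 (t%:C * z)) <= e) ->
  normc (G z - G 0) <= e * normc z.
Proof.
move=> Gd Ge.
have e0 : 0 <= e by rewrite (le_trans (normc_ge0 _) (Ge 0 _))// lexx ler01.
set D := G z - G 0; have [->|D0] := eqVneq D 0.
  by rewrite normc0 mulr_ge0 ?normc_ge0.
have nD : 0 < normc D by rewrite normc_gt0.
pose u := D^*.
have Hd (t : R) : 0 <= t <= 1 -> is_derive t 1 (fun s : R => Re (u * G (s%:C * z)))
    (Re (u * (G1 (t%:C * z) * z))).
  by move=> t01; exact: cderiv_ray (Gd t t01).
have [c c01] := mean_value01 Hd.
rewrite rmorph1 mul1r rmorph0 mul0r -cReN -cReD -mulrN -mulrDr -/D => Dc.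
have uD : Re (u * D) = normc D ^+ 2.
  rewrite /u; case: (D) => x y /=; rewrite mulNr opprK -!expr2 sqr_sqrtr//.
  by rewrite addr_ge0 ?sqr_ge0.
have nu : normc u = normc D by rewrite /u; case: (D) => x y /=; rewrite sqrrN.
rewrite -(ler_pM2l nD) -expr2 -uD Dc.
apply: le_trans (ler_norm _) _; apply: le_trans (Re_le_normc _) _.
rewrite !normcM nu ler_wpM2l ?normc_ge0// ler_wpM2r ?normc_ge0//.
exact: Ge.
Qed.

Lemma cderiv_exp n (z : C) : cderiv (fun z => z ^+ n.+1) z (n.+1%:R * z ^+ n).
Proof.
have [K K0 HK] : exists2 K : R, 0 <= K & forall h, normc h <= 1 ->
    normc ((z + h) ^+ n.+1 - z ^+ n.+1 - h * (n.+1%:R * z ^+ n)) <= K * normc h ^+ 2.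
  elim: n => [|n [K K0 HK]].
    exists 0 => // h _; rewrite mul0r !expr1 expr0 mulr1 mulr1.
    by rewrite [z + h]addrC addrK subrr normc0.
  exists ((normc z + 1) * K + normc (n.+1%:R * z ^+ n)) => [|h h1].
    by rewrite addr_ge0 ?mulr_ge0 ?addr_ge0 ?normc_ge0.
  have -> : (z + h) ^+ n.+2 - z ^+ n.+2 - h * (n.+2%:R * z ^+ n.+1) =
     (z + h) * ((z + h) ^+ n.+1 - z ^+ n.+1 - h * (n.+1%:R * z ^+ n)) +
      (n.+1%:R * z ^+ n) * h ^+ 2.
    rewrite -[n.+2%:R]natr1; rewrite [(z + h) ^+ n.+2]exprS [z ^+ n.+2]exprS [z ^+ n.+1]exprS.
    ring.
  apply: le_trans (le_normcD _ _) _; rewrite [leRHS]mulrDl; apply: lerD.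
    rewrite normcM -mulrA; apply: ler_pM; rewrite ?normc_ge0 ?HK//.
    by apply: le_trans (le_normcD _ _) _; rewrite lerD2l.
  by rewrite normcM normcX.
exact: (@quadratic_cderiv _ _ _ _ 1 K).
Qed.

(** A polynomial in [z] and [w], as a list of terms [(c, (i, j))] standing for
   [c z ^ i w ^ j]. *)
Definition peval (p : seq (C * (nat * nat))) (z w : C) : C :=
  \sum_(e <- p) e.1 * z ^+ e.2.1 * w ^+ e.2.2.

Definition antiz (p : seq (C * (nat * nat))) :=
  [seq (e.1 / e.2.1.+1%:R, (e.2.1.+1, e.2.2)) | e <- p].

Definition antiw0 (p : seq (C * (nat * nat))) :=
  [seq (e.1 / e.2.2.+1%:R, (0%N, e.2.2.+1)) | e <- p & e.2.1 == 0%N].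

Lemma peval_cons e p (z w : C) :
  peval (e :: p) z w = e.1 * z ^+ e.2.1 * w ^+ e.2.2 + peval p z w.
Proof. by rewrite /peval big_cons. Qed.

Lemma cderiv_cst (c z : C) : cderiv (fun=> c) z 0.
Proof.
apply: (@quadratic_cderiv _ _ _ _ 1 0) => // h _.
by rewrite subrr mulr0 subr0 normc0 mul0r.
Qed.

Lemma cderiv_antiz p (z w : C) : cderiv ((peval (antiz p))^~ w) z (peval p z w).
Proof.
elim: p => [|e p IH].
  rewrite (_ : (peval (antiz [::]))^~ w = fun=> 0) ?/peval ?big_nil; first exact: cderiv_cst.
  by apply/funext => x; rewrite big_nil.
have -> : peval (e :: p) z w =
  e.1 / e.2.1.+1%:R * w ^+ e.2.2 * (e.2.1.+1%:R * z ^+ e.2.1) + 1 * peval p z w.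
  have n0 : (e.2.1.+1%:R : C) != 0 by rewrite pnatr_eq0.
  by rewrite peval_cons mul1r; congr (_ + _); move: (_.+1%:R) n0 => n n0; field.
have := cderiv_lin (e.1 / e.2.1.+1%:R * w ^+ e.2.2) 1 (cderiv_exp e.2.1 z) IH.
congr (cderiv _ z _); apply/funext => x.
by rewrite /antiz/= peval_cons mul1r; congr (_ + _); rewrite /= mulrAC.
Qed.

Lemma cderiv_antiw0 p (z w : C) : cderiv (peval (antiw0 p) z) w (peval p 0 w).
Proof.
elim: p => [|e p IH].
  rewrite (_ : peval (antiw0 [::]) z = fun=> 0) ?/peval ?big_nil; first exact: cderiv_cst.
  by apply/funext => x; rewrite big_nil.
rewrite peval_cons /antiw0/=; have [e0|e0] := eqVneq e.2.1 0%N; last first.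
  by rewrite expr0n (negbTE e0) mulr0 mul0r add0r.
have -> : e.1 * 0 ^+ e.2.1 * w ^+ e.2.2 + peval p 0 w =
  e.1 / e.2.2.+1%:R * (e.2.2.+1%:R * w ^+ e.2.2) + 1 * peval p 0 w.
  have n0 : (e.2.2.+1%:R : C) != 0 by rewrite pnatr_eq0.
  by rewrite mul1r e0 expr0; congr (_ + _); move: (_.+1%:R) n0 => n n0; field.
have := cderiv_lin (e.1 / e.2.2.+1%:R) 1 (cderiv_exp e.2.2 w) IH.
congr (cderiv _ w _); apply/funext => x.
by rewrite /= peval_cons mul1r; congr (_ + _); rewrite /= expr0 mulr1.
Qed.

Lemma peval_antiz0 p (w : C) : peval (antiz p) 0 w = 0.
Proof. by rewrite /peval big_map big1// => e _; rewrite expr0n/= mulr0 mul0r. Qed.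

Lemma peval_antiw00 p (z : C) : peval (antiw0 p) z 0 = 0.
Proof. by rewrite /peval big_map big_filter big1// => e _; rewrite expr0n/= mulr0. Qed.

Lemma peval_antiw0 p (z z' w : C) : peval (antiw0 p) z w = peval (antiw0 p) z' w.
Proof. by rewrite /peval !big_map !big_filter; apply: eq_bigr => e _; rewrite !expr0. Qed.

End MeanValue.

Section WeightedTaylor.
Context {R : realType}.
Local Notation C := R[i].
Local Notation C2 := 'rV[C]_2.

Lemma exprB_le (t : R) (M a : nat) : 0 <= t <= 1 -> t ^+ a * t ^+ (M - a) <= t ^+ M.
Proof.
move=> /andP[t0 t1]; rewrite -exprD; apply: ler_wiXn2l => //.
by rewrite -leq_subLR.
Qed.

Lemma near_small (A r : R) : 0 < r -> \forall t \near 0^'+, `|A| * t < r.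
Proof.
move=> r0; near=> t.
have A1 : 0 < `|A| + 1 by rewrite ltr_wpDl.
have t0 : 0 < t by near: t; exact: nbhs_right_gt.
apply: (@le_lt_trans _ _ ((`|A| + 1) * t)); first by rewrite ler_pM2r// lerDl.
rewrite mulrC -ltr_pdivlMr//; near: t; apply: nbhs_right_lt; exact: divr_gt0.
Unshelve. all: by end_near. Qed.

Lemma near_unit : \forall t \near (0 : R)^'+, 0 < t <= 1.
Proof.
near=> t; apply/andP; split; near: t; first exact: nbhs_right_gt.
exact: nbhs_right_le.
Unshelve. all: by end_near. Qed.

Lemma weight_small (A r t : R) (a : nat) x : (0 < a)%N -> 0 < t <= 1 -> `|A| * t < r ->
  x <= A * t ^+ a -> x < r.
Proof.
move=> a0 /andP[t0 t1] Ar xA; apply: le_lt_trans xA _; apply: le_lt_trans Ar.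
apply: (@le_trans _ _ (`|A| * t ^+ a)); first by rewrite ler_wpM2r ?exprn_ge0 ?(ltW t0)// ler_norm.
by rewrite ler_wpM2l// ler_iXnr// ?(ltW t0)//; exact: t1.
Qed.

Lemma fderiv_bounded (g : C -> C -> C) z w a b : fderiv g z w a b ->
  exists r B : R, 0 < r /\ forall h l, normc h < r -> normc l < r ->
    normc (g (z + h) (w + l)) <= B.
Proof.
move=> /(_ 1 ltr01)[r r0 H].
exists r, (normc (g z w) + (normc a * r + normc b * r) + (r + r)); split=> // h l hr lr.
have := H h l hr lr; rewrite mul1r => {}H.
have -> : g (z + h) (w + l) = g z w + (a * h + b * l) +
   (g (z + h) (w + l) - g z w - (a * h + b * l)) by ring.
apply: le_trans (le_normcD _ _) _; apply: lerD; last first.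
  by apply: le_trans H _; apply: lerD; exact: ltW.
apply: le_trans (le_normcD _ _) _; apply: lerD => //.
apply: le_trans (le_normcD _ _) _; rewrite !normcM.
by apply: lerD; rewrite ler_wpM2l ?normc_ge0// ltW.
Qed.

(** Taylor expansion of a holomorphic function with respect to the weights [a]
   of [z] and [b] of [w], obtained by integrating the expansions of the
   partial derivatives. *)
Lemma weighted_taylor (O : set C2) (a b : nat) : open O -> O 0 ->
  (0 < a)%N -> (0 < b)%N -> forall M (K : C2 -> C), (forall q, O q -> differentiable K q) ->
  exists p, forall A : R, exists c, \forall t \near (0 : R)^'+, forall z w : C,
    normc z <= A * t ^+ a -> normc w <= A * t ^+ b ->
    normc (K (vec2 z w) - peval p z w) <= c * t ^+ M.
Proof.
move=> Oo O0 a0 b0; elim/ltn_ind => -[_|M IH] K Kd.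
  have /differentiable_fderiv/fderiv_bounded[r [B [r0 KB]]] := Kd _ O0.
  exists [::] => A; exists B; near=> t => z w zt wt.
  have t01 : 0 < t <= 1 by near: t; exact: near_unit.
  have Ar : `|A| * t < r by near: t; exact: near_small.
  rewrite expr0 mulr1 /peval big_nil subr0.
  have := KB z w; rewrite !mxE !add0r; apply.
    exact: weight_small zt.
  exact: weight_small wt.
have [p1 P1] := IH (M.+1 - a)%N ltac:(by rewrite ltn_subrL a0) ('D_(vec2 1 0) K)
  (holomorphic_derive (vec2 1 0) Oo Kd).
have [p2 P2] := IH (M.+1 - b)%N ltac:(by rewrite ltn_subrL b0) ('D_(vec2 0 1) K)
  (holomorphic_derive (vec2 0 1) Oo Kd).
have /nbhs_vec2P[r r0 Hr] := open_nbhs_nbhs (conj Oo O0).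
exists ((K 0, (0%N, 0%N)) :: antiz p1 ++ antiw0 p2) => A.
have [c1 H1] := P1 A; have [c2 H2] := P2 A.
exists (`|A| * `|c1| + `|A| * `|c2|).
near=> t => z w zt wt.
have t01 : 0 < t <= 1 by near: t; exact: near_unit.
have Ar : `|A| * t < r by near: t; exact: near_small.
have E1 : forall z w : C, normc z <= A * t ^+ a -> normc w <= A * t ^+ b ->
    normc ('D_(vec2 1 0) K (vec2 z w) - peval p1 z w) <= c1 * t ^+ (M.+1 - a) by near: t.
have E2 : forall z w : C, normc z <= A * t ^+ a -> normc w <= A * t ^+ b ->
    normc ('D_(vec2 0 1) K (vec2 z w) - peval p2 z w) <= c2 * t ^+ (M.+1 - b) by near: t.
have t0' : 0 <= t <= 1 by case/andP: t01 => /ltW -> ->.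
have fd z' w' : normc z' <= A * t ^+ a -> normc w' <= A * t ^+ b ->
   fderiv (fun z w => K (vec2 z w)) z' w' ('D_(vec2 1 0) K (vec2 z' w')) ('D_(vec2 0 1) K (vec2 z' w')).
  move=> zt' wt'; have := @differentiable_fderiv _ K (vec2 z' w').
  rewrite vec2_0 vec2_1; apply; apply: Kd; rewrite -[vec2 _ _]add0r.
  by apply: Hr; [exact: weight_small zt'|exact: weight_small wt'].
have ray (x : C) (s y : R) : 0 <= s <= 1 -> normc x <= y -> normc (s%:C * x) <= y.
  move=> /andP[s0 s1]; rewrite normcM normcR ger0_norm//; apply: le_trans.
  by rewrite ler_piMl ?normc_ge0.
have bound (c x y : R) i : x <= A * t ^+ i -> 0 <= x -> y <= c * t ^+ (M.+1 - i) * x ->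
    y <= `|A| * `|c| * t ^+ M.+1.
  move=> xA x0 /le_trans; apply.
  have [t0 _] := andP t0'.
  apply: (@le_trans _ _ (`|c| * t ^+ (M.+1 - i) * (`|A| * t ^+ i))).
    apply: (@le_trans _ _ (`|c| * t ^+ (M.+1 - i) * x)).
      by rewrite ler_wpM2r// ler_wpM2r ?exprn_ge0// ler_norm.
    rewrite ler_wpM2l ?mulr_ge0 ?exprn_ge0//; apply: le_trans xA _.
    by rewrite ler_wpM2r ?exprn_ge0// ler_norm.
  have -> : `|c| * t ^+ (M.+1 - i) * (`|A| * t ^+ i) = `|A| * `|c| * (t ^+ i * t ^+ (M.+1 - i)) by ring.
  by rewrite ler_wpM2l ?mulr_ge0// exprB_le.
pose Gz z := 1 * K (vec2 z w) + (-1) * peval (antiz p1) z w.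
pose Gw w := 1 * K (vec2 0 w) + (-1) * peval (antiw0 p2) 0 w.
have z0 : normc (0 : C) <= A * t ^+ a by rewrite normc0 (le_trans _ zt) ?normc_ge0.
have hz : normc (Gz z - Gz 0) <= `|A| * `|c1| * t ^+ M.+1.
  apply: (bound _ _ _ _ zt (normc_ge0 _)).
  apply: (@cderiv_mean_value _ Gz (fun x => 1 * 'D_(vec2 1 0) K (vec2 x w) + (-1) * peval p1 x w)) => s s01.
    apply: cderiv_lin; last exact: cderiv_antiz.
    by apply: (fderiv_cderiv (fd _ _ _ _)) => //; exact: ray.
  by rewrite mul1r mulN1r; apply: E1 => //; exact: ray.
have hw : normc (Gw w - Gw 0) <= `|A| * `|c2| * t ^+ M.+1.
  apply: (bound _ _ _ _ wt (normc_ge0 _)).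
  apply: (@cderiv_mean_value _ Gw (fun x => 1 * 'D_(vec2 0 1) K (vec2 0 x) + (-1) * peval p2 0 x)) => s s01.
    apply: cderiv_lin; last exact: cderiv_antiw0.
    have /fderiv_swap/fderiv_cderiv := fd 0 (s%:C * w) z0 (ray _ _ _ s01 wt).
    exact.
  by rewrite mul1r mulN1r; apply: E2 => //; exact: ray.
rewrite mulrDl; apply: le_trans (lerD hz hw); apply: le_trans (le_normcD _ _).
rewrite le_eqVlt; apply/orP; left; apply/eqP; congr normc.
have K00 : vec2 0 0 = 0 :> C2 by apply/rowP => j; rewrite !mxE; case: ifP.
rewrite /Gz /Gw peval_antiz0 peval_antiw00 K00 peval_cons/= (peval_antiw0 _ 0 z).
have -> : peval (antiz p1 ++ antiw0 p2) z w = peval (antiz p1) z w + peval (antiw0 p2) z w.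
  by rewrite /peval big_cat.
by rewrite !expr0; ring.
Unshelve. all: by end_near. Qed.

End WeightedTaylor.

Section WeightedSmooth.
Context {R : realType} {n : nat}.
Implicit Types (G : 'rV[R]_n -> R) (X : 'rV[R]_n).

Lemma nbhs_coordP X (U : set 'rV[R]_n) :
  nbhs X U <-> exists2 r : R, 0 < r & forall Y : 'rV[R]_n, (forall i, `|Y 0 i| < r) -> U (X + Y).
Proof.
rewrite nbhs_ballP; split=> [[r r0 rU]|[r r0 rU]]; exists r => //.
  move=> Y Yr; apply: rU; split=> // i j; rewrite -ball_normE/= !mxE (ord1 i).
  by rewrite opprD addrA subrr add0r normrN.
move=> Y [_ H]; have -> : Y = X + (Y - X) by rewrite addrC subrK.
by apply: rU => i; have := H 0 i; rewrite -ball_normE/= !mxE distrC.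
Qed.

Lemma mxderive_sum G X Y : differentiable G X ->
  'D_Y G X = \sum_i Y 0 i * 'D_'e_i G X.
Proof.
move=> dG; rewrite deriveE// {1}[Y]row_sum_delta linear_sum; apply: eq_bigr => i _.
by rewrite linearZ/= deriveE.
Qed.

Lemma is_derive_line G X (v : 'rV[R]_n) (t : R) : differentiable G (X + t *: v) ->
  is_derive t 1 (fun a : R => G (X + a *: v)) ('D_v G (X + t *: v)).
Proof.
move=> dG.
have E : (fun h : R => h^-1 *: (((fun a : R => G (X + a *: v)) \o shift t) (h *: 1) - G (X + t *: v))) =
   (fun h : R => h^-1 *: ((G \o shift (X + t *: v)) (h *: v) - G (X + t *: v))).
  apply/funext => h /=; have -> : h *: (1 : R) = h := mulr1 h.
  by rewrite scalerDl addrCA.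
have dX : derivable G (X + t *: v) v by exact: diff_derivable.
by apply: DeriveDef; rewrite /derivable /derive E.
Qed.

(** Taylor's formula with weights, by induction on [M] from the mean value
   theorem along rays. The function is the member [g l] of a family in which
   [g (i :: s)] is the derivative of [g s], so that differences of smooth
   functions are covered as well. *)
Lemma weighted_vanishing (wt : 'I_n -> nat) (A : R) (g : seq 'I_n -> 'rV[R]_n -> R) :
  (forall i, 0 < wt i)%N ->
  (\forall X \near (0 : 'rV[R]_n), forall s, differentiable (g s) X /\
     forall i, 'D_'e_i (g s) X = g (i :: s) X) ->
  forall M l, (forall s, (\sum_(i <- s) wt i < M)%N -> g (s ++ l) 0 = 0) ->
  exists c, \forall t \near (0 : R)^'+, forall X,
    (forall i, `|X 0 i| <= A * t ^+ wt i) -> `|g l X| <= c * t ^+ M.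
Proof.
move=> wt0 gs; elim/ltn_ind => -[_|M IH] l g0.
  have [/differentiable_continuous Gc _] := nbhs_singleton gs l.
  have : \forall X \near (0 : 'rV[R]_n), `|g l X| < `|g l 0| + 1.
    by apply: (cvgr_norm_lt (g l 0) Gc); rewrite ltrDl.
  move=> /nbhs_coordP[r r0 Hr]; exists (`|g l 0| + 1); near=> t => X Xt.
  have t01 : 0 < t <= 1 by near: t; exact: near_unit.
  have Ar : `|A| * t < r by near: t; exact: near_small.
  rewrite expr0 mulr1 ltW// -[X]add0r; apply: Hr => i; exact: weight_small (Xt i).
have IHi i : exists c, \forall t \near (0 : R)^'+, forall X,
    (forall i, `|X 0 i| <= A * t ^+ wt i) -> `|g (i :: l) X| <= c * t ^+ (M.+1 - wt i).
  apply: IH; first by rewrite ltn_subrL wt0.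
  move=> s ws; rewrite -cat_rcons; apply: g0.
  by rewrite -cats1 big_cat big_seq1/= addnC -ltn_subRL.
have [c Hc] := choice IHi.
have /nbhs_coordP[r r0 Hr] := gs.
have Hc1 : \forall t \near (0 : R)^'+, forall i X, (forall i, `|X 0 i| <= A * t ^+ wt i) ->
   `|g (i :: l) X| <= c i * t ^+ (M.+1 - wt i) by exact: filter_forall.
exists (\sum_i `|A| * `|c i|); near=> t => X Xt.
have t01 : 0 < t <= 1 by near: t; exact: near_unit.
have Ar : `|A| * t < r by near: t; exact: near_small.
have Hc2 : forall i X, (forall i, `|X 0 i| <= A * t ^+ wt i) ->
   `|g (i :: l) X| <= c i * t ^+ (M.+1 - wt i) by near: t.
have t0' : 0 <= t <= 1 by case/andP: t01 => /ltW -> ->.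
have ray (s : R) i : 0 <= s <= 1 -> `|(s *: X) 0 i| <= A * t ^+ wt i.
  move=> /andP[s0 s1]; rewrite mxE normrM ger0_norm//; apply: le_trans (Xt i).
  by rewrite ler_piMl.
have dg (s : R) : 0 <= s <= 1 -> differentiable (g l) (0 + s *: X) /\
     forall i, 'D_'e_i (g l) (0 + s *: X) = g (i :: l) (0 + s *: X).
  move=> s01; apply: Hr => i; exact: weight_small (ray s i s01).
have [s s01] := mean_value01 (fun s s01 => is_derive_line (dg s s01).1).
have -> : g l (0 + 0 *: X) = 0 by rewrite scale0r addr0; apply: (g0 [::]); rewrite big_nil.
rewrite add0r scale1r subr0 => ->; rewrite mxderive_sum; last exact: (dg s s01).1.
rewrite mulr_suml; apply: le_trans (ler_norm_sum _ _ _) _; apply: ler_sum => i _.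
rewrite normrM (dg s s01).2 add0r.
have [t0 _] := andP t0'.
apply: (@le_trans _ _ ((`|A| * t ^+ wt i) * (`|c i| * t ^+ (M.+1 - wt i)))).
  apply: ler_pM => //.
    by apply: le_trans (Xt i) _; rewrite ler_wpM2r ?exprn_ge0// ler_norm.
  apply: le_trans (Hc2 i _ (fun j => ray s j s01)) _.
  by rewrite ler_wpM2r ?exprn_ge0// ler_norm.
have -> : `|A| * t ^+ wt i * (`|c i| * t ^+ (M.+1 - wt i)) =
   `|A| * `|c i| * (t ^+ wt i * t ^+ (M.+1 - wt i)) by ring.
by rewrite ler_wpM2l ?mulr_ge0// exprB_le.
Unshelve. all: by end_near. Qed.

End WeightedSmooth.

(** * Derivatives along curves and polynomial functions *)

Section Curves.
Context {R : realType} {n : nat}.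
Implicit Types (G : 'rV[R]_n -> R) (X : 'rV[R]_n).

Lemma is_derive_curve G (x : 'I_n -> R -> R) (dx : 'I_n -> R) (t : R) :
  differentiable G (\row_i x i t) -> (forall i, is_derive t 1 (x i) (dx i)) ->
  is_derive t 1 (fun s => G (\row_i x i s))
    (\sum_i dx i * 'D_'e_i G (\row_i x i t)).
Proof.
move=> dG dX.
pose Y s : 'rV[R]_n := \sum_i x i s *: delta_mx 0 i.
have YE s : \row_i x i s = Y s.
  by rewrite [LHS]row_sum_delta; apply: eq_bigr => i _; rewrite mxE.
have dx1 i : differentiable (x i) t by apply/derivable1_diffP; case: (dX i).
have dY : differentiable Y t.
  rewrite (_ : Y = \sum_i (fun s => x i s *: delta_mx 0 i)); last first.
    by apply/funext => s; rewrite fct_sumE.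
  by apply: differentiable_sum => i; exact: differentiableZl.
have D1 : 'd Y t 1 = \row_i dx i.
  rewrite -deriveE// (_ : Y = \sum_i (fun s => x i s *: delta_mx 0 i)); last first.
    by apply/funext => s; rewrite fct_sumE.
  rewrite derive_sum; last first.
    by move=> i; apply/derivable1_diffP; exact: differentiableZl.
  rewrite [RHS]row_sum_delta; apply: eq_bigr => i _; rewrite mxE.
  rewrite deriveE; last exact: differentiableZl.
  by rewrite diffZl//= -deriveE//; have [_ ->] := dX i.
rewrite (_ : (fun s => G (\row_i x i s)) = G \o Y); last by apply/funext => s; rewrite YE.
rewrite YE in dG *.
have dGY : differentiable (G \o Y) t by exact: differentiable_comp.
apply: DeriveDef; first exact/derivable1_diffP.
rewrite deriveE// diff_comp//= D1 -deriveE// mxderive_sum//.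
by apply: eq_bigr => i _; rewrite mxE.
Qed.

(** Polynomials, presented by closure properties: smoothness and stability under
   derivatives follow by induction. *)
Inductive polyfun : ('rV[R]_n -> R) -> Prop :=
| polyfun_cst c : polyfun (fun=> c)
| polyfun_coord i : polyfun (fun X => X 0 i)
| polyfunD f g : polyfun f -> polyfun g -> polyfun (fun X => f X + g X)
| polyfunM f g : polyfun f -> polyfun g -> polyfun (fun X => f X * g X).

Lemma polyfun_differentiable f X : polyfun f -> differentiable f X.
Proof.
elim=> [c|i|{}f g _ fd _ gd|{}f g _ fd _ gd].
- exact: differentiable_cst.
- exact: differentiable_coord.
- exact: differentiableD.
- exact: differentiableM.
Qed.

Lemma is_derive_along (f : 'rV[R]_n -> R) X v d :
  is_derive (0 : R) 1 (fun s : R => f (s *: v + X)) d -> is_derive X v f d.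
Proof.
have E : (fun h : R => h^-1 *: (((fun s : R => f (s *: v + X)) \o shift 0) (h *: 1)
     - f (0 *: v + X))) = (fun h : R => h^-1 *: ((f \o shift X) (h *: v) - f X)).
  apply/funext => h /=; have -> : h *: (1 : R) = h := mulr1 h.
  by rewrite addr0 scale0r add0r.
by move=> -[]; rewrite /derivable /derive E => fX fd; exact: DeriveDef.
Qed.

Lemma derive_val_coord (i : 'I_n) v X : 'D_v (fun Y : 'rV[R]_n => Y 0 i) X = v 0 i.
Proof.
have H : is_derive (0 : R) 1 (fun s : R => (s *: v + X) 0 i) (v 0 i).
  apply: is_derive_eps => e e0; exists 1 => // h _.
  rewrite !mxE add0r mul0r add0r addrK mulrC subrr normr0 mulr_ge0// ltW//.
by have [_ ->] := @is_derive_along (fun Y => Y 0 i) X v _ H.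
Qed.

Lemma polyfun_derive f v : polyfun f -> polyfun ('D_v f).
Proof.
elim=> [c|i|{}f g pf IHf pg IHg|{}f g pf IHf pg IHg].
- rewrite (_ : 'D_v _ = fun=> 0); first exact: polyfun_cst.
  by apply/funext => X; rewrite derive_cst.
- rewrite (_ : 'D_v _ = fun=> v 0 i); first exact: polyfun_cst.
  by apply/funext => X; rewrite derive_val_coord.
- rewrite (_ : 'D_v _ = fun X => 'D_v f X + 'D_v g X); first exact: polyfunD.
  by apply/funext => X; rewrite -deriveD//; apply: diff_derivable; exact: polyfun_differentiable.
- rewrite (_ : 'D_v _ = fun X => f X * 'D_v g X + g X * 'D_v f X).
    by apply: polyfunD; exact: polyfunM.
  by apply/funext => X; rewrite -deriveM//; apply: diff_derivable; exact: polyfun_differentiable.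
Qed.

Lemma polyfun_partials s f : polyfun f -> polyfun (partials s f).
Proof. by move=> pf; elim: s => // i s IH; exact: polyfun_derive. Qed.

Lemma partialsD f g s : polyfun f -> polyfun g ->
  partials s (fun X => f X + g X) = fun X => partials s f X + partials s g X.
Proof.
move=> pf pg; elim: s => //= i s ->; apply/funext => X.
by rewrite -deriveD//; apply: diff_derivable; apply: polyfun_differentiable; exact: polyfun_partials.
Qed.

End Curves.

(** * Weighted homogeneous polynomials *)

Section Homogeneous.
Context {R : realType}.
Local Notation C := R[i].
Local Notation R3 := 'rV[R]_3.
Implicit Types (P h : C -> R -> R) (z : C) (u t : R) (X : R3).

Lemma pt3_x z u : pt3 z u 0 ix = Re z. Proof. by rewrite mxE. Qed.
Lemma pt3_y z u : pt3 z u 0 iy = Im z. Proof. by rewrite mxE. Qed.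
Lemma pt3_u z u : pt3 z u 0 iu = u. Proof. by rewrite mxE. Qed.

Lemma sum3 (F : 'I_3 -> R) : \sum_i F i = F ix + F iy + F iu.
Proof.
rewrite !big_ord_recl big_ord0 addr0 addrA.
by do !congr (_ + _); congr F; apply: val_inj.
Qed.

Lemma ord3 (Q : 'I_3 -> Prop) : Q ix -> Q iy -> Q iu -> forall i, Q i.
Proof.
move=> h1 h2 h3 [[|[|[|//]]] hi].
- by have -> : Ordinal hi = ix by apply: val_inj.
- by have -> : Ordinal hi = iy by apply: val_inj.
- by have -> : Ordinal hi = iu by apply: val_inj.
Qed.

Lemma pt3_eta X : pt3 (X 0 ix +i* X 0 iy) (X 0 iu) = X.
Proof. by apply/rowP; apply: ord3; rewrite ?pt3_x ?pt3_y ?pt3_u. Qed.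

Lemma real3_pt3 P z u : real3 P (pt3 z u) = P z u.
Proof. by rewrite /real3 pt3_x pt3_y pt3_u; case: z. Qed.

Definition cpolyfun (g : R3 -> C) :=
  polyfun (fun X => Re (g X)) /\ polyfun (fun X => Im (g X)).

Lemma cpolyfunM g g' : cpolyfun g -> cpolyfun g' -> cpolyfun (fun X => g X * g' X).
Proof.
have pN f : polyfun f -> polyfun (fun X : R3 => - f X).
  move=> pf; rewrite (_ : (fun X => _) = (fun X => (fun=> -1) X * f X)).
    by apply: polyfunM => //; exact: polyfun_cst.
  by apply/funext => X /=; rewrite mulN1r.
move=> [g1 g2] [g'1 g'2]; split.
  rewrite (_ : (fun X => _) = fun X => Re (g X) * Re (g' X) +
     - (Im (g X) * Im (g' X))); last by apply/funext => X; rewrite cReM.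
  by apply: polyfunD; [exact: polyfunM | apply: pN; exact: polyfunM].
rewrite (_ : (fun X => _) = fun X => Re (g X) * Im (g' X) +
     Im (g X) * Re (g' X)); last by apply/funext => X; rewrite cImM.
by apply: polyfunD; exact: polyfunM.
Qed.

Lemma cpolyfun_cst (c : C) : cpolyfun (fun=> c).
Proof. by split; exact: polyfun_cst. Qed.

Lemma cpolyfunX g n : cpolyfun g -> cpolyfun (fun X => g X ^+ n).
Proof.
move=> pg; elim: n => [|n IH].
  by rewrite (_ : (fun X => _) = fun=> 1); [exact: cpolyfun_cst | apply/funext => X; rewrite expr0].
rewrite (_ : (fun X => _) = fun X => g X * g X ^+ n); first exact: cpolyfunM.
by apply/funext => X; rewrite exprS.
Qed.

Lemma cpolyfun_z : cpolyfun (fun X => X 0 ix +i* X 0 iy).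
Proof. by split; exact: polyfun_coord. Qed.

Lemma cpolyfun_zbar : cpolyfun (fun X => (X 0 ix +i* X 0 iy)^*).
Proof.
split=> /=; first exact: polyfun_coord.
rewrite (_ : (fun X => _) = (fun X => (fun=> -1) X * X 0 iy)).
  by apply: polyfunM; [exact: polyfun_cst | exact: polyfun_coord].
by apply/funext => X /=; rewrite mulN1r.
Qed.

Lemma cpolyfun_u : cpolyfun (fun X => (X 0 iu)%:C).
Proof. by split=> /=; [exact: polyfun_coord | exact: polyfun_cst]. Qed.

Lemma cpolyfun_sum (T : Type) (s : seq T) (F : T -> R3 -> C) :
  (forall e, cpolyfun (F e)) -> cpolyfun (fun X => \sum_(e <- s) F e X).
Proof.
move=> pF; elim: s => [|e s [IH1 IH2]].
  rewrite (_ : (fun X => _) = fun=> 0); first exact: cpolyfun_cst.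
  by apply/funext => X; rewrite big_nil.
have [F1 F2] := pF e; split.
  rewrite (_ : (fun X => _) = fun X => Re (F e X) +
     Re (\sum_(e <- s) F e X)); first exact: polyfunD.
  by apply/funext => X; rewrite big_cons cReD.
rewrite (_ : (fun X => _) = fun X => Im (F e X) +
     Im (\sum_(e <- s) F e X)); first exact: polyfunD.
by apply/funext => X; rewrite big_cons cImD.
Qed.

Lemma weight_homogeneous_polyfun k lam gam P :
  weight_homogeneous k lam gam P -> polyfun (real3 P).
Proof.
move=> [s [_ PE]].
have [ps _] : cpolyfun (fun X => \sum_(e <- s) monomial e (X 0 ix +i* X 0 iy) (X 0 iu)).
  apply: cpolyfun_sum => -[c [[i j] l]]; rewrite /monomial.
  apply: cpolyfunM; last by apply: cpolyfunX; exact: cpolyfun_u.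
  apply: cpolyfunM; last by apply: cpolyfunX; exact: cpolyfun_zbar.
  apply: cpolyfunM; last by apply: cpolyfunX; exact: cpolyfun_z.
  exact: cpolyfun_cst.
rewrite (_ : real3 P = fun X => Re (\sum_(e <- s) monomial e (X 0 ix +i* X 0 iy) (X 0 iu)))//.
by apply/funext => X; rewrite -PE.
Qed.

Lemma weight_homogeneous_scale k lam P (a b N : nat) :
  (forall m l, weight k lam m l = 1 -> (a * m + b * l = N)%N) ->
  weight_homogeneous k lam 1 P ->
  forall t z u, P ((t ^+ a)%:C * z) (t ^+ b * u) = t ^+ N * P z u.
Proof.
move=> wN [s [sw PE]] t z u; apply: (@complexI R); rewrite [RHS]rmorphM/= !PE mulr_sumr.
rewrite !big_seq; apply: eq_bigr => -[c [[i j] l]] /sw/wN H.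
rewrite /monomial -H.
have -> : Num.conj ((t ^+ a)%:C * z) = (t ^+ a)%:C * Num.conj z :> C.
  by rewrite rmorphM; congr (_ * _); exact: conjc_real.
rewrite rmorphM/= !exprMn -!rmorphXn/= -!exprM exprD mulnDr exprD !rmorphM/=; ring.
Qed.

Definition wt3 (a b : nat) (i : 'I_3) : nat := if i == iu then b else a.

Definition dil (w : 'I_3 -> nat) t X : R3 := \row_i (t ^+ w i * X 0 i).

Lemma dil_pt3 a b t z u : dil (wt3 a b) t (pt3 z u) = pt3 ((t ^+ a)%:C * z) (t ^+ b * u).
Proof.
apply/rowP; apply: ord3; rewrite mxE ?pt3_x ?pt3_y ?pt3_u ?cReM ?cImM//=.
  by rewrite mul0r subr0.
by rewrite mul0r addr0.
Qed.

(** The homogeneity relation is differentiated by the chain rule. *)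
Lemma homogeneous_derive (w : 'I_3 -> nat) (N : nat) t (G : R3 -> R) i : polyfun G ->
  (forall X, G (dil w t X) = t ^+ N * G X) -> forall X,
  t ^+ w i * 'D_'e_i G (dil w t X) = t ^+ N * 'D_'e_i G X.
Proof.
move=> pG GN X.
have dG Y : differentiable G Y := polyfun_differentiable Y pG.
transitivity ('D_'e_i (fun Y => G (dil w t Y)) X).
  have -> : 'D_'e_i (fun Y => G (dil w t Y)) X =
      'D_(t ^+ w i *: delta_mx 0 i) G (dil w t X).
    have E : (fun h : R => h^-1 *: (((fun Y => G (dil w t Y)) \o shift X) (h *: delta_mx 0 i) - G (dil w t X)))
      = (fun h : R => h^-1 *: ((G \o shift (dil w t X)) (h *: (t ^+ w i *: delta_mx 0 i)) - G (dil w t X))).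
      apply/funext => h /=; congr (_ *: (G _ - _)); apply/rowP => j; rewrite !mxE mulrDr; congr (_ + _).
      rewrite eqxx/=; case: eqP => [->|_]; last by rewrite !mulr0.
      by rewrite !mulr1 mulrC.
    by rewrite /derive E.
  by rewrite !deriveE// linearZ.
rewrite (_ : (fun Y => G (dil w t Y)) = t ^+ N \*: G); last by apply/funext => Y; exact: GN.
rewrite deriveZ//; apply: diff_derivable; exact: dG.
Qed.

End Homogeneous.

Section HarmonicPart.
Context {R : realType}.
Local Notation C := R[i].
Implicit Types (p q : seq (C * (nat * nat))) (z c : C) (u : R).

Definition repart c q (z : C) (u : R) : R := Re (c * peval q z u%:C).

Lemma derive_repart (d : C) (i : 'I_3) c q : 
  (forall (s : R) (X : 'rV[R]_3), (s *: delta_mx 0 i + X) 0 ix +i* (s *: delta_mx 0 i + X) 0 iy =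
     (X 0 ix +i* X 0 iy) + s%:C * d) ->
  (forall (s : R) (X : 'rV[R]_3), (s *: delta_mx 0 i + X) 0 iu = X 0 iu) ->
  'D_'e_i (real3 (repart c (antiz q))) = real3 (repart (c * d) q).
Proof.
move=> dz du; apply/funext => X.
set z := X 0 ix +i* X 0 iy.
pose G x := peval (antiz q) (z + x) (X 0 iu)%:C.
have : is_derive (0 : R) 1 (fun s : R => Re (c * G (s%:C * d)))
   (Re (c * (peval q z (X 0 iu)%:C * d))).
  apply: cderiv_ray.
  apply/(@cderiv_shift _ ((peval (antiz q))^~ (X 0 iu)%:C) z); rewrite rmorph0 mul0r addr0.
  exact: cderiv_antiz.
rewrite (_ : (fun s : R => Re (c * G (s%:C * d))) =
  (fun s => real3 (repart c (antiz q)) (s *: delta_mx 0 i + X))); last first.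
  by apply/funext => s; rewrite /real3 dz du.
move/is_derive_along => [_ ->]; rewrite /real3 /repart -/z.
by congr Re; ring.
Qed.

Lemma derive_repart_x c q :
  'D_'e_ix (real3 (repart c (antiz q))) = real3 (repart c q).
Proof.
rewrite (@derive_repart 1) ?mulr1// => s X; rewrite !mxE/= ?mulr1 ?mulr0 ?add0r//.
by apply/eqP; rewrite eq_complex/= !(mulr0, mulr1, subr0, addr0) [s + _]addrC !eqxx.
Qed.

Lemma derive_repart_y c q :
  'D_'e_iy (real3 (repart c (antiz q))) = real3 (repart (c * 'i) q).
Proof.
rewrite (@derive_repart 'i)// => s X; rewrite !mxE/= ?mulr1 ?mulr0 ?add0r//.
by apply/eqP; rewrite eq_complex/= !(mulr0, mulr1, mul0r, subr0, addr0, add0r) [s + _]addrC !eqxx.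
Qed.

(** The second primitive in [z] turns [p] into a harmonic function with Hessian
   [- Im (p zeta ^ 2)]; the factor [i] makes it an imaginary part up to sign. *)
Definition harmonic_primitive p : C -> R -> R := repart 'i (antiz (antiz p)).

Lemma harmonic_primitive_partials p :
  [/\ partials [:: ix; ix] (real3 (harmonic_primitive p)) = real3 (repart 'i p),
      partials [:: ix; iy] (real3 (harmonic_primitive p)) = real3 (repart ('i * 'i) p),
      partials [:: iy; ix] (real3 (harmonic_primitive p)) = real3 (repart ('i * 'i) p) &
      partials [:: iy; iy] (real3 (harmonic_primitive p)) = real3 (repart ('i * 'i * 'i) p)].
Proof.
split.
- exact: (etrans (congr1 (fun f => 'D_'e_ix f) (derive_repart_x 'i (antiz p))) (derive_repart_x 'i p)).
- exact: (etrans (congr1 (fun f => 'D_'e_ix f) (derive_repart_y 'i (antiz p))) (derive_repart_x ('i * 'i) p)).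
- exact: (etrans (congr1 (fun f => 'D_'e_iy f) (derive_repart_x 'i (antiz p))) (derive_repart_y 'i p)).
- exact: (etrans (congr1 (fun f => 'D_'e_iy f) (derive_repart_y 'i (antiz p))) (derive_repart_y ('i * 'i) p)).
Qed.

Lemma harmonic_primitive_laplace p z u :
  partials [:: ix; ix] (real3 (harmonic_primitive p)) (pt3 z u)
    + partials [:: iy; iy] (real3 (harmonic_primitive p)) (pt3 z u) = 0.
Proof.
have [-> _ _ ->] := harmonic_primitive_partials p; rewrite !real3_pt3 /repart.
rewrite -cReD -mulrDl -{1}['i]mulr1 -mulrA -mulrDr -expr2 sqr_i subrr mulr0 mul0r//.
Qed.

Lemma Dz2_harmonic_primitive p z u zeta :
  Dz2 (harmonic_primitive p) z u zeta = - Im (peval p z u%:C * zeta ^+ 2).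
Proof.
rewrite /Dz2 !big_cons !big_nil !addr0.
rewrite -[(ix, _).1]/ix -[(iy, _).1]/iy -[(ix, _).2]/(Re zeta) -[(iy, _).2]/(Im zeta).
have [-> -> -> ->] := harmonic_primitive_partials p; rewrite !real3_pt3 /repart.
rewrite expr2; case: zeta => x y; case: (peval p z u%:C) => a b /=.
ring.
Qed.

Lemma weight_homogeneous_repart k lam c q :
  (forall e, e \in q -> weight k lam e.2.1 e.2.2 = 1) ->
  weight_homogeneous k lam 1 (repart c q).
Proof.
move=> qw.
exists ([seq (c * e.1 / 2, (e.2.1, 0%N, e.2.2)) | e <- q] ++
        [seq (Num.conj (c * e.1) / 2, (0%N, e.2.1, e.2.2)) | e <- q]); split.
  move=> c' i j l; rewrite mem_cat => /orP[] /mapP[e /qw we [_ -> -> ->]].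
    by rewrite addn0.
  by rewrite add0n.
move=> z u; rewrite big_cat !big_map/= /repart.
have -> : (Re (c * peval q z u%:C))%:C =
   (c * peval q z u%:C + Num.conj (c * peval q z u%:C)) / 2 by exact: ReJ_add.
rewrite mulrDl rmorphM/= {2}/peval rmorph_sum/= /peval !mulr_sumr !mulr_suml; congr (_ + _).
  by apply: eq_bigr => e _; rewrite expr0 mulr1; ring.
apply: eq_bigr => e _; rewrite !rmorphM !rmorphXn/= expr0 mulr1.
have -> : Num.conj (u%:C : C) = u%:C by exact: conjc_real.
ring.
Qed.

Lemma harmonic_primitive_Hspace k lam p :
  (forall e, e \in p -> weight k lam e.2.1.+2 e.2.2 = 1) ->
  Hspace k lam (harmonic_primitive p).
Proof.
move=> pw; split; last exact: harmonic_primitive_laplace.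
apply: weight_homogeneous_repart => e; rewrite /antiz -map_comp => /mapP[e' /pw we' ->].
exact: we'.
Qed.

Lemma Dz2D (P h : C -> R -> R) z u zeta : polyfun (real3 P) -> polyfun (real3 h) ->
  Dz2 (fun z' u' => P z' u' + h z' u') z u zeta = Dz2 P z u zeta + Dz2 h z u zeta.
Proof.
move=> pP ph; rewrite /Dz2 -big_split/=; apply: eq_bigr => a _.
rewrite -big_split/=; apply: eq_bigr => b _; rewrite -!mulrDl; congr (_ * _ * _).
exact: (congr1 (fun f => f (pt3 z u)) (partialsD [:: a.1; b.1] pP ph)).
Qed.

End HarmonicPart.

(** * Complex lines in holomorphic coordinates *)

Section Lines.
Context {R : realType}.
Local Notation C := R[i].
Local Notation C2 := 'rV[C]_2.
Implicit Types (G : C2 -> C) (q Q T v : C2).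

Lemma fderiv_line (F : C -> C -> C) z w a b (s t : C) : fderiv F z w a b ->
  cderiv (fun x => F (z + x * s) (w + x * t)) 0 (a * s + b * t).
Proof.
move=> Fd e e0.
pose A := normc s + normc t + 1.
have A0 : 0 < A by rewrite ltr_wpDl// addr_ge0 ?normc_ge0.
have eA : 0 < e / A by rewrite divr_gt0.
have [r r0 Hr] := Fd _ eA.
exists (r / A) => [|h]; first by rewrite divr_gt0.
rewrite ltr_pdivlMr// => hA.
have hs : normc (h * s) <= normc h * normc s by rewrite normcM.
have ht : normc (h * t) <= normc h * normc t by rewrite normcM.
have s0 := normc_ge0 s; have t0 := normc_ge0 t; have h0 := normc_ge0 h.
have hs0 := mulr_ge0 h0 s0; have ht0 := mulr_ge0 h0 t0.
have hAE : normc h * A = normc h * normc s + normc h * normc t + normc h.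
  by rewrite /A !mulrDr mulr1.
rewrite add0r !mul0r !addr0.
have -> : (a * s + b * t) * h = a * (h * s) + b * (h * t) by ring.
apply: le_trans (Hr _ _ _ _) _; [lra|lra|].
have -> : e * normc h = e / A * (normc h * A) by field; rewrite gt_eqF.
by rewrite ler_wpM2l ?(ltW eA)//; lra.
Qed.

Lemma cderiv_line G Q T (x : C) : differentiable G (Q + x *: T) ->
  cderiv (fun x => G (Q + x *: T)) x ('D_T G (Q + x *: T)).
Proof.
move=> dG; rewrite -[x in cderiv _ x]addr0; apply/cderiv_shift.
rewrite derive_vec2//.
have := fderiv_line (T 0 0) (T 0 1) (differentiable_fderiv dG).
congr (cderiv _ 0 _); apply/funext => y; congr G.
rewrite scalerDl addrA -[in RHS](vec2_eta (Q + x *: T)) -[in RHS](vec2_eta (y *: T)) vec2D.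
by congr (vec2 (_ + _) (_ + _)); rewrite mxE.
Qed.

Lemma is_derive_Re_line G Q T (s : R) : differentiable G (Q + s%:C *: T) ->
  is_derive s 1 (fun s : R => Re (G (Q + s%:C *: T)))
    (Re ('D_T G (Q + s%:C *: T))).
Proof.
move=> dG.
have := @cderiv_ray R (fun x => G (Q + x *: T)) 1 1 ('D_T G (Q + s%:C *: T)) s.
rewrite !mulr1 mul1r => /(_ (cderiv_line dG)).
by congr (is_derive s 1 _ _); apply/funext => t; rewrite mulr1 mul1r.
Qed.

Lemma is_derive_Im_line G Q T (s : R) : differentiable G (Q + s%:C *: T) ->
  is_derive s 1 (fun s : R => Im (G (Q + s%:C *: T)))
    (Im ('D_T G (Q + s%:C *: T))).
Proof.
move=> dG.
have ImE (w : C) : Im w = Re (- 'i * w).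
  by case: w => a b /=; rewrite oppr0 mul0r sub0r mulN1r opprK.
have := @cderiv_ray R (fun x => G (Q + x *: T)) (- 'i) 1 ('D_T G (Q + s%:C *: T)) s.
rewrite !mulr1 -ImE => /(_ (cderiv_line dG)).
by congr (is_derive s 1 _ _); apply/funext => t; rewrite mulr1 ImE.
Qed.

Lemma coord_differentiable j Q : differentiable (fun v : C2 => v 0 j) Q.
Proof. exact: (@differentiable_coord C 1 2 Q 0 j). Qed.

Lemma derive_coord j Q w : 'D_w (fun v : C2 => v 0 j) Q = w 0 j.
Proof.
have := @cderiv_line (fun v => v 0 j) Q w 0 (coord_differentiable j _).
rewrite scale0r addr0 => H; apply: cderiv_unique H _.
apply: (@quadratic_cderiv _ _ _ _ 1 0) => // h _.
rewrite !mxE.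
have -> : Q 0 j + (0 + h) * w 0 j - (Q 0 j + 0 * w 0 j) - h * w 0 j = 0 by ring.
by rewrite normc0 mul0r.
Qed.

Lemma differentiable_comp_coord (phi : C2 -> C2) q j : differentiable phi q ->
  differentiable (fun q => phi q 0 j) q.
Proof.
by move=> dphi; exact: (differentiable_comp dphi (coord_differentiable j (phi q))).
Qed.

Lemma diff_comp_coord (phi : C2 -> C2) q v j : differentiable phi q ->
  'd phi q v 0 j = 'D_v (fun q => phi q 0 j) q.
Proof.
move=> dphi; rewrite (deriveE _ (differentiable_comp_coord j dphi)).
rewrite (diff_comp dphi (coord_differentiable j (phi q))).
by rewrite -[RHS](deriveE _ (coord_differentiable j (phi q))) derive_coord.
Qed.

End Lines.

(** In coordinates [phi] with inverse [psi], the real lines of the target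
   are curves [s |-> psi (phi q + s T)] whose second derivative is a quadratic
   form in the initial velocity with holomorphic coefficients. *)
Section Straightening.
Context {R : realType}.
Local Notation C := R[i].
Local Notation C2 := 'rV[C]_2.
Variables (phi psi : C2 -> C2) (O O' : set C2).
Hypothesis Oo : open O.
Hypothesis Oo' : open O'.
Hypothesis phid : forall q, O q -> differentiable phi q.
Hypothesis psid : forall q, O' q -> differentiable psi q.
Hypothesis phiO : forall q, O q -> O' (phi q).
Hypothesis phiK : forall q, O q -> psi (phi q) = q.

Definition velocity (v q : C2) : C2 := 'd phi q v.

Let dphi (v : C2) (j : 'I_2) (q : C2) : C := 'D_v (fun q => phi q 0 j) q.
Let dpsi (v : C2) (i : 'I_2) (Q : C2) : C := 'D_v (fun Q => psi Q 0 i) Q.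

Lemma velocityE v q j : O q -> velocity v q 0 j = dphi v j q.
Proof. by move=> Oq; rewrite /velocity diff_comp_coord//; exact: phid. Qed.

Lemma dpsi_velocity v q i : O q -> dpsi (velocity v q) i (phi q) = v 0 i.
Proof.
move=> Oq; have dp := phid Oq; have ds := psid (phiO Oq).
rewrite /dpsi -diff_comp_coord// /velocity.
have E : 'd (psi \o phi) q v = 'd psi (phi q) ('d phi q v).
  have F := diff_comp dp ds.
  exact: (congr1 (fun h : C2 -> C2 => h v) F).
rewrite -E (diff_comp_coord v i (differentiable_comp dp ds)).
have N : \forall q' \near q, (psi \o phi) q' 0 i = q' 0 i.
  have : \forall q' \near q, O q' by exact: open_nbhs_nbhs.
  by apply: filterS => q' Oq' /=; rewrite phiK.
by rewrite (near_eq_derive v N) derive_coord.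
Qed.

Let e0 : C2 := vec2 1 0.
Let e1 : C2 := vec2 0 1.
Let ddpsi (v w : C2) (i : 'I_2) (Q : C2) : C := 'D_w (dpsi v i) Q.

Let dpsi_differentiable v i Q : O' Q -> differentiable (dpsi v i) Q.
Proof.
apply: holomorphic_derive => // Q' OQ'; apply: differentiable_comp_coord; exact: psid.
Qed.

Let ddpsi_differentiable v w i Q : O' Q -> differentiable (ddpsi v w i) Q.
Proof. by apply: holomorphic_derive => // Q' OQ'; exact: dpsi_differentiable. Qed.

Definition second_form (i : 'I_2) (a b : 'I_2 -> C) (q : C2) : C :=
  a 0 * b 0 * ddpsi e0 e0 i (phi q) + a 0 * b 1 * ddpsi e0 e1 i (phi q)
  + a 1 * b 0 * ddpsi e1 e0 i (phi q) + a 1 * b 1 * ddpsi e1 e1 i (phi q).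

Lemma second_derivative T i Q : O' Q ->
  'D_T (dpsi T i) Q =
  T 0 0 * T 0 0 * ddpsi e0 e0 i Q + T 0 0 * T 0 1 * ddpsi e0 e1 i Q
  + T 0 1 * T 0 0 * ddpsi e1 e0 i Q + T 0 1 * T 0 1 * ddpsi e1 e1 i Q.
Proof.
move=> OQ.
have E w : 'D_w (dpsi T i) Q = T 0 0 * ddpsi e0 w i Q + T 0 1 * ddpsi e1 w i Q.
  have N : \forall Q' \near Q, dpsi T i Q' = ((T 0 0 \*: dpsi e0 i) + (T 0 1 \*: dpsi e1 i)) Q'.
    have : \forall q' \near Q, O' q' by exact: open_nbhs_nbhs.
    apply: filterS => Q' OQ'.
    rewrite /dpsi (derive_vec2 T (differentiable_comp_coord i (psid OQ'))).
    transitivity (T 0 0 * dpsi e0 i Q' + T 0 1 * dpsi e1 i Q'); last by [].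
    by congr (_ + _); exact: mulrC.
  have d0 v : derivable (dpsi v i) Q w := diff_derivable (dpsi_differentiable v i OQ).
  rewrite (near_eq_derive w N) (deriveD (derivableZ (d0 e0)) (derivableZ (d0 e1))).
  by congr (_ + _); [exact: (deriveZ _ (d0 e0)) | exact: (deriveZ _ (d0 e1))].
rewrite derive_vec2; last exact: dpsi_differentiable.
have alg (x y a b c d : C) : (x * a + y * c) * x + (x * b + y * d) * y =
  x * x * a + x * y * b + y * x * c + y * y * d by ring.
by rewrite (E e0) (E e1); exact: alg.
Qed.

Definition Kform i (q : C2) := second_form i (fun j => dphi e0 j q) (fun j => dphi e0 j q) q.
Definition Lform i (q : C2) := second_form i (fun j => dphi e0 j q) (fun j => dphi e1 j q) q
  + second_form i (fun j => dphi e1 j q) (fun j => dphi e0 j q) q.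
Definition Nform i (q : C2) := second_form i (fun j => dphi e1 j q) (fun j => dphi e1 j q) q.

Lemma acceleration i q (z w : C) : O q ->
  let T := velocity (vec2 z w) q in
  'D_T ('D_T (fun Q => psi Q 0 i)) (phi q) =
    z ^+ 2 * Kform i q + z * w * Lform i q + w ^+ 2 * Nform i q.
Proof.
move=> Oq T; rewrite -/(dpsi T i) second_derivative; last exact: phiO.
have TE j : T 0 j = z * dphi e0 j q + w * dphi e1 j q.
  rewrite velocityE// /dphi derive_vec2; last by apply: differentiable_comp_coord; exact: phid.
  by rewrite vec2_0 vec2_1 [z * _]mulrC [w * _]mulrC.
rewrite !TE /Kform /Lform /Nform /second_form.
have alg (a0 a1 b0 b1 c00 c01 c10 c11 : C) :
  (z * a0 + w * b0) * (z * a0 + w * b0) * c00 + (z * a0 + w * b0) * (z * a1 + w * b1) * c01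
  + (z * a1 + w * b1) * (z * a0 + w * b0) * c10 + (z * a1 + w * b1) * (z * a1 + w * b1) * c11 =
  z ^+ 2 * (a0 * a0 * c00 + a0 * a1 * c01 + a1 * a0 * c10 + a1 * a1 * c11)
  + z * w * (a0 * b0 * c00 + a0 * b1 * c01 + a1 * b0 * c10 + a1 * b1 * c11
             + (b0 * a0 * c00 + b0 * a1 * c01 + b1 * a0 * c10 + b1 * a1 * c11))
  + w ^+ 2 * (b0 * b0 * c00 + b0 * b1 * c01 + b1 * b0 * c10 + b1 * b1 * c11) by ring.
exact: alg.
Qed.

Lemma second_form_differentiable i v w q : O q ->
  differentiable (fun q => second_form i (fun j => dphi v j q) (fun j => dphi w j q) q) q.
Proof.
move=> Oq.
have d1 u j : differentiable (dphi u j) q.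
  apply: (@holomorphic_derive _ _ O) => // q' Oq'; apply: differentiable_comp_coord; exact: phid.
have d2 u u' : differentiable (fun q => ddpsi u u' i (phi q)) q.
  apply: (@differentiable_comp _ _ _ _ phi (ddpsi u u' i)); first exact: phid.
  by apply: ddpsi_differentiable; exact: phiO.
have d3 u u' j k : differentiable (fun q => dphi v j q * dphi w k q * ddpsi u u' i (phi q)) q.
  apply: differentiableM; last exact: d2.
  by apply: differentiableM; exact: d1.
apply: differentiableD; last exact: d3.
apply: differentiableD; last exact: d3.
apply: differentiableD; exact: d3.
Qed.

Lemma Kform_differentiable i q : O q -> differentiable (Kform i) q.
Proof. exact: second_form_differentiable. Qed.

Lemma Lform_differentiable i q : O q -> differentiable (Lform i) q.
Proof. by move=> Oq; apply: differentiableD; exact: second_form_differentiable. Qed.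

Lemma Nform_differentiable i q : O q -> differentiable (Nform i) q.
Proof. exact: second_form_differentiable. Qed.

End Straightening.

(** * The second order condition for convexity *)

Section SecondOrder.
Context {R : realType}.
Local Notation C := R[i].
Local Notation C2 := 'rV[C]_2.

Lemma is_derive0_eps (f : R -> R) (d : R) : is_derive (0 : R) 1 f d ->
  forall e : R, 0 < e -> exists2 r : R, 0 < r & forall h, `|h| < r ->
     `|f h - f 0 - d * h| <= e * `|h|.
Proof.
move=> [/cvg_ex[l fl] fd] e e0.
have ld : l = d by rewrite -fd /derive; apply/esym/cvg_lim.
move: fl => /cvgrPdist_le/(_ e e0)[r r0 Hr]; exists r => // h hr.
have [->|h0] := eqVneq h 0; first by rewrite subrr mulr0 subr0 normr0 mulr0.
have := Hr h; rewrite /ball_/= sub0r normrN => /(_ hr h0).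
have -> : h *: (1 : R) = h := mulr1 h.
rewrite addr0 ld -(ler_pM2r (x := `|h|)) ?normr_gt0// -normrM.
have -> : (d - h^-1 *: (f h - f 0)) * h = - (f h - f 0 - d * h).
  by rewrite /GRing.scale/=; field.
by rewrite normrN.
Qed.

(** By the mean value theorem [rho s] is [s * drho x] for some [x] between 0 and
   [s], and [drho] has the sign opposite to that of its argument. *)
Lemma no_descent (rho drho : R -> R) (E : R) : rho 0 = 0 -> drho 0 = 0 ->
  (\forall s \near (0 : R), is_derive (s : R) 1 rho (drho s)) ->
  is_derive (0 : R) 1 drho E -> E < 0 ->
  exists2 r : R, 0 < r & forall s, s != 0 -> `|s| < r -> rho s < 0.
Proof.
move=> r0 d0 [r1 r10 H1] /is_derive0_eps dE E0.
have [r2 r20 H2] := dE (- E / 2) ltac:(lra).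
exists (Num.min r1 r2) => [|s s0]; first by rewrite lt_min r10.
rewrite lt_min => /andP[s1 s2].
have ray (t : R) : 0 <= t <= 1 -> `|t * s| <= `|s|.
  by move=> /andP[t0 t1]; rewrite normrM ger0_norm// ler_piMl.
have D (t : R) : 0 <= t <= 1 -> is_derive t 1 (fun t => rho (t * s)) (drho (t * s) * s).
  move=> t01; have ts : `|t * s| < r1 := le_lt_trans (ray t t01) s1.
  have Hts : is_derive (t * s) 1 rho (drho (t * s)).
    by apply: H1; rewrite /ball_/= sub0r normrN.
  have dl : is_derive t 1 (fun t : R => t * s) s.
    apply: is_derive_eps => e e0; exists 1 => // h _.
    have -> : (t + h) * s - t * s - s * h = 0 by ring.
    by rewrite normr0 mulr_ge0// ltW.
  exact: (@is_derive1_comp R rho (fun t => t * s) t _ _ Hts dl).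
have [x x01|x|c c01] := @MVT R (fun t => rho (t * s)) (fun t => drho (t * s) * s) 0 1 ltr01.
- by apply: D; move: x01; rewrite in_itv/= => /andP[? ?]; rewrite !ltW.
- apply: derivable_within_continuous => t; rewrite in_itv/= => t01.
  by have [] := D t t01.
rewrite mul1r mul0r r0 !subr0 mulr1 => ->.
move: c01; rewrite in_itv/= => /andP[c0 c1].
have := H2 (c * s) (le_lt_trans (ray c ltac:(by rewrite !ltW)) s2).
rewrite d0 subr0 ler_norml => /andP[h1 h2].
have [sp|sn] := ltP 0 s.
  rewrite pmulr_llt0//; apply: le_lt_trans (_ : E * (c * s) + - E / 2 * `|c * s| < 0).
    by rewrite -lerBlDl.
  rewrite gtr0_norm ?mulr_gt0//.
  have -> : E * (c * s) + - E / 2 * (c * s) = E / 2 * (c * s) by field.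
  have E2 : E / 2 < 0 by lra.
  by rewrite (nmulr_rlt0 _ E2) mulr_gt0.
have {}sn : s < 0 by rewrite lt_neqAle s0.
rewrite nmulr_llt0//; apply: lt_le_trans (_ : 0 < E * (c * s) - - E / 2 * `|c * s|) _.
  rewrite ltr0_norm ?pmulr_rlt0//.
  have -> : E * (c * s) - - E / 2 * - (c * s) = E / 2 * (c * s) by field.
  have E2 : E / 2 < 0 by lra.
  by rewrite (nmulr_rgt0 _ E2) pmulr_rlt0.
by move: h1; move: (- E / 2 * _) (E * _) => x y; lra.
Qed.

Variables (phi psi : C2 -> C2) (O O' : set C2) (dom : set C2) (F : 'rV[R]_3 -> R).
Hypothesis Oo : open O.
Hypothesis Oo' : open O'.
Hypothesis O0 : O 0.
Hypothesis phid : forall q, O q -> differentiable phi q.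
Hypothesis psid : forall q, O' q -> differentiable psi q.
Hypothesis phiO : forall q, O q -> O' (phi q).
Hypothesis phiK : forall q, O q -> psi (phi q) = q.
Hypothesis Fs : smooth_near F 0.

Definition base_point (q : C2) : 'rV[R]_3 := pt3 (q 0 0) (Re (q 0 1)).

Hypothesis domE : \forall q \near (0 : C2),
  dom q <-> F (base_point q) < Im (q 0 1).
Hypothesis conv : forall q, O q -> ~ dom q -> forall (T : C2) (s : R),
  O' (phi q + s%:C *: T) -> O' (phi q - s%:C *: T) ->
  dom (psi (phi q + s%:C *: T)) -> dom (psi (phi q - s%:C *: T)) -> False.

Let F1 i := 'D_'e_i F.
Let F2 i j := 'D_'e_i ('D_(delta_mx 0 j) F).

Lemma base_point_near (q : C2) (U : set 'rV[R]_3) : nbhs (base_point q) U ->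
  \forall q' \near q, U (base_point q').
Proof.
move=> /nbhs_coordP[r r0 Hr]; apply/nbhs_vec2P; exists r => // h l hr lr.
have -> : base_point (q + vec2 h l) = base_point q + pt3 h (Re l).
  rewrite /base_point; apply/rowP; apply: ord3; rewrite [in RHS]mxE !(pt3_x, pt3_y, pt3_u) ![(q + _) _ _]mxE ?vec2_0 ?vec2_1 ?cReD ?cImD//.
apply: Hr; apply: ord3; rewrite ?pt3_x ?pt3_y ?pt3_u.
- exact: le_lt_trans (Re_le_normc _) hr.
- exact: le_lt_trans (Im_le_normc _) hr.
- exact: le_lt_trans (Re_le_normc _) lr.
Qed.

Lemma base_point0 : base_point 0 = 0.
Proof. by apply/rowP; apply: ord3; rewrite /base_point ?pt3_x ?pt3_y ?pt3_u !mxE. Qed.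

Lemma near_nested (T : topologicalType) (x : T) (A : set T) : nbhs x A ->
  \forall y \near x, nbhs y A.
Proof.
rewrite nbhsE => -[B [oB Bx] BA].
have : \forall y \near x, B y by exact: open_nbhs_nbhs.
by apply: filterS => y By; apply: filterS BA _; exact: open_nbhs_nbhs.
Qed.

Lemma line_near (Q T : C2) (A : set C2) : nbhs Q A ->
  \forall s \near (0 : R), A (Q + s%:C *: T) /\ A (Q - s%:C *: T).
Proof.
move=> /nbhs_vec2P[r r0 Hr].
pose N := normc (T 0 0) + normc (T 0 1) + 1.
have a0 := normc_ge0 (T 0 0); have b0 := normc_ge0 (T 0 1).
have N0 : 0 < N by rewrite ltr_wpDl// addr_ge0.
exists (r / N) => [|s]; first exact: divr_gt0.
rewrite /ball_/= sub0r normrN ltr_pdivlMr// => sN.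
have small j : normc (s%:C * T 0 j) < r.
  apply: le_lt_trans sN; rewrite normcM normcR ler_wpM2l// /N.
  have [->|->] : j = 0 \/ j = 1.
    by case: j => [[|[|//]]] i; [left|right]; apply: val_inj.
    by lra.
  by lra.
have E : s%:C *: T = vec2 (s%:C * T 0 0) (s%:C * T 0 1) by rewrite -vec2Z vec2_eta.
split; rewrite E; first by apply: Hr.
have -> : - vec2 (s%:C * T 0 0) (s%:C * T 0 1) = vec2 (- (s%:C * T 0 0)) (- (s%:C * T 0 1)).
  by rewrite -scaleN1r vec2Z !mulN1r.
by apply: Hr; rewrite normcN.
Qed.

Definition hess2 (X : 'rV[R]_3) (zeta : C) : R :=
  F2 ix ix X * Re zeta * Re zeta
  + F2 ix iy X * Re zeta * Im zeta
  + (F2 iy ix X * Im zeta * Re zeta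
     + F2 iy iy X * Im zeta * Im zeta).

(** Along the curve through a boundary point [q] that is tangent to the boundary
   and straight in the convex coordinates, the defining function vanishes at
   [q] with its first derivative; were its second derivative negative, both
   ends of a short chord through [q] would lie in the convex domain. The
   direction is chosen with [Re dw = 0], so that no derivative of [F] in [u] of
   order two occurs. *)
Lemma second_order : \forall q \near (0 : C2),
  F (base_point q) = Im (q 0 1) -> forall zeta : C,
  let X := base_point q in
  let al := 'i * (F1 ix X * Re zeta + F1 iy X * Im zeta)%:C in
  let kappa i := zeta ^+ 2 * Kform phi psi i q + zeta * al * Lform phi psi i q
    + al ^+ 2 * Nform phi psi i q in
  0 <= hess2 X zeta + F1 ix X * Re (kappa 0) + F1 iy X * Im (kappa 0)
       + F1 iu X * Re (kappa 1) - Im (kappa 1).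
Proof.
have N1 : \forall q \near (0 : C2), O q by exact: open_nbhs_nbhs.
have N2 := near_nested domE.
have N3 : \forall q \near (0 : C2), \forall q' \near q,
    forall s, differentiable (partials s F) (base_point q').
  apply: near_nested.
  apply: (@base_point_near 0 (fun X => forall s, differentiable (partials s F) X)).
  by rewrite base_point0; exact: Fs.
near=> q; move=> qb zeta.
pose X := base_point q.
pose al : C := 'i * (F1 ix X * Re zeta + F1 iy X * Im zeta)%:C.
pose kappa i := zeta ^+ 2 * Kform phi psi i q + zeta * al * Lform phi psi i q
  + al ^+ 2 * Nform phi psi i q.
change (is_true (0 <= hess2 X zeta + F1 ix X * Re (kappa 0)
  + F1 iy X * Im (kappa 0) + F1 iu X * Re (kappa 1) - Im (kappa 1))).
have Oq : O q by near: q.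
have dq : \forall q' \near q, dom q' <-> F (base_point q') < Im (q' 0 1) by near: q.
have sq : \forall q' \near q, forall s, differentiable (partials s F) (base_point q') by near: q.
have ndom : ~ dom q.
  by move=> /(nbhs_singleton dq); rewrite qb ltxx.
pose v := vec2 zeta al.
pose T := velocity phi v q.
pose Q (s : R) := phi q + s%:C *: T.
pose c (s : R) := psi (Q s).
have Q0 : Q 0 = phi q by rewrite /Q scale0r addr0.
have c0 : c 0 = q by rewrite /c Q0 phiK.
have OQ : O' (phi q) := phiO Oq.
have NO : \forall Q' \near phi q, O' Q' by exact: open_nbhs_nbhs.
have psic : forall A : set C2, nbhs q A -> \forall Q' \near phi q, A (psi Q').
  move=> A qA; have pc : {for phi q, continuous psi} := differentiable_continuous (psid OQ).
  by apply: pc; rewrite phiK.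
have near_c (A : set C2) : nbhs q A -> \forall s \near (0 : R), A (c s).
  by move=> /psic/(line_near T); apply: filterS => s [].
have near_O : \forall s \near (0 : R), O' (Q s).
  by have := line_near T NO; apply: filterS => s [].
pose ps (i : 'I_2) (Q : C2) := psi Q 0 i.
have dps i Q' : O' Q' -> differentiable (ps i) Q'.
  by move=> OQ'; apply: differentiable_comp_coord; exact: psid.
have ddps i Q' : O' Q' -> differentiable ('D_T (ps i)) Q'.
  by apply: (@holomorphic_derive _ (ps i) O') => // Q''; exact: dps.
pose x (i : 'I_3) (s : R) : R := if i == ix then Re (ps 0 (Q s))
  else if i == iy then Im (ps 0 (Q s)) else Re (ps 1 (Q s)).
pose dx (i : 'I_3) (s : R) : R := if i == ix then Re ('D_T (ps 0) (Q s))
  else if i == iy then Im ('D_T (ps 0) (Q s)) else Re ('D_T (ps 1) (Q s)).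
pose ddx (i : 'I_3) : R := if i == ix then Re ('D_T ('D_T (ps 0)) (Q 0))
  else if i == iy then Im ('D_T ('D_T (ps 0)) (Q 0)) else Re ('D_T ('D_T (ps 1)) (Q 0)).
have rowE s : \row_i x i s = base_point (c s).
  by apply/rowP => i; rewrite !mxE.
have xd i s : O' (Q s) -> is_derive s 1 (x i) (dx i s).
  move=> OQs; rewrite /x /dx; case: ifP => _; first exact: (is_derive_Re_line (dps 0 _ OQs)).
  case: ifP => _; first exact: (is_derive_Im_line (dps 0 _ OQs)).
  exact: (is_derive_Re_line (dps 1 _ OQs)).
have dxd : forall i, is_derive (0 : R) 1 (dx i) (ddx i).
  have OQ0 : O' (phi q + 0%:C *: T) by rewrite scale0r addr0.
  have H0 := (@is_derive_Re_line R ('D_T (ps 0)) (phi q) T 0 (ddps 0 _ OQ0)).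
  have H1 := (@is_derive_Im_line R ('D_T (ps 0)) (phi q) T 0 (ddps 0 _ OQ0)).
  have H2 := (@is_derive_Re_line R ('D_T (ps 1)) (phi q) T 0 (ddps 1 _ OQ0)).
  by apply: (@ord3 (fun i => is_derive (0 : R) 1 (dx i) (ddx i))); [exact: H0|exact: H1|exact: H2].
pose rho (s : R) := F (\row_i x i s) - Im (ps 1 (Q s)).
pose drho (s : R) := \sum_i dx i s * F1 i (\row_i x i s) - Im ('D_T (ps 1) (Q s)).
pose G i (s : R) := F1 i (\row_i x i s).
pose dG i := \sum_j dx j 0 * F2 j i (\row_i x i 0).
pose E := (dx ix 0 * dG ix + G ix 0 * ddx ix) + (dx iy 0 * dG iy + G iy 0 * ddx iy)
  + (dx iu 0 * dG iu + G iu 0 * ddx iu) - Im ('D_T ('D_T (ps 1)) (Q 0)).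
have Gd i : is_derive (0 : R) 1 (G i) (dG i).
  have OQ0 : O' (Q 0) by rewrite Q0.
  have H : differentiable (F1 i) (\row_i x i 0).
    by rewrite rowE c0; exact: (nbhs_singleton sq [:: i]).
  exact: (@is_derive_curve R 3 (F1 i) x (fun j => dx j 0) 0 H (fun j => xd j 0 OQ0)).
have prod i : is_derive (0 : R) 1 (fun s => dx i s * G i s) (dx i 0 * dG i + G i 0 * ddx i).
  exact: (is_deriveM (dxd i) (Gd i)).
have drhod : is_derive (0 : R) 1 drho E.
  have OQ0 : O' (Q 0) by rewrite Q0.
  have D := is_deriveB (is_deriveD (is_deriveD (prod ix) (prod iy)) (prod iu))
    (@is_derive_Im_line R ('D_T (ps 1)) (phi q) T 0 (ddps 1 _ OQ0)).
  have -> : drho = (fun s => dx ix s * G ix s + dx iy s * G iy s + dx iu s * G iu s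
      - Im ('D_T (ps 1) (Q s))).
    by apply/funext => s; rewrite /drho sum3.
  exact: D.
have rhod : \forall s \near (0 : R), is_derive (s : R) 1 rho (drho s).
  have sc := near_c _ sq.
  near=> s.
  have OQs : O' (Q s) by near: s.
  have Fds : forall l, differentiable (partials l F) (base_point (c s)) by near: s.
  have D1 : is_derive s 1 (fun s => F (\row_i x i s)) (\sum_i dx i s * F1 i (\row_i x i s)).
    have H : differentiable F (\row_i x i s) by rewrite rowE; exact: (Fds [::]).
    exact: (@is_derive_curve R 3 F x (fun j => dx j s) s H (fun j => xd j s OQs)).
  exact: (is_deriveB D1 (is_derive_Im_line (dps 1 _ OQs))).
have D0 i : 'D_T (ps i) (Q 0) = v 0 i.
  by rewrite Q0; exact: (dpsi_velocity Oo phid psid phiO phiK v i Oq).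
have v0 : v 0 0 = zeta by exact: vec2_0.
have v1 : v 0 1 = al by exact: vec2_1.
have dx0 : dx ix 0 = Re zeta by rewrite /dx eqxx D0 v0.
have dy0 : dx iy 0 = Im zeta by rewrite /dx /= D0 v0.
have al_re : Re al = 0 by rewrite /al/= mulr0 mul0r subr0.
have al_im : Im al = F1 ix X * Re zeta + F1 iy X * Im zeta.
  by rewrite /al/= mul0r mul1r add0r.
have du0 : dx iu 0 = 0 by rewrite /dx /= D0 v1.
have rho0 : rho 0 = 0.
  by rewrite /rho rowE c0 /ps -/(c 0) c0 qb subrr.
have drho0 : drho 0 = 0.
  rewrite /drho sum3 dx0 dy0 du0 D0 v1 al_im rowE c0 -/X mul0r addr0.
  by rewrite [Re _ * _]mulrC [Im _ * _]mulrC subrr.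
have acc i : 'D_T ('D_T (ps i)) (Q 0) = kappa i.
  by rewrite Q0; exact: (acceleration Oo' phid psid phiO i zeta al Oq).
have EE : E = hess2 X zeta + F1 ix X * Re (kappa 0) + F1 iy X * Im (kappa 0)
       + F1 iu X * Re (kappa 1) - Im (kappa 1).
  have hx : ddx ix = Re (kappa 0) := congr1 (@Re R) (acc 0).
  have hy : ddx iy = Im (kappa 0) := congr1 (@Im R) (acc 0).
  have hu : ddx iu = Re (kappa 1) := congr1 (@Re R) (acc 1).
  have GX i : G i 0 = F1 i X by rewrite /G rowE c0.
  have dGX i : dG i = Re zeta * F2 ix i X + Im zeta * F2 iy i X + 0 * F2 iu i X.
    by rewrite /dG sum3 dx0 dy0 du0 rowE c0.
  rewrite /E dx0 dy0 du0 (dGX ix) (dGX iy) (dGX iu) (GX ix) (GX iy) (GX iu) hx hy hu (acc 1) /hess2.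
  have alg (a b p00 p01 p10 p11 q0 q1 g0 g1 g2 k0 k0' k1 k1' m0 m1 m2 : R) :
    a * (a * p00 + b * p10 + 0 * q0) + g0 * k0 + (b * (a * p01 + b * p11 + 0 * q1) + g1 * k0')
     + (0 * (a * m0 + b * m1 + 0 * m2) + g2 * k1) - k1' =
    p00 * a * a + p01 * a * b + (p10 * b * a + p11 * b * b) + g0 * k0 + g1 * k0' + g2 * k1 - k1'.
    ring.
  exact: alg.
rewrite -EE leNgt; apply/negP => E0.
have [r r0 Hr] := no_descent rho0 drho0 rhod drhod E0.
have [r' r'0 Hr'] := line_near T (filterI NO (psic _ dq)).
pose s := Num.min r r' / 2.
have m0 : 0 < Num.min r r' by rewrite lt_min r0.
have s0' : 0 < s by rewrite divr_gt0.
have : `|s| < Num.min r r' by rewrite gtr0_norm// ltr_pdivrMr// ltr_pMr// ltr1n.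
rewrite lt_min => /andP[sr sr'].
have s0 : s != 0 by rewrite gt_eqF.
have [ [h1 h2] [d1 d2] ] : (O' (Q s) /\ O' (Q (- s))) /\
    ((dom (c s) <-> F (base_point (c s)) < Im (c s 0 1)) /\
     (dom (c (- s)) <-> F (base_point (c (- s))) < Im (c (- s) 0 1))).
  have [ [a1 a2] [b1 b2] ] := Hr' s ltac:(by rewrite /ball_/= sub0r normrN).
  by rewrite /c (_ : Q (- s) = phi q - s%:C *: T)// /Q rmorphN scaleNr.
have f1 : F (base_point (c s)) < Im (c s 0 1).
  by have := Hr s s0 sr; rewrite /rho rowE subr_lt0.
have f2 : F (base_point (c (- s))) < Im (c (- s) 0 1).
  have := Hr (- s); rewrite oppr_eq0 normrN => /(_ s0 sr).
  by rewrite /rho rowE subr_lt0.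
have QN : Q (- s) = phi q - s%:C *: T by rewrite /Q rmorphN scaleNr.
apply: (conv Oq ndom (T := T) (s := s)) => //.
- by rewrite -QN.
- exact/d1.
- by rewrite -QN; exact/d2.
Unshelve. all: by end_near. Qed.

End SecondOrder.

(** * Orders of magnitude along weighted dilations *)

Section BigO.
Context {R : realType}.
Local Notation C := R[i].
Implicit Types (f g : R -> R) (n m : nat).

(** Landau's [O(t ^ n)], for [t] tending to 0 from the right. *)
Definition Ot n f := exists c, \forall t \near (0 : R)^'+, `|f t| <= c * t ^+ n.

Lemma Ot_near n f g : Ot n f -> (\forall t \near (0 : R)^'+, `|g t| <= `|f t|) -> Ot n g.
Proof.
move=> [c fc] gf; exists c; near=> t; apply: (@le_trans _ _ `|f t|); near: t => //.
Unshelve. all: by end_near. Qed.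

Lemma Ot_le n f g : Ot n f -> (forall t, `|g t| <= `|f t|) -> Ot n g.
Proof. by move=> fO gf; apply: Ot_near fO _; near=> t. Unshelve. all: by end_near. Qed.

Lemma OtD n f g : Ot n f -> Ot n g -> Ot n (fun t => f t + g t).
Proof.
move=> [c fc] [d gd]; exists (c + d); near=> t.
apply: le_trans (ler_normD _ _) _; rewrite mulrDl; apply: lerD; near: t => //.
Unshelve. all: by end_near. Qed.

Lemma OtN n f : Ot n f -> Ot n (fun t => - f t).
Proof. by move=> fO; apply: Ot_le fO _ => t; rewrite normrN. Qed.

Lemma OtB n f g : Ot n f -> Ot n g -> Ot n (fun t => f t - g t).
Proof. by move=> fO /OtN; exact: OtD. Qed.

Lemma OtM n m f g : Ot n f -> Ot m g -> Ot (n + m) (fun t => f t * g t).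
Proof.
move=> [c fc] [d gd]; exists (c * d); near=> t.
have t0 : 0 < t by near: t; exact: nbhs_right_gt.
rewrite normrM exprD mulrACA; apply: ler_pM => //; near: t => //.
Unshelve. all: by end_near. Qed.

Lemma Ot_weaken n m f : (m <= n)%N -> Ot n f -> Ot m f.
Proof.
move=> mn [c fc]; exists `|c|; near=> t.
have /andP[t0 t1] : 0 < t <= 1 by near: t; exact: near_unit.
apply: (@le_trans _ _ (c * t ^+ n)); first by near: t.
apply: (@le_trans _ _ (`|c| * t ^+ n)).
  by rewrite ler_wpM2r ?exprn_ge0 ?ler_norm// ltW.
by rewrite ler_wpM2l// ler_wiXn2l// ltW.
Unshelve. all: by end_near. Qed.

Lemma Ot_cst c : Ot 0 (fun=> c).
Proof. by exists `|c|; near=> t; rewrite expr0 mulr1. Unshelve. all: by end_near. Qed.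

Lemma Ot_exp n : Ot n (fun t => t ^+ n).
Proof.
exists 1; near=> t; have t0 : 0 < t by near: t; exact: nbhs_right_gt.
by rewrite mul1r ger0_norm// exprn_ge0// ltW.
Unshelve. all: by end_near. Qed.

Lemma Ot_mulexp n m f : Ot m f -> Ot (n + m) (fun t => t ^+ n * f t).
Proof. exact: OtM (Ot_exp n). Qed.

Lemma Ot0 n : Ot n (fun=> 0).
Proof. by exists 0; near=> t; rewrite normr0 mul0r. Unshelve. all: by end_near. Qed.

Lemma Ot_scale n c f : Ot n f -> Ot n (fun t => c * f t).
Proof. exact: OtM (Ot_cst c). Qed.

Lemma Ot_exp_cancel n m f : Ot (n + m) (fun t => t ^+ n * f t) -> Ot m f.
Proof.
move=> [c fc]; exists c; near=> t.
have t0 : 0 < t by near: t; exact: nbhs_right_gt.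
rewrite -(ler_pM2l (exprn_gt0 n t0)).
have -> : t ^+ n * `|f t| = `|t ^+ n * f t| by rewrite normrM ger0_norm// exprn_ge0// ltW.
have -> : t ^+ n * (c * t ^+ m) = c * t ^+ (n + m) by rewrite exprD; ring.
by near: t.
Unshelve. all: by end_near. Qed.

(** The way in which an estimate with an error term becomes an inequality in
   the limit. *)
Lemma limit_le0 (a : R) f : Ot 1 f -> (\forall t \near (0 : R)^'+, a <= f t) -> a <= 0.
Proof.
move=> [c fc] af; apply/ler_addgt0Pr => e e0; rewrite add0r.
suff : \forall t \near (0 : R)^'+, a <= e by move=> /filter_ex[].
near=> t; apply: (@le_trans _ _ (f t)); first by near: t.
apply: le_trans (ler_norm _) _; apply: (@le_trans _ _ (c * t ^+ 1)); first by near: t.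
rewrite expr1; apply: (@le_trans _ _ (`|c| * t)).
  by rewrite ler_wpM2r ?ler_norm// ltW//; near: t; exact: nbhs_right_gt.
by apply: ltW; near: t; exact: near_small.
Unshelve. all: by end_near. Qed.

Lemma normc_poly_bounded (g : {poly C}) : Ot 0 (fun t => normc g.[t%:C]).
Proof.
elim/poly_ind: g => [|p c IH].
  by apply: Ot_le (Ot0 0) _ => t; rewrite horner0 normc0.
apply: Ot_near (OtD (OtM IH (Ot_weaken (leq0n 1) (Ot_exp 1))) (Ot_cst (normc c))) _.
near=> t; have t0 : 0 < t by near: t; exact: nbhs_right_gt.
rewrite hornerMXaddC expr1 !ger0_norm ?addr_ge0 ?mulr_ge0 ?normc_ge0 ?(ltW t0)//.
apply: le_trans (le_normcD _ _) _.
by rewrite normcM normcR ger0_norm// ltW.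
Unshelve. all: by end_near. Qed.

(** A polynomial that is [O(t ^ M)] has no term of lower degree. *)
Lemma poly_leading (g : {poly C}) M : Ot M (fun t => normc g.[t%:C]) ->
  Ot M.+1 (fun t => normc (g.[t%:C] - (t ^+ M)%:C * g`_M)).
Proof.
elim/poly_ind: g M => [|p c IH] M gO.
  by apply: Ot_le (Ot0 _) _ => t; rewrite horner0 coef0 mulr0 subr0 normc0.
case: M gO => [_|M gO].
  apply: Ot_near (OtM (Ot_exp 1) (normc_poly_bounded p)) _.
  near=> t; have t0 : 0 < t by near: t; exact: nbhs_right_gt.
  rewrite hornerMXaddC expr0 mul1r coefD coefMX coefC/= add0r addrK.
  rewrite !ger0_norm ?mulr_ge0 ?normc_ge0 ?exprn_ge0 ?(ltW t0)//.
  by rewrite normcM normcR expr1 mulrC gtr0_norm.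
have pO : Ot 1 (fun t => normc (p.[t%:C] * t%:C)).
  apply: Ot_near (OtM (Ot_exp 1) (normc_poly_bounded p)) _.
  near=> t; have t0 : 0 < t by near: t; exact: nbhs_right_gt.
  rewrite !ger0_norm ?mulr_ge0 ?normc_ge0 ?exprn_ge0 ?(ltW t0)//.
  by rewrite normcM normcR expr1 mulrC gtr0_norm.
have c0 : c = 0.
  apply/eqP; rewrite -normc_eq0 eq_le normc_ge0 andbT.
  apply: limit_le0 (OtD (Ot_weaken (ltn0Sn M) gO) pO) _.
  near=> t; rewrite hornerMXaddC -[normc (p.[t%:C] * t%:C)]normcN.
  by apply: le_trans _ (le_normcD _ _); rewrite addrAC subrr add0r.
rewrite {}c0 addr0 in gO *.
have pM : Ot M (fun t => normc p.[t%:C]).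
  apply: (@Ot_exp_cancel 1); apply: Ot_near gO _.
  near=> t; have t0 : 0 < t by near: t; exact: nbhs_right_gt.
  rewrite hornerMX normcM normcR expr1 normrM !ger0_norm ?mulr_ge0 ?normc_ge0 ?(ltW t0)//.
  by rewrite mulrC.
have H : Ot M.+2 _ := Ot_mulexp 1 (IH M pM).
apply: Ot_near H _.
near=> t; have t0 : 0 < t by near: t; exact: nbhs_right_gt.
rewrite hornerMX coefMX/= normrM !ger0_norm ?mulr_ge0 ?normc_ge0 ?exprn_ge0 ?(ltW t0)//.
have -> : p.[t%:C] * t%:C - (t ^+ M.+1)%:C * p`_M = t%:C * (p.[t%:C] - (t ^+ M)%:C * p`_M).
  by rewrite exprS rmorphM/=; ring.
by rewrite normcM normcR gtr0_norm// expr1.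
Unshelve. all: by end_near. Qed.

End BigO.

Section Remainder.
Context {R : realType}.
Local Notation C := R[i].
Local Notation R3 := 'rV[R]_3.
Implicit Types (F g : R3 -> R) (X : R3).

Lemma partialsB_at0 F g s : smooth_near F 0 -> polyfun g ->
  partials s (fun X => F X - g X) 0 = partials s F 0 - partials s g 0.
Proof.
move=> Fs pg.
have : nbhs (0 : R3) (fun Y => forall s, differentiable (partials s F) Y) := Fs.
rewrite nbhsE => -[B [oB B0] BF].
suff H : forall X, B X -> partials s (fun X => F X - g X) X = partials s F X - partials s g X.
  exact: H.
elim: s => [//|i s IH] X BX.
have N : \forall Y \near X, partials s (fun X => F X - g X) Y = (partials s F - partials s g) Y.
  have : \forall Y \near X, B Y by exact: open_nbhs_nbhs.
  by apply: filterS => Y BY; exact: IH.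
transitivity ('D_'e_i (partials s F - partials s g) X).
  exact: (near_eq_derive _ N).
apply: deriveB; apply: diff_derivable; first exact: BF.
by apply: polyfun_differentiable; exact: polyfun_partials.
Qed.

Variables (w : 'I_3 -> nat) (N : nat) (F g : R3 -> R).
Hypothesis w0 : (forall i, 0 < w i)%N.
Hypothesis Fs : smooth_near F 0.
Hypothesis pg : polyfun g.
Hypothesis gN : forall t X, g (dil w t X) = t ^+ N * g X.
Hypothesis FgN : forall s, (\sum_(i <- s) w i <= N)%N ->
  partials s (fun X => F X - g X) 0 = 0.

Lemma dil_bound X : forall t, 0 <= t ->
  forall i, `|dil w t X 0 i| <= (\sum_j `|X 0 j|) * t ^+ w i.
Proof.
move=> t t0 i; rewrite mxE normrM ger0_norm ?exprn_ge0// mulrC ler_wpM2r ?exprn_ge0//.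
by rewrite (bigD1 i)//= lerDl sumr_ge0.
Qed.

(** [F] and [g] agree up to the weight [N] at the origin, hence so do their
   derivatives, up to [N] diminished by the weight of the derivative. *)
Lemma remainder_partials l n X : (\sum_(i <- l) w i + n = N.+1)%N ->
  Ot n (fun t => partials l F (dil w t X) - partials l g (dil w t X)).
Proof.
move=> ln.
have D : \forall X \near (0 : R3), forall s,
    differentiable (fun X => partials s F X - partials s g X) X /\
    forall i, 'D_'e_i (fun X => partials s F X - partials s g X) X =
      partials (i :: s) F X - partials (i :: s) g X.
  apply: filterS Fs => Y FY s.
  have d1 : differentiable (partials s F) Y := FY s.
  have d2 : differentiable (partials s g) Y.
    by apply: polyfun_differentiable; exact: polyfun_partials.
  split=> [|i]; first exact: differentiableB.
  exact: (deriveB (diff_derivable d1) (diff_derivable d2)).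
have [|c Hc] := @weighted_vanishing R 3 w (\sum_j `|X 0 j|)
    (fun s X => partials s F X - partials s g X) w0 D n l.
  move=> s sn; rewrite -partialsB_at0//; apply: FgN.
  by rewrite big_cat/= addnC -ltnS -ln ltn_add2l.
exists c; near=> t; have t0 : 0 <= t by apply: ltW; near: t; exact: nbhs_right_gt.
have Hct : forall X0 : R3, (forall i, `|X0 0 i| <= (\sum_j `|X 0 j|) * t ^+ w i) ->
  `|partials l F X0 - partials l g X0| <= c * t ^+ n by near: t.
by apply: Hct; exact: dil_bound.
Unshelve. all: by end_near. Qed.

Lemma homogeneous_partials l : (\sum_(i <- l) w i <= N)%N ->
  forall t X, 0 < t ->
  partials l g (dil w t X) = t ^+ (N - \sum_(i <- l) w i) * partials l g X.
Proof.
elim: l => [|i l IH]; first by rewrite big_nil subn0.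
rewrite big_cons => le t X t0.
have {}IH Y := IH (leq_trans (leq_addl _ _) le) t Y t0.
have pl : polyfun (partials l g) by exact: polyfun_partials.
have H := homogeneous_derive i pl IH X.
apply: (mulfI (_ : t ^+ w i != 0)); first by rewrite expf_neq0// gt_eqF.
have leN := leq_trans (leq_addl _ _) le.
have E : (w i + (N - (w i + \sum_(j <- l) w j)) = N - \sum_(j <- l) w j)%N.
  by rewrite [(w i + \sum_(j <- l) w j)%N]addnC subnDA subnKC// leq_subRL// addnC.
by rewrite -/(partials l g) [LHS]H mulrA -exprD E.
Qed.

End Remainder.

Section ComplexBigO.
Context {R : realType}.
Local Notation C := R[i].
Implicit Types (f g : R -> C) (n m : nat).

Definition Otc n f := Ot n (fun t => normc (f t)).

Lemma Otc_le n f (h : R -> R) : Ot n h -> (forall t, normc (f t) <= `|h t|) -> Otc n f.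
Proof. by move=> hO fh; apply: Ot_le hO _ => t; rewrite ger0_norm ?normc_ge0. Qed.

Lemma OtcD n f g : Otc n f -> Otc n g -> Otc n (fun t => f t + g t).
Proof.
move=> fO gO; apply: Otc_le (OtD fO gO) _ => t.
by rewrite ger0_norm ?addr_ge0 ?normc_ge0// le_normcD.
Qed.

Lemma OtcN n f : Otc n f -> Otc n (fun t => - f t).
Proof. by move=> fO; apply: Otc_le fO _ => t; rewrite normcN ger0_norm ?normc_ge0. Qed.

Lemma OtcB n f g : Otc n f -> Otc n g -> Otc n (fun t => f t - g t).
Proof. by move=> fO /OtcN; exact: OtcD. Qed.

Lemma OtcM n m f g : Otc n f -> Otc m g -> Otc (n + m) (fun t => f t * g t).
Proof.
move=> fO gO; apply: Otc_le (OtM fO gO) _ => t.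
by rewrite ger0_norm ?mulr_ge0 ?normc_ge0// normcM.
Qed.

Lemma Otc_weaken n m f : (m <= n)%N -> Otc n f -> Otc m f.
Proof. exact: Ot_weaken. Qed.

Lemma Otc_cst c : Otc 0 (fun=> c).
Proof. exact: Ot_cst. Qed.

Lemma Otc_real n (h : R -> R) : Ot n h -> Otc n (fun t => (h t)%:C).
Proof. by move=> hO; apply: Otc_le hO _ => t; rewrite normcR. Qed.

Lemma Otc_Re n f : Otc n f -> Ot n (fun t => Re (f t)).
Proof. by move=> fO; apply: Ot_le fO _ => t; rewrite [leRHS]ger0_norm ?normc_ge0// Re_le_normc. Qed.

Lemma Otc_Im n f : Otc n f -> Ot n (fun t => Im (f t)).
Proof. by move=> fO; apply: Ot_le fO _ => t; rewrite [leRHS]ger0_norm ?normc_ge0// Im_le_normc. Qed.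

Lemma Otc_scale n c f : Otc n f -> Otc n (fun t => c * f t).
Proof. exact: OtcM (Otc_cst c). Qed.

Lemma Otc_sum n (T : Type) (s : seq T) (f : T -> R -> C) :
  (forall e, Otc n (f e)) -> Otc n (fun t => \sum_(e <- s) f e t).
Proof.
move=> fO; elim: s => [|e s IH].
  by apply: Otc_le (Ot0 n) _ => t; rewrite big_nil normc0.
by apply: Otc_le (OtcD (fO e) IH) _ => t; rewrite big_cons ger0_norm ?normc_ge0.
Qed.

Lemma Otc_pow f j : Otc 0 f -> Otc 0 (fun t => f t ^+ j).
Proof.
move=> fO; elim: j => [|j IH].
  by apply: Otc_le (Ot_cst 1) _ => t; rewrite expr0 normc1 normr1.
by apply: Otc_le (OtcM fO IH) _ => t; rewrite exprS ger0_norm ?normc_ge0.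
Qed.

Lemma Otc_powB n f g j : Otc 0 f -> Otc 0 g -> Otc n (fun t => f t - g t) ->
  Otc n (fun t => f t ^+ j - g t ^+ j).
Proof.
move=> fO gO fg; elim: j => [|j IH].
  by apply: Otc_le (Ot0 n) _ => t; rewrite subrr normc0.
have H : Otc (0 + n) _ := OtcD (OtcM fO IH) (OtcM (Otc_pow j gO) fg).
apply: Otc_le H _ => t; rewrite [leRHS]ger0_norm ?normc_ge0// le_eqVlt.
by apply/orP; left; apply/eqP; congr normc; rewrite !exprS; ring.
Qed.

Lemma peval_Otc (p : seq (C * (nat * nat))) n (z w w' : R -> C) :
  Otc 0 z -> Otc 0 w -> Otc 0 w' -> Otc n (fun t => w t - w' t) ->
  Otc n (fun t => peval p (z t) (w t) - peval p (z t) (w' t)).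
Proof.
move=> zO wO w'O ww'.
have H : Otc n (fun t => \sum_(e <- p) e.1 * z t ^+ e.2.1 * (w t ^+ e.2.2 - w' t ^+ e.2.2)).
  apply: Otc_sum => e; have H1 := Otc_scale e.1 (Otc_pow e.2.1 zO).
  exact: OtcM H1 (Otc_powB e.2.2 wO w'O ww').
apply: Otc_le H _ => t; rewrite [leRHS]ger0_norm ?normc_ge0// le_eqVlt.
apply/orP; left; apply/eqP; congr normc.
by rewrite /peval -sumrB; apply: eq_bigr => e _; ring.
Qed.

Lemma Ot_small n (h : R -> R) (e : R) : (0 < n)%N -> 0 < e -> Ot n h ->
  \forall t \near (0 : R)^'+, `|h t| < e.
Proof.
move=> n0 e0 [c hc]; near=> t.
have t01 : 0 < t <= 1 by near: t; exact: near_unit.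
have ce : `|c| * t < e by near: t; exact: near_small.
by apply: (weight_small n0 t01 ce); near: t.
Unshelve. all: by end_near. Qed.

(** Along a weighted dilation a polynomial in [z] and [w] becomes a polynomial in
   [t] graded by the weight, to which [poly_leading] applies. *)
Lemma peval_leading (p : seq (C * (nat * nat))) (a b M : nat) (z w : C) :
  Otc M (fun t => peval p ((t ^+ a)%:C * z) ((t ^+ b)%:C * w)) ->
  Otc M.+1 (fun t => peval p ((t ^+ a)%:C * z) ((t ^+ b)%:C * w) -
    (t ^+ M)%:C * peval [seq e <- p | (a * e.2.1 + b * e.2.2 == M)%N] z w).
Proof.
pose g : {poly C} := \sum_(e <- p) (e.1 * z ^+ e.2.1 * w ^+ e.2.2) *: 'X^(a * e.2.1 + b * e.2.2).
have gE t : g.[t%:C] = peval p ((t ^+ a)%:C * z) ((t ^+ b)%:C * w).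
  rewrite /g horner_sum; apply: eq_bigr => e _.
  rewrite hornerZ hornerXn !exprMn exprD !exprM !rmorphXn/=; ring.
have gM : g`_M = peval [seq e <- p | (a * e.2.1 + b * e.2.2 == M)%N] z w.
  rewrite /g coef_sum /peval big_filter [RHS]big_mkcond/=; apply: eq_bigr => e _.
  by rewrite coefZ coefXn eq_sym; case: eqP => _; rewrite ?mulr1 ?mulr0.
move=> H; have : Ot M (fun t => normc g.[t%:C]).
  by apply: Ot_le H _ => t; rewrite gE.
by move/poly_leading => {}H; apply: Ot_le H _ => t; rewrite gE gM.
Qed.

End ComplexBigO.

(** * Passage to the weighted limit *)

Section Limit.
Context {R : realType}.
Local Notation C := R[i].
Local Notation C2 := 'rV[C]_2.
Local Notation R3 := 'rV[R]_3.

Lemma Dz2E (P : C -> R -> R) z u zeta :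
  Dz2 P z u zeta = hess2 (real3 P) (pt3 z u) zeta.
Proof. by rewrite /Dz2 !big_cons !big_nil !addr0. Qed.

Lemma differentiable_bounded (G : C2 -> C) : differentiable G 0 ->
  exists B : R, \forall q \near (0 : C2), normc (G q) <= B.
Proof.
move=> /differentiable_fderiv/fderiv_bounded[r [B [r0 H]]]; exists B.
apply/nbhs_vec2P; exists r => // h l hr lr.
by have := H h l hr lr; rewrite -vec2D vec2_eta.
Qed.

(** The four directions give [zeta ^ 2] the values 1, -1 and, up to a factor 2,
   [i] and [- i]; thus upper bounds for the form are also lower bounds, and the
   perturbation with the factor [f] is absorbed. *)
Lemma four_directions (k : C) (f : R) (bd : C -> R) : `|f| <= 2^-1 ->
  let Q zeta := Im (zeta ^+ 2 * k) - f * Re (zeta ^+ 2 * k) <= bd zeta in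
  Q 1 -> Q 'i -> Q (1 + 'i) -> Q (1 - 'i) ->
  normc k <= 4 * (`|bd 1| + `|bd 'i| + `|bd (1 + 'i)| + `|bd (1 - 'i)|).
Proof.
case: k => x y f2 Q H1 H2 H3 H4; have := normc_le_ReIm (x +i* y); move: (normc _) => n /= nk.
have h1 := le_trans H1 (ler_norm _); have h2 := le_trans H2 (ler_norm _).
have h3 := le_trans H3 (ler_norm _); have h4 := le_trans H4 (ler_norm _).
have e2 : 'i ^+ 2 = -1 :> C := sqr_i R.
have e3 : (1 + 'i) ^+ 2 = 2%:C * 'i :> C.
  by rewrite rmorph_nat sqrrD e2 expr1n mul1r; ring.
have e4 : (1 - 'i) ^+ 2 = - (2%:C * 'i) :> C.
  by rewrite rmorph_nat sqrrB e2 expr1n mul1r; ring.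
move: h1 h2 h3 h4; rewrite e2 e3 e4 expr1n mul1r mulN1r mulNr.
move: (normr_ge0 (bd 1)) (normr_ge0 (bd 'i)) (normr_ge0 (bd (1 + 'i))) (normr_ge0 (bd (1 - 'i))).
move: `|bd 1| `|bd 'i| `|bd (1 + 'i)| `|bd (1 - 'i)| => b1 b2 b3 b4 p1 p2 p3 p4.
rewrite {H1 H2 H3 H4 Q}/= !(mul0r, mulr0, mulr1, subr0, addr0, sub0r, add0r, oppr0, mulrN, opprK).
move=> h1 h2 h3 h4.
apply: le_trans nk _.
have fx : `|f * x| <= 2^-1 * `|x| by rewrite normrM ler_wpM2r.
have fy : `|f * y| <= 2^-1 * `|y| by rewrite normrM ler_wpM2r.
move: fx fy; rewrite !ler_norml => /andP[fx1 fx2] /andP[fy1 fy2].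
have y1 : `|y| <= 2^-1 * `|x| + b1 + b2 by rewrite ler_norml; apply/andP; split; lra.
have x1 : `|x| <= 2^-1 * `|y| + b3 + b4 by rewrite ler_norml; apply/andP; split; lra.
lra.
Qed.

Variables (a b N : nat) (P : C -> R -> R) (F : R3 -> R) (O : set C2).
Variables (K L H : 'I_2 -> C2 -> C).
Hypotheses (a0 : (0 < a)%N) (b0 : (0 < b)%N) (bN : (b <= N)%N) (aN : (a + a <= N)%N).
Hypothesis pP : polyfun (real3 P).
Hypothesis PN : forall t z u, P ((t ^+ a)%:C * z) (t ^+ b * u) = t ^+ N * P z u.
Hypothesis Fs : smooth_near F 0.
Hypothesis F1 : forall i, partials [:: i] F 0 = 0.
Hypothesis FP : forall s, (\sum_(i <- s) wt3 a b i <= N)%N ->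
  partials s (fun X => F X - real3 P X) 0 = 0.
Hypothesis Oo : open O.
Hypothesis O0 : O 0.
Hypothesis Kd : forall i q, O q -> differentiable (K i) q.
Hypothesis Ld : forall i q, O q -> differentiable (L i) q.
Hypothesis Hd : forall i q, O q -> differentiable (H i) q.
Hypothesis tangent_ineq : \forall q \near (0 : C2),
  F (base_point q) = Im (q 0 1) -> forall zeta : C,
  let X := base_point q in
  let al := 'i * ('D_'e_ix F X * Re zeta
                  + 'D_'e_iy F X * Im zeta)%:C in
  let kappa i := zeta ^+ 2 * K i q + zeta * al * L i q + al ^+ 2 * H i q in
  0 <= hess2 F X zeta + 'D_'e_ix F X * Re (kappa 0)
       + 'D_'e_iy F X * Im (kappa 0)
       + 'D_'e_iu F X * Re (kappa 1) - Im (kappa 1).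

Let M := (N - (a + a))%N.
Let w := wt3 a b.

Let w_gt0 i : (0 < w i)%N.
Proof. by rewrite /w /wt3; case: ifP. Qed.

Let gN t X : real3 P (dil w t X) = t ^+ N * real3 P X.
Proof. by rewrite -[X]pt3_eta dil_pt3 !real3_pt3 PN. Qed.

Section Point.
Variables (z : C) (u : R).

Let X (t : R) : R3 := dil w t (pt3 z u).
Let zt (t : R) : C := (t ^+ a)%:C * z.
Let ut (t : R) : C := (t ^+ b)%:C * u%:C.
Let wt (t : R) : C := ut t + 'i * (F (X t))%:C.
Let q (t : R) : C2 := vec2 (zt t) (wt t).

Let base_q t : base_point (q t) = X t.
Proof.
rewrite /base_point /q vec2_0 vec2_1 /X dil_pt3; congr pt3.
by rewrite /wt /ut !cReD !cReM/= !(mul0r, mulr0, subr0, addr0).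
Qed.

Let F_q t : F (base_point (q t)) = Im (q t 0 1).
Proof.
rewrite base_q /q vec2_1 /wt /ut !cImD !cImM/=.
by rewrite !(mul0r, mulr0, addr0, add0r, mul1r).
Qed.

Let ix_w : w ix = a. Proof. by []. Qed.
Let iy_w : w iy = a. Proof. by []. Qed.

Let rem l n : (\sum_(i <- l) w i + n = N.+1)%N ->
  Ot n (fun t => partials l F (X t) - partials l (real3 P) (X t)).
Proof. exact: remainder_partials. Qed.

Let FO : Ot N (fun t => F (X t)).
Proof.
have r := @rem [::] N.+1 ltac:(by rewrite big_nil).
have h := OtM (Ot_exp N) (Ot_cst (real3 P (pt3 z u))); rewrite addn0 in h.
apply: Ot_le (OtD (Ot_weaken (leqnSn N) r) h) _ => t.
by rewrite /partials/= gN subrK.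
Qed.

Let aN1 : (a <= N)%N := leq_trans (leq_addr a a) aN.

Let F1O i : w i = a -> Ot (N - a) (fun t => 'D_'e_i F (X t)).
Proof.
move=> wi.
have r := @rem [:: i] (N.+1 - a) ltac:(by rewrite big_seq1 wi subnKC// ltnW).
have h := OtM (Ot_exp (N - a)) (Ot_cst (partials [:: i] (real3 P) (pt3 z u))).
rewrite addn0 in h.
have le : (N - a <= N.+1 - a)%N by rewrite leq_sub2r.
apply: Ot_near (OtD (Ot_weaken le r) h) _.
near=> t; have t0 : 0 < t by near: t; exact: nbhs_right_gt.
have hp := homogeneous_partials pP gN (l := [:: i]) _ _ t0.
rewrite big_seq1 wi in hp.
by rewrite -(hp aN1 (pt3 z u)) subrK.
Unshelve. all: by end_near. Qed.

Let F2O i j : w i = a -> w j = a ->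
  Ot M.+1 (fun t => partials [:: i; j] F (X t) - t ^+ M * partials [:: i; j] (real3 P) (pt3 z u)).
Proof.
move=> wi wj.
have s2 : (\sum_(k <- [:: i; j]) w k = a + a)%N by rewrite big_cons big_seq1 wi wj.
have r := @rem [:: i; j] M.+1 ltac:(by rewrite s2 /M addnS subnKC).
apply: Ot_near r _.
near=> t; have t0 : 0 < t by near: t; exact: nbhs_right_gt.
have hp := homogeneous_partials pP gN (l := [:: i; j]) _ _ t0.
rewrite s2 in hp; by rewrite -(hp aN (pt3 z u)).
Unshelve. all: by end_near. Qed.

Let hessO zeta : Ot M.+1 (fun t => hess2 F (X t) zeta - t ^+ M * Dz2 P z u zeta).
Proof.
pose x := Re zeta; pose y := Im zeta.
have h := OtD (OtD (Ot_scale (x * x) (F2O ix_w ix_w)) (Ot_scale (x * y) (F2O ix_w iy_w)))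
  (OtD (Ot_scale (y * x) (F2O iy_w ix_w)) (Ot_scale (y * y) (F2O iy_w iy_w))).
apply: Ot_le h _ => t; rewrite le_eqVlt; apply/orP; left; apply/eqP; congr `|_|.
rewrite Dz2E.
have alg (s p1 p2 p3 p4 q1 q2 q3 q4 : R) :
  p1 * x * x + p2 * x * y + (p3 * y * x + p4 * y * y) -
   s * (q1 * x * x + q2 * x * y + (q3 * y * x + q4 * y * y)) =
  x * x * (p1 - s * q1) + x * y * (p2 - s * q2) +
    (y * x * (p3 - s * q3) + y * y * (p4 - s * q4)) by ring.
exact: alg.
Qed.

Let ztO : Otc a zt.
Proof. by have h := OtcM (Otc_real (Ot_exp a)) (Otc_cst z); rewrite addn0 in h. Qed.

Let utO : Otc b ut.
Proof. by have h := OtcM (Otc_real (Ot_exp b)) (Otc_cst u%:C); rewrite addn0 in h. Qed.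

Let FcO : Otc N (fun t => 'i * (F (X t))%:C).
Proof. exact: Otc_scale (Otc_real FO). Qed.

Let wtO : Otc b wt.
Proof. exact: OtcD utO (Otc_weaken bN FcO). Qed.

Let q_near (A : set C2) : nbhs (0 : C2) A -> \forall t \near (0 : R)^'+, A (q t).
Proof.
move=> /nbhs_vec2P[r r0 Hr]; near=> t.
rewrite -[q t]add0r; apply: Hr.
  by rewrite -[ltLHS]ger0_norm ?normc_ge0//; near: t; exact: Ot_small ztO.
by rewrite -[ltLHS]ger0_norm ?normc_ge0//; near: t; exact: Ot_small wtO.
Unshelve. all: by end_near. Qed.

Let GO (G : C2 -> C) : (forall q, O q -> differentiable G q) -> Otc 0 (fun t => G (q t)).
Proof.
move=> Gd; have [B GB] := differentiable_bounded (Gd 0 O0).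
exists B; have := q_near GB; apply: filterS => t.
by rewrite expr0 mulr1 ger0_norm ?normc_ge0.
Qed.

Let FuO (e : R) : 0 < e -> \forall t \near (0 : R)^'+, `|'D_'e_iu F (X t)| < e.
Proof.
move=> e0.
have d : differentiable ('D_'e_iu F) 0 := nbhs_singleton Fs [:: iu].
have Fu0 : 'D_'e_iu F 0 = 0 := F1 iu.
have : \forall Y \near (0 : R3), `|'D_'e_iu F Y| < e.
  by apply: (cvgr_norm_lt ('D_'e_iu F 0) (differentiable_continuous d)); rewrite Fu0 normr0.
move=> Y0; have := @base_point_near R 0 (fun Y => `|'D_'e_iu F Y| < e).
rewrite base_point0 => /(_ Y0)/q_near; apply: filterS => t.
by rewrite base_q.
Qed.

Let FuO0 : Ot 0 (fun t => 'D_'e_iu F (X t)).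
Proof.
exists 1; have := FuO ltr01; apply: filterS => t /ltW.
by rewrite expr0 mulr1.
Qed.

Let leM : (M.+1 <= N - a)%N.
Proof.
rewrite /M subnDA ltn_subrL a0 subn_gt0/=; apply: leq_trans aN.
by rewrite -addn1 leq_add2l.
Qed.

Let al (zeta : C) t : C := 'i * ('D_'e_ix F (X t) * Re zeta
                  + 'D_'e_iy F (X t) * Im zeta)%:C.

Let alO zeta : Otc M.+1 (al zeta).
Proof.
apply: Otc_scale; apply: Otc_real; apply: Ot_weaken leM _.
have h1 := Ot_scale (Re zeta) (F1O ix_w).
have h2 := Ot_scale (Im zeta) (F1O iy_w).
by apply: Ot_le (OtD h1 h2) _ => t; rewrite [Re _ * _]mulrC [Im _ * _]mulrC.
Qed.

Let r i zeta t : C := zeta * al zeta t * L i (q t) + al zeta t ^+ 2 * H i (q t).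

Let rO i zeta : Otc M.+1 (r i zeta).
Proof.
apply: OtcD.
  have h := OtcM (Otc_scale zeta (alO zeta)) (GO (@Ld i)).
  by rewrite addn0 in h.
have h := OtcM (OtcM (alO zeta) (Otc_weaken (leq0n _) (alO zeta))) (GO (@Hd i)).
by rewrite !addn0 in h.
Qed.

Let kappa i zeta t : C := zeta ^+ 2 * K i (q t) + r i zeta t.

Let kappaO i zeta : Otc 0 (kappa i zeta).
Proof.
apply: OtcD; last exact: Otc_weaken (leq0n _) (rO i zeta).
exact: Otc_scale (GO (@Kd i)).
Qed.

Let err zeta t : R := (hess2 F (X t) zeta - t ^+ M * Dz2 P z u zeta)
  + 'D_'e_ix F (X t) * Re (kappa 0 zeta t)
  + 'D_'e_iy F (X t) * Im (kappa 0 zeta t)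
  + 'D_'e_iu F (X t) * Re (r 1 zeta t) - Im (r 1 zeta t).

Let errO zeta : Ot M.+1 (err zeta).
Proof.
have h1 := OtM (F1O ix_w) (Otc_Re (kappaO 0 zeta)).
have h2 := OtM (F1O iy_w) (Otc_Im (kappaO 0 zeta)).
rewrite addn0 in h1; rewrite addn0 in h2.
have h3 := OtM FuO0 (Otc_Re (rO 1 zeta)).
apply: OtB; last exact: Otc_Im (rO 1 zeta).
apply: OtD; last exact: h3.
apply: OtD; last exact: Ot_weaken leM h2.
apply: OtD; last exact: Ot_weaken leM h1.
exact: hessO.
Qed.

Let k1 t : C := K 1 (q t).

(** The tangential inequality at [q t], with all the terms of higher order
   collected in [err]. *)
Let main_ineq zeta : \forall t \near (0 : R)^'+,
  Im (zeta ^+ 2 * k1 t) - 'D_'e_iu F (X t) * Re (zeta ^+ 2 * k1 t)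
  <= t ^+ M * Dz2 P z u zeta + err zeta t.
Proof.
have := q_near tangent_ineq; apply: filterS => t /(_ (F_q t) zeta); rewrite base_q.
have kE i : kappa i zeta t =
    zeta ^+ 2 * K i (q t) + zeta * al zeta t * L i (q t) + al zeta t ^+ 2 * H i (q t) := addrA _ _ _.
move=> I.
have {I} : 0 <= hess2 F (X t) zeta + 'D_'e_ix F (X t) * Re (kappa 0 zeta t)
       + 'D_'e_iy F (X t) * Im (kappa 0 zeta t)
       + 'D_'e_iu F (X t) * Re (kappa 1 zeta t) - Im (kappa 1 zeta t).
  by rewrite (kE 0) (kE 1); exact: I.
have e1 : Re (kappa 1 zeta t) = Re (zeta ^+ 2 * k1 t) + Re (r 1 zeta t) := cReD _ _.
have e2 : Im (kappa 1 zeta t) = Im (zeta ^+ 2 * k1 t) + Im (r 1 zeta t) := cImD _ _.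
rewrite e1 e2 /err.
have alg (h d f1 f2 f3 x y kx ky rx ry : R) :
  0 <= h + f1 * x + f2 * y + f3 * (kx + rx) - (ky + ry) ->
  ky - f3 * kx <= d + (h - d + f1 * x + f2 * y + f3 * rx - ry).
  by rewrite mulrDr; lra.
exact: alg.
Qed.

Let k1O : Otc M k1.
Proof.
pose bd zeta t := t ^+ M * Dz2 P z u zeta + err zeta t.
have bO zeta : Ot M (bd zeta).
  have h := OtM (Ot_exp M) (Ot_cst (Dz2 P z u zeta)); rewrite addn0 in h.
  exact: OtD h (Ot_weaken (leqnSn M) (errO zeta)).
have bO' zeta : Ot M (fun t => `|bd zeta t|) by apply: Ot_le (bO zeta) _ => t; rewrite normr_id.
have h := Ot_scale 4 (OtD (OtD (OtD (bO' 1) (bO' 'i)) (bO' (1 + 'i))) (bO' (1 - 'i))).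
apply: Ot_near h _.
near=> t.
rewrite [leRHS]ger0_norm ?mulr_ge0 ?addr_ge0// ger0_norm ?normc_ge0//.
have f2 : `|'D_'e_iu F (X t)| <= 2^-1.
  by apply: ltW; near: t; apply: FuO; rewrite invr_gt0.
apply: (four_directions f2 (bd := bd^~ t)).
- by near: t; exact: main_ineq.
- by near: t; exact: main_ineq.
- by near: t; exact: main_ineq.
- by near: t; exact: main_ineq.
Unshelve. all: by end_near. Qed.

Variable p : seq (C * (nat * nat)).
Hypothesis Hp : forall A : R, exists c, \forall t \near (0 : R)^'+, forall z w : C,
    normc z <= A * t ^+ a -> normc w <= A * t ^+ b ->
    normc (K 1 (vec2 z w) - peval p z w) <= c * t ^+ M.+1.

Let k1p : Otc M.+1 (fun t => k1 t - peval p (zt t) (wt t)).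
Proof.
have [c1 zc] := ztO; have [c2 wc] := wtO.
have [c Hc] := Hp (`|c1| + `|c2|).
exists c; near=> t.
have t0 : 0 < t by near: t; exact: nbhs_right_gt.
have Hct : forall z w : C,
    normc z <= (`|c1| + `|c2|) * t ^+ a -> normc w <= (`|c1| + `|c2|) * t ^+ b ->
    normc (K 1 (vec2 z w) - peval p z w) <= c * t ^+ M.+1 by near: t.
have le n : 0 <= t ^+ n by rewrite exprn_ge0// ltW.
rewrite ger0_norm ?normc_ge0//; apply: Hct.
  rewrite -[leLHS]ger0_norm ?normc_ge0//; apply: (@le_trans _ _ (c1 * t ^+ a)); first by near: t.
  by rewrite ler_wpM2r// (le_trans (ler_norm _))// lerDl.
rewrite -[leLHS]ger0_norm ?normc_ge0//; apply: (@le_trans _ _ (c2 * t ^+ b)); first by near: t.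
by rewrite ler_wpM2r// (le_trans (ler_norm _))// lerDr.
Unshelve. all: by end_near. Qed.

Let top := [seq e <- p | (a * e.2.1 + b * e.2.2 == M)%N].

(** On the curve [q t] the Taylor polynomial may be evaluated at [u] instead of
   [w = u + i F], because [F] is [O(t ^ N)] and [M < N]. *)
Let k1_top : Otc M.+1 (fun t => k1 t - (t ^+ M)%:C * peval top z u%:C).
Proof.
have leMN : (M.+1 <= N)%N := leq_trans leM (leq_subr a N).
have d : Otc M.+1 (fun t => peval p (zt t) (wt t) - peval p (zt t) (ut t)).
  apply: peval_Otc; try exact: Otc_weaken (leq0n _) _.
  - exact: Otc_weaken (leq0n _) ztO.
  - exact: Otc_weaken (leq0n _) wtO.
  - exact: Otc_weaken (leq0n _) utO.
  - apply: Otc_le (Otc_weaken leMN FcO) _ => t.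
    by rewrite /wt addrAC subrr add0r ger0_norm ?normc_ge0.
have pO : Otc M (fun t => peval p (zt t) (ut t)).
  have h := OtcB (OtcB k1O (Otc_weaken (leqnSn M) k1p)) (Otc_weaken (leqnSn M) d).
  apply: Otc_le h _ => t; rewrite [leRHS]ger0_norm ?normc_ge0// le_eqVlt.
  by apply/orP; left; apply/eqP; congr normc; ring.
have h := OtcD (OtcD k1p d) (peval_leading pO).
apply: Otc_le h _ => t; rewrite [leRHS]ger0_norm ?normc_ge0// le_eqVlt.
by apply/orP; left; apply/eqP; congr normc; rewrite -/top /zt /ut; ring.
Qed.

Lemma limit_ineq zeta :
  0 <= Dz2 P z u zeta - Im (peval top z u%:C * zeta ^+ 2).
Proof.
set d := Dz2 P z u zeta; set T := peval top z u%:C.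
rewrite subr_ge0 -subr_le0.
have [c k1c] : Otc M (fun t => zeta ^+ 2 * k1 t) := Otc_scale (zeta ^+ 2) k1O.
apply/ler_addgt0Pr => e e0; rewrite add0r -subr_le0.
have c1 : 0 < `|c| + 1 by rewrite ltr_wpDl.
pose rest t := err zeta t - Im (zeta ^+ 2 * (k1 t - (t ^+ M)%:C * T)).
have restO : Ot M.+1 rest.
  by apply: OtB (errO zeta) _; apply: Otc_Im; exact: Otc_scale k1_top.
have [c2 rc] := restO.
have lin : Ot 1 (fun t => c2 * t) := Ot_scale c2 (Ot_exp 1).
apply: limit_le0 lin _.
near=> t; have t0 : 0 < t by near: t; exact: nbhs_right_gt.
have tM : 0 < t ^+ M by rewrite exprn_gt0.
have fu : `|'D_'e_iu F (X t)| < e / (`|c| + 1).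
  by near: t; apply: FuO; rewrite divr_gt0.
have mi : Im (zeta ^+ 2 * k1 t) - 'D_'e_iu F (X t) * Re (zeta ^+ 2 * k1 t)
  <= t ^+ M * d + err zeta t by near: t; exact: main_ineq.
have kb : normc (zeta ^+ 2 * k1 t) <= `|c| * t ^+ M.
  apply: (@le_trans _ _ (c * t ^+ M)); last by rewrite ler_wpM2r ?ler_norm// ltW.
  by rewrite -[leLHS]ger0_norm ?normc_ge0//; near: t.
have rb : `|rest t| <= c2 * t ^+ M.+1 by near: t.
have fk : 'D_'e_iu F (X t) * Re (zeta ^+ 2 * k1 t) <= e * t ^+ M.
  apply: le_trans (ler_norm _) _; rewrite normrM.
  apply: (@le_trans _ _ (e / (`|c| + 1) * (`|c| * t ^+ M))).
    by apply: ler_pM => //; [exact: ltW | exact: le_trans (Re_le_normc _) kb].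
  rewrite mulrA ler_pM2r// mulrAC ler_pdivrMr// ler_pM2l// lerDl//.
rewrite -(ler_pM2l tM).
have -> : t ^+ M * (c2 * t) = c2 * t ^+ M.+1 by rewrite exprSr; ring.
have rE : Im (zeta ^+ 2 * k1 t) = t ^+ M * Im (T * zeta ^+ 2) +
    Im (zeta ^+ 2 * (k1 t - (t ^+ M)%:C * T)).
  have -> : t ^+ M * Im (T * zeta ^+ 2) = Im ((t ^+ M)%:C * (T * zeta ^+ 2)).
    by rewrite [in RHS]cImM/= mul0r addr0.
  by rewrite -cImD; congr Im; ring.
have := le_trans (ler_norm _) rb; rewrite /rest => rb'.
have := mi; rewrite rE.
by rewrite !mulrBr [t ^+ M * e]mulrC; lra.
Unshelve. all: by end_near. Qed.

End Point.

(** The polynomial is the part of weight [M] of the Taylor expansion of [K 1];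
   the same one serves for all points, since the expansion does not depend on
   the point [(z, u)] being dilated. *)
Theorem convex_limit : exists p : seq (C * (nat * nat)),
  (forall e, e \in p -> (a * e.2.1 + b * e.2.2 = M)%N) /\
  forall z u zeta, 0 <= Dz2 P z u zeta - Im (peval p z u%:C * zeta ^+ 2).
Proof.
have [p Hp] := weighted_taylor Oo O0 a0 b0 M.+1 (@Kd 1).
exists [seq e <- p | (a * e.2.1 + b * e.2.2 == M)%N]; split.
  by move=> e; rewrite mem_filter => /andP[/eqP].
by move=> z u zeta; exact: limit_ineq.
Qed.

End Limit.

(** * The tangential inequality for a locally convexifiable boundary *)

Section Geometry.
Context {R : realType}.
Local Notation C := R[i].
Local Notation C2 := 'rV[C]_2.

Lemma ofC_l (Q : C2) j : ofC Q 0 (lshift 2 j) = Re (Q 0 j).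
Proof. by rewrite /ofC row_mxEl mxE. Qed.

Lemma ofC_r (Q : C2) j : ofC Q 0 (rshift 2 j) = Im (Q 0 j).
Proof. by rewrite /ofC row_mxEr mxE. Qed.

Lemma toC_ofC (Q : C2) : toC (ofC Q) = Q.
Proof. by apply/rowP => j; rewrite mxE ofC_l ofC_r; case: (Q 0 j). Qed.

Lemma toC_midpoint (Q T : C2) (s : R) :
  toC (2^-1 *: ofC (Q + s%:C *: T) + 2^-1 *: ofC (Q - s%:C *: T)) = Q.
Proof.
have lin (A B : 'rV[R]_(2 + 2)) i :
  (2^-1 *: A + 2^-1 *: B) 0 i = 2^-1 * A 0 i + 2^-1 * B 0 i by rewrite !mxE.
apply/rowP => j; rewrite mxE !lin !ofC_l !ofC_r !mxE.
case: (Q 0 j) => x y; case: (T 0 j) => x' y' /=.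
by congr (_ +i* _); field.
Qed.

Lemma open_restricted_preimage (U A : set C2) (f : C2 -> C2) : open U -> open A ->
  (forall q, U q -> differentiable f q) -> open [set q | U q /\ A (f q)].
Proof.
move=> oU oA fd; rewrite openE => q [Uq Afq].
have c : {for q, continuous f} := differentiable_continuous (fd q Uq).
apply: filterI; first exact: open_nbhs_nbhs.
by apply: c; exact: open_nbhs_nbhs.
Qed.

Lemma convex_midpoint (A : set 'rV[R]_(2 + 2)) : @convex_set R 'rV[R]_(2 + 2) A ->
  forall X Y, A X -> A Y -> A (2^-1 *: X + 2^-1 *: Y).
Proof.
move=> cA X Y AX AY.
have h0 : (0 : R) <= 2^-1 by lra.
have h1 : (2^-1 : R) <= 1 by lra.
have := cA X Y (Itv01 h0 h1) (mem_set AX) (mem_set AY).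
rewrite inE; congr A.
rewrite /conv/=; congr (_ *: _ + _ *: _).
rewrite /unstable.onem; lra.
Qed.

(** Here [phi] is [f' \o g]. Convexity enters in the form that [second_order]
   requires: in the convex coordinates, a point outside [D] is never the
   midpoint of two points of [D]. *)
Lemma tangential_inequality (D : set C2) (p : C2) f g F :
  normal_coordinates D p f g F -> locally_convexifiable D p ->
  exists (O : set C2) (phi psi : C2 -> C2), [/\ open O /\ O 0,
    forall i q, O q -> differentiable (Kform phi psi i) q,
    forall i q, O q -> differentiable (Lform phi psi i) q,
    forall i q, O q -> differentiable (Nform phi psi i) q &
    \forall q \near (0 : C2),
  F (base_point q) = Im (q 0 1) -> forall zeta : C,
  let X := base_point q in
  let al := 'i * ('D_'e_ix F X * Re zeta
                  + 'D_'e_iy F X * Im zeta)%:C in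
  let kappa i := zeta ^+ 2 * Kform phi psi i q + zeta * al * Lform phi psi i q
    + al ^+ 2 * Nform phi psi i q in
  0 <= hess2 F X zeta + 'D_'e_ix F X * Re (kappa 0)
       + 'D_'e_iy F X * Im (kappa 0)
       + 'D_'e_iu F X * Re (kappa 1) - Im (kappa 1)].
Proof.
move=> [ [U [V [Up [oU oV fUV gVU]]]] fp Fs _ domE].
move=> [U' [V' [f' [g' [U'p [oU' oV' fUV' gVU'] cvx]]]]].
have [Vfp gfp _] := fUV p Up; rewrite fp in Vfp gfp.
pose O : set C2 := [set q | V q /\ U' (g q)].
pose O' : set C2 := [set Q | V' Q /\ U (g' Q)].
pose phi q := f' (g q); pose psi Q := f (g' Q).
have oO : open O.
  by apply: open_restricted_preimage => // q /gVU[].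
have oO' : open O'.
  by apply: open_restricted_preimage => // q /gVU'[].
have O0 : O 0 by split=> //; rewrite gfp.
have phid q : O q -> differentiable phi q.
  move=> [/gVU[_ _ dg] /fUV'[_ _ df]]; exact: (differentiable_comp dg df).
have psid q : O' q -> differentiable psi q.
  move=> [/gVU'[_ _ dg] /fUV[_ _ df]]; exact: (differentiable_comp dg df).
have phiO q : O q -> O' (phi q).
  move=> [/gVU[Ug _ _] /fUV'[V'f g'f _]]; split=> //; by rewrite /phi g'f.
have phiK q : O q -> psi (phi q) = q.
  by move=> [/gVU[_ fg _] /fUV'[_ g'f _]]; rewrite /psi /phi g'f.
have conv q : O q -> ~ D (g q) -> forall (T : C2) (s : R),
    O' (phi q + s%:C *: T) -> O' (phi q - s%:C *: T) ->
    D (g (psi (phi q + s%:C *: T))) -> D (g (psi (phi q - s%:C *: T))) -> False.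
  move=> [Vq U'gq] nD T s Op Om Dp Dm.
  have im Q : O' Q -> D (g (psi Q)) -> (toC @^-1` (f' @` (D `&` U'))) (ofC Q).
    move=> [/gVU'[U'g' f'g' _] /fUV[_ gf _]]; rewrite /psi gf => Dg'.
    by rewrite /preimage/= toC_ofC; exists (g' Q).
  have := convex_midpoint cvx (im _ Op Dp) (im _ Om Dm).
  rewrite /preimage/= toC_midpoint => -[y [Dy U'y] f'y].
  apply: nD; have [_ <- _] := fUV' _ U'gq; rewrite -/(phi q) -f'y.
  by have [_ -> _] := fUV' _ U'y.
exists O, phi, psi; split.
- by [].
- move=> i q; exact: (Kform_differentiable oO oO' phid psid phiO).
- move=> i q; exact: (Lform_differentiable oO oO' phid psid phiO).
- move=> i q; exact: (Nform_differentiable oO oO' phid psid phiO).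
- exact: (@second_order R phi psi O O' [set q | D (g q)] F oO oO' O0 phid psid phiO phiK Fs domE conv).
Qed.

End Geometry.

(** * Iterated finite differences *)

Section FiniteDifferences.
Context {R : realType} {n : nat}.
Local Notation V := 'rV[R]_n.
Implicit Types (G : V -> R) (X Y : V) (s l : seq 'I_n) (h : R).

(** The difference in the first direction of [s] is taken last, so that the mean
   value theorem produces the derivatives in reverse order. *)
Fixpoint fdiff h s G X : R :=
  if s is i :: s' then fdiff h s' G (X + h *: delta_mx 0 i) - fdiff h s' G X
  else G X.

Variables (G : seq 'I_n -> V -> R) (r : R).
Hypothesis GD : forall X, (forall j, `|X 0 j| < r) -> forall s,
  differentiable (G s) X /\ forall i, 'D_'e_i (G s) X = G (i :: s) X.

Let Sn (m : nat) (h x : R) : x + m.+1%:R * h = x + h + m%:R * h.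
Proof. by rewrite -[m.+1]add1n natrD mulrDl mul1r addrA. Qed.

Let step_le h i X t j : 0 <= h -> 0 <= t <= 1 ->
  `|(X + t *: (h *: delta_mx 0 i)) 0 j| <= `|X 0 j| + h.
Proof.
move=> h0 /andP[t0 t1]; rewrite !mxE eqxx/=.
apply: le_trans (ler_normD _ _) _; rewrite lerD2l !normrM !ger0_norm ?ler0n//.
apply: (@le_trans _ _ (1 * (h * 1))); last by rewrite !mul1r mulr1.
by rewrite ler_pM ?mulr_ge0 ?ler0n// ler_wpM2l// lern1 leq_b1.
Qed.

Lemma is_derive_fdiff h s l i X (t : R) : 0 <= h -> 0 <= t <= 1 ->
  (forall j, `|X 0 j| + h + (size s)%:R * h < r) ->
  is_derive t 1 (fun a : R => fdiff h s (G l) (X + a *: (h *: delta_mx 0 i)))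
    (h * fdiff h s (G (i :: l)) (X + t *: (h *: delta_mx 0 i))).
Proof.
move=> h0 t01; elim: s X => [|k s IH] X Xr /=.
  have Xr0 j : `|X 0 j| + h < r by have := Xr j; rewrite /= mul0r addr0.
  have [dG Gi] := GD (fun j => le_lt_trans (step_le i X j h0 t01) (Xr0 j)) l.
  rewrite -Gi; have <- : 'D_(h *: delta_mx 0 i) (G l) (X + t *: (h *: delta_mx 0 i)) =
    h * 'D_'e_i (G l) (X + t *: (h *: delta_mx 0 i)) by rewrite !deriveE// linearZ.
  exact: is_derive_line.
have E a : X + a *: (h *: delta_mx 0 i) + h *: delta_mx 0 k =
  (X + h *: delta_mx 0 k) + a *: (h *: delta_mx 0 i) by rewrite addrAC.
rewrite mulrBr E (_ : (fun a : R => _) =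
  (fun a : R => fdiff h s (G l) ((X + h *: delta_mx 0 k) + a *: (h *: delta_mx 0 i))) -
  (fun a : R => fdiff h s (G l) (X + a *: (h *: delta_mx 0 i)))); last first.
  by apply/funext => a; rewrite E.
apply: is_deriveB; apply: IH => j.
  apply: le_lt_trans (Xr j); rewrite /= Sn !lerD2r; have := step_le k X j h0 (_ : 0 <= 1 <= 1).
  by rewrite scale1r; apply; rewrite ler01 lexx.
apply: le_lt_trans (Xr j); by rewrite /= Sn lerD2r lerDl.
Qed.

Lemma fdiff_mean_value h s l X : 0 <= h ->
  (forall j, `|X 0 j| + (size s)%:R * h < r) ->
  exists Y, (forall j, `|Y 0 j| <= `|X 0 j| + (size s)%:R * h) /\
    fdiff h s (G l) X = h ^+ size s * G (catrev s l) Y.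
Proof.
move=> h0; elim: s l X => [|i s IH] l X Xr.
  by exists X; split=> [j|]; rewrite /= ?mul0r ?addr0// mul1r.
have Xr' j : `|X 0 j| + h + (size s)%:R * h < r by rewrite -Sn; exact: Xr.
have [c c01 Hc] := mean_value01 (fun t t01 => is_derive_fdiff l i h0 t01 Xr').
have [|Y [YX YE]] := IH (i :: l) (X + c *: (h *: delta_mx 0 i)).
  by move=> j; apply: le_lt_trans (Xr' j); rewrite lerD2r step_le.
exists Y; split=> [j|] /=.
  by rewrite Sn; apply: le_trans (YX j) _; rewrite lerD2r step_le.
by move: Hc; rewrite scale1r scale0r addr0 => ->; rewrite YE exprS mulrA.
Qed.

Lemma fdiff_bound h s g B X : 0 <= h ->
  (forall Y, (forall j, `|Y 0 j| <= `|X 0 j| + (size s)%:R * h) ->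
     (forall j, j \notin s -> Y 0 j = X 0 j) -> `|g Y| <= B) ->
  `|fdiff h s g X| <= 2 ^+ size s * B.
Proof.
move=> h0; elim: s X => [|i s IH] X H /=.
  by rewrite mul1r; apply: H => // j; rewrite mul0r addr0.
rewrite exprS -mulrA mulr2n mulrDl mul1r.
apply: le_trans (ler_normB _ _) _; apply: lerD; apply: IH => Y Y1 Y2; apply: H => j.
- rewrite /= Sn; apply: le_trans (Y1 j) _; rewrite lerD2r.
  by have := step_le i X j h0 (_ : 0 <= 1 <= 1); rewrite scale1r; apply; rewrite ler01 lexx.
- rewrite inE negb_or => /andP[ji /Y2 ->]; rewrite !mxE (negbTE ji) andbF mulr0n.
  by rewrite mulr0 addr0.
- rewrite /= Sn; apply: le_trans (Y1 j) _; rewrite lerD2r lerDl//.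
- by rewrite inE negb_or => /andP[_ /Y2].
Qed.

End FiniteDifferences.

Section SmallOnSubspace.
Context {R : realType} {n : nat}.
Local Notation V := 'rV[R]_n.

(** Derivatives in the directions of [s] only see the coordinate subspace
   spanned by them; comparing orders with the iterated differences avoids the
   symmetry of the mixed derivatives. *)
Lemma derivative_eq0_small (G : seq 'I_n -> V -> R) (s : seq 'I_n) :
  (\forall X \near (0 : V), forall s, differentiable (G s) X /\
     forall i, 'D_'e_i (G s) X = G (i :: s) X) ->
  (forall e : R, 0 < e -> \forall h \near (0 : R)^'+, forall Y : V,
     (forall j, `|Y 0 j| <= h) -> (forall j, j \notin s -> Y 0 j = 0) ->
     `|G [::] Y| <= e * h ^+ size s) ->
  G (catrev s [::]) 0 = 0.
Proof.
move=> GD small; set m := size s.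
have [/differentiable_continuous Gc _] := nbhs_singleton GD (catrev s [::]).
have /nbhs_coordP[r r0 Hr] := GD.
have {}Hr (X : V) : (forall j, `|X 0 j| < r) -> forall s, differentiable (G s) X /\
     forall i, 'D_'e_i (G s) X = G (i :: s) X.
  by move=> Xr; rewrite -[X]add0r; exact: Hr.
apply/eqP; rewrite -normr_le0; apply/ler_addgt0Pr => e e0; rewrite add0r.
pose c : R := 2 ^+ m * m.+1%:R ^+ m.
have c0 : 0 < c by rewrite mulr_gt0// exprn_gt0.
have ec : 0 < e / 2 / c by rewrite !divr_gt0.
have : \forall X \near (0 : V), `|G (catrev s [::]) 0 - G (catrev s [::]) X| < e / 2.
  by move: Gc => /cvgrPdist_lt; apply; rewrite divr_gt0.
move=> /nbhs_coordP[d d0 Hd].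
near (0 : R)^'+ => h.
have h0 : 0 < h by near: h; exact: nbhs_right_gt.
have hr : h < r by near: h; exact: nbhs_right_lt.
have hd : h < d by near: h; exact: nbhs_right_lt.
have Gh : forall Y : V, (forall j, `|Y 0 j| <= h) -> (forall j, j \notin s -> Y 0 j = 0) ->
     `|G [::] Y| <= e / 2 / c * h ^+ m by near: h; exact: small.
(* m steps of this size remain in the cube of radius h *)
pose h1 := h / m.+1%:R.
have h10 : 0 < h1 by rewrite divr_gt0.
have mh : m%:R * h1 <= h.
  by rewrite mulrC -mulrA ler_piMr ?(ltW h0)// mulrC ler_pdivrMr// mul1r ler_nat.
have zr j : `|(0 : V) 0 j| + m%:R * h1 <= h by rewrite mxE normr0 add0r.
have [Y [Ym YE]] := fdiff_mean_value Hr [::] (ltW h10) (fun j => le_lt_trans (zr j) hr).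
have Yh j : `|Y 0 j| <= h := le_trans (Ym j) (zr j).
have YB : `|G (catrev s [::]) Y| <= e / 2.
  have := @fdiff_bound R n h1 s (G [::]) (e / 2 / c * h ^+ m) 0 (ltW h10).
  rewrite YE normrM (ger0_norm (exprn_ge0 _ (ltW h10))) -/m => B.
  rewrite -(ler_pM2l (exprn_gt0 m h10)).
  have -> : h1 ^+ m * (e / 2) = 2 ^+ m * (e / 2 / c * h ^+ m).
    rewrite /h1 /c expr_div_n; field.
    by rewrite !expf_neq0// pnatr_eq0.
  apply: B => Z Z1 Z2; apply: Gh => j; first exact: le_trans (Z1 j) (zr j).
  by move=> js; rewrite Z2// mxE.
have := Hd Y (fun j => le_lt_trans (Yh j) hd); rewrite add0r => D.
rewrite -[G _ 0](subrK (G (catrev s [::]) Y)).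
apply: le_trans (ler_normD _ _) _.
by rewrite [e]splitr lerD// ltW.
Unshelve. all: by end_near. Qed.

End SmallOnSubspace.

Section Unweighted.
Context {R : realType}.
Local Notation C := R[i].
Local Notation R3 := 'rV[R]_3.
Implicit Types (F : R3 -> R) (P : C -> R -> R).

Lemma sum_wt3 a b s :
  (\sum_(i <- s) wt3 a b i = a * count (predC1 iu) s + b * count_mem iu s)%N.
Proof.
elim: s => [|i s IH]; first by rewrite big_nil !muln0.
rewrite big_cons IH /wt3/=; case: (i == iu); rewrite ?add0n ?add1n ?mulnS; ring.
Qed.

Lemma derive_iu0 P X : (forall z u, P z u = P z 0) ->
  'D_'e_iu (real3 P) X = 0.
Proof.
move=> P0; have H : is_derive (0 : R) 1 (fun a : R => real3 P (a *: delta_mx 0 iu + X)) 0.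
  rewrite (_ : (fun a => _) = fun=> real3 P X); first exact: is_derive_cst.
  by apply/funext => a; rewrite /real3 P0 [RHS]P0 !mxE/= !mulr0 !add0r.
by have [_ ->] := is_derive_along H.
Qed.

(** A derivative of weight at most [k] is either the derivative in [u], under
   which [P] is constant, or one of order at most [k] in [x] and [y]; for the
   latter the estimate on the plane [u = 0] suffices. *)
Lemma unweighted_remainder k F P : (0 < k)%N -> smooth_near F 0 ->
  (forall i, partials [:: i] F 0 = 0) -> polyfun (real3 P) ->
  (forall z u, P z u = P z 0) ->
  (fun X => F X - real3 P X) =o_ (0 : R3) real3 (fun z u => normc z ^+ k + `|u|) ->
  forall s, (\sum_(i <- s) wt3 1 k i <= k)%N ->
    partials s (fun X => F X - real3 P X) 0 = 0.
Proof.
move=> k0 Fs F1 pP P0 Fo s; have [us|us] := boolP (iu \in s).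
  move=> sk; have -> : s = [:: iu].
    case: s us sk => // i s; rewrite inE big_cons /wt3; case: (eqVneq iu i) => [<- _|ui /= us].
      rewrite -[leqRHS]addn0 leq_add2l sum_wt3; case: s => // j s.
      by rewrite /=; case: (j == iu) => /=; rewrite ?add0n ?add1n ?mulnS; lia.
    rewrite sum_wt3.
    have : (0 < count_mem iu s)%N by rewrite -has_count has_pred1.
    by case: (count_mem iu s) => // m _; rewrite mulnS; lia.
  rewrite partialsB_at0// F1 sub0r; apply/eqP; rewrite oppr_eq0; apply/eqP.
  exact: derive_iu0.
rewrite sum_wt3 (count_memPn us) muln0 addn0 mul1n => sk.
have {}sk : (size s <= k)%N.
  apply: leq_trans sk; rewrite -(count_predC (pred1 iu)) (count_memPn us) add0n//.
rewrite partialsB_at0//.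
have <- : catrev (rev s) [::] = s := revK s.
apply: (@derivative_eq0_small R 3 (fun l X => partials l F X - partials l (real3 P) X)).
  apply: filterS Fs => Y FY l.
  have d1 : differentiable (partials l F) Y := FY l.
  have d2 : differentiable (partials l (real3 P)) Y.
    by apply: polyfun_differentiable; exact: polyfun_partials.
  split=> [|i]; first exact: differentiableB.
  exact: (deriveB (diff_derivable d1) (diff_derivable d2)).
move=> e e0.
have e1 : 0 < e / 2 ^+ k by rewrite divr_gt0// exprn_gt0.
have /eqoP/(_ _ e1)/nbhs_coordP[r r0 Hr] := Fo.
near=> h => Y Yh Ys.
have h0 : 0 < h by near: h; exact: nbhs_right_gt.
have h1 : h <= 1 by near: h; exact: nbhs_right_le.
have hr : h < r by near: h; exact: nbhs_right_lt.
have := Hr Y (fun j => le_lt_trans (Yh j) hr); rewrite add0r.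
have -> : real3 (fun z u => normc z ^+ k + `|u|) Y = normc (Y 0 ix +i* Y 0 iy) ^+ k.
  by rewrite /real3 (Ys iu) ?mem_rev// normr0 addr0.
move=> H; apply: le_trans H _.
rewrite size_rev -mulrA ler_pM2l// ger0_norm ?exprn_ge0 ?normc_ge0//.
rewrite mulrC ler_pdivrMr ?exprn_gt0//.
apply: (@le_trans _ _ ((h * 2) ^+ k)).
  rewrite lerXn2r ?nnegrE ?normc_ge0 ?mulr_ge0 ?(ltW h0)//.
  apply: le_trans (normc_le_ReIm _) _ => /=.
  by have := Yh ix; have := Yh iy; lra.
by rewrite exprMn ler_wpM2r ?exprn_ge0// ler_wiXn2l// ltW.
Unshelve. all: by end_near. Qed.

End Unweighted.

(** * The harmonic correction *)

Section Correction.
Context {R : realType}.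
Local Notation C := R[i].
Local Notation C2 := 'rV[C]_2.

Lemma harmonic_correction (D : set C2) (p : C2) f g F k mu P (a b N : nat) :
  normal_coordinates D p f g F -> locally_convexifiable D p ->
  (0 < a)%N -> (0 < b)%N -> (b <= N)%N -> (a + a <= N)%N ->
  weight_homogeneous k mu 1 P ->
  (forall (t : R) (z : C) u, P ((t ^+ a)%:C * z) (t ^+ b * u) = t ^+ N * P z u) ->
  (forall s, (\sum_(i <- s) wt3 a b i <= N)%N ->
    partials s (fun X => F X - real3 P X) 0 = 0) ->
  (forall i j, (a * i + b * j)%N = (N - (a + a))%N -> weight k mu i.+2 j = 1) ->
  exists2 h, Hspace k mu h & forall z u zeta,
    0 <= Dz2 (fun z' u' => P z' u' + h z' u') z u zeta.
Proof.
move=> Dn Dc a0 b0 bN aN Pw PN FP wN.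
have pP := weight_homogeneous_polyfun Pw.
have [_ _ Fs [_ F1] _] := Dn.
have [ O [phi [psi [ [oO O0] Kd Ld Nd ineq]]]] := tangential_inequality Dn Dc.
have [q [qw qP]] := convex_limit a0 b0 bN aN pP PN Fs F1 FP oO O0 Kd Ld Nd ineq.
have qH : Hspace k mu (harmonic_primitive q).
  by apply: harmonic_primitive_Hspace => e /qw; exact: wN.
exists (harmonic_primitive q) => // z u zeta.
rewrite Dz2D//; last by have [/weight_homogeneous_polyfun] := qH.
by rewrite Dz2_harmonic_primitive; exact: qP.
Qed.

(** Multiplication by [k * denq mu] turns the weights into the integers [denq mu]
   and [k * numq mu]. *)
Lemma weight_nat k mu m l : (0 < k)%N -> 0 < mu ->
  weight k mu m l * (k * `|denq mu|)%N%:R = (`|denq mu| * m + k * `|numq mu| * l)%N%:R.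
Proof.
move=> k0 mu0.
have den : ((`|denq mu|)%:R : rat) = (denq mu)%:~R by rewrite -[in RHS]absz_denq.
have num : ((`|numq mu|)%:R : rat) = (numq mu)%:~R.
  by rewrite -[in RHS](gtz0_abs (_ : 0 < numq mu)) ?numq_gt0.
have kn : (k%:R : rat) != 0 by rewrite pnatr_eq0 -lt0n.
have dn : ((denq mu)%:~R : rat) != 0 by rewrite intr_eq0 denq_neq0.
rewrite /weight !natrM natrD !natrM den num -[in X in _ + _ * X](divq_num_den mu).
by move: (numq mu)%:~R (denq mu)%:~R dn => x y dn; field; rewrite kn dn.
Qed.

Lemma weighted_correction D p k mu P : (2 < k)%N -> is_weight_vector k mu ->
  weighted_model D p k mu P -> locally_convexifiable D p ->
  exists2 h, @Hspace R k mu h & forall z u zeta,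
    0 <= Dz2 (fun z' u' => P z' u' + h z' u') z u zeta.
Proof.
move=> k2 [mu0 [k1 [l [l0 wl]]]] [Pw [f [g [F [Dn Fw]]]]] Dc.
have k0 : (0 < k)%N by exact: leq_trans k2.
set a := `|denq mu|%N; set b := (k * `|numq mu|)%N; set N := (k * a)%N.
have a0 : (0 < a)%N by rewrite absz_gt0 denq_neq0.
have b0 : (0 < b)%N by rewrite muln_gt0 k0 absz_gt0 numq_eq0 gt_eqF.
have N0 : (0 : rat) < N%:R by rewrite ltr0n muln_gt0 k0.
have wE m j := weight_nat m j k0 mu0 : weight k mu m j * N%:R = (a * m + b * j)%N%:R.
have w1 m j : weight k mu m j = 1 <-> (a * m + b * j)%N = N.
  split=> [w|w]; first by apply/eqP; rewrite -(eqr_nat rat) -wE w mul1r.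
  by apply: (mulIf (lt0r_neq0 N0)); rewrite wE w mul1r.
have bN : (b <= N)%N.
  have /w1 <- := wl.
  by rewrite (leq_trans _ (leq_addl _ _))// leq_pmulr.
have aN : (a + a <= N)%N by rewrite addnn -mul2n leq_mul2r ltnW// orbT.
apply: (harmonic_correction Dn Dc a0 b0 bN aN Pw).
- by apply: weight_homogeneous_scale Pw => m j /w1.
- move=> s; rewrite sum_wt3 => sN; apply: Fw.
  by rewrite -(ler_pM2r N0) wE mul1r ler_nat.
- move=> i j ij; apply/w1; rewrite -addn2 mulnDr muln2 -addnn addnAC ij subnK//.
Qed.

Lemma unweighted_correction D p k P : (2 < k)%N ->
  unweighted_model D p k P -> locally_convexifiable D p ->
  exists2 h, @Hspace R k 0 h & forall z u zeta,
    0 <= Dz2 (fun z' u' => P z' u' + h z' u') z u zeta.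
Proof.
move=> k2 [Pw [a0 [c [_ PE]]] [f [g [F [Dn Fo]]]]] Dc.
have k0 : (0 < k)%N by exact: leq_trans k2.
have kn : (k%:R : rat) != 0 by rewrite pnatr_eq0 -lt0n.
have P0 z u : P z u = P z 0 by rewrite !PE.
have w1 m j : weight k 0 m j = 1 <-> m = k.
  rewrite /weight mulr0 addr0; split=> [w|->]; last by rewrite divff.
  apply/eqP; rewrite -(eqr_nat rat); apply/eqP.
  by rewrite -[LHS](divfK kn) w mul1r.
have [_ _ Fs [_ F1] _] := Dn.
apply: (harmonic_correction (a := 1) (b := k) (N := k) Dn Dc _ _ _ _ Pw) => //.
- by rewrite ltnW.
- move=> t z u; rewrite P0 [in RHS]P0.
  have h := @weight_homogeneous_scale R k 0 P 1 0 k _ Pw.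
  rewrite -h; first by rewrite mulr0.
  by move=> m l /w1 ->; rewrite mul1n mul0n addn0.
- exact: unweighted_remainder (weight_homogeneous_polyfun Pw) P0 Fo.
- move=> i [|j]; last by rewrite mulnS; lia.
  rewrite mul1n muln0 addn0 => ->; apply/w1; rewrite -[LHS]addn2 subnK// ltnW//.
Qed.

End Correction.

Theorem propositionB (R : realType) (D : set 'rV[R[i]]_2) (p : 'rV[R[i]]_2)
    (k : nat) (mu : rat) (P : R[i] -> R -> R)
    (D_open : open D) (D_connected : connected D)
    (D_smooth : smooth_boundary D) (D_pseudoconvex : pseudoconvex D)
    (p_bd : bd D p) (p_type : finite_type D p k) (k_gt2 : (2 < k)%N)
    (mu_weight : weight_of_w D p k mu)
    (P_model : generalized_model D p k mu P)
    (M_convexifiable : locally_convexifiable D p) :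
  exists2 h, Hspace k mu h &
    forall (z : R[i]) (u : R) (zeta : R[i]),
      Normc.normc z ^+ 2 + u ^+ 2 = 1 -> Normc.normc zeta = 1 ->
      0 <= Dz2 (fun z' u' => P z' u' + h z' u') z u zeta.
Proof.
suff [h hH Hh] : exists2 h, Hspace k mu h & forall z u zeta,
    0 <= Dz2 (fun z' u' => P z' u' + h z' u') z u zeta.
  by exists h => // z u zeta _ _; exact: Hh.
case: P_model => [[mu0 Pm]|[mu0 Pm]].
  have muw : is_weight_vector k mu.
    by case: mu_weight => [[_ [] //]|[mu00 _]]; rewrite mu00 ltxx in mu0.
  exact: weighted_correction Pm M_convexifiable.
by rewrite mu0; exact: unweighted_correction Pm M_convexifiable.
Qed.
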